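(* Let $L_0\in\operatorname{GL}_{2d}(\mathbb{R})$ and suppose $f_0\in\mathcal{E}_{L_0}(\mathbb{R}^d)$ is such that $\mathcal{G}(f_0,L_0)$ is a Gabor frame for $L^2(\mathbb{R}^d)$. Then for every continuous section $\Upsilon\in\Gamma(\kappa)$ that passes through $f_0$ (i.e. $\Upsilon(L_0)=f_0$), there exists an open set $U_0\subseteq\operatorname{GL}_{2d}(\mathbb{R})$ containing $L_0$ such that $\mathcal{G}(\Upsilon(L),L)$ is a Gabor frame for $L^2(\mathbb{R}^d)$ for all $L\in U_0$.
   Context: Fix $d\ge1$; $\operatorname{GL}_{2d}(\mathbb{R})$ has its usual topology. For $z=(x,\omega)\in\mathbb{R}^{2d}$, $(\pi(z)f)(t)=e^{2\pi i\,t\cdot\omega}f(t-x)$ on $L^2(\mathbb{R}^d)$. For $g\in L^2(\mathbb{R}^d)$ and $L\in\operatorname{GL}_{2d}(\mathbb{R})$, $\mathcal{G}(g,L)=\{\pi(Lk)g\}_{k\in\mathbb{Z}^{2d}}$. It is a Gabor frame if there are $A,B>0$ with $A\|f\|_2^2\le\sum_k|\langle f,\pi(Lk)g\rangle|^2\le B\|f\|_2^2$ for all $f\in L^2(\mathbb{R}^d)$; any $B>0$ satisfying the right inequality is a Bessel bound. Put $\phi(t)=e^{-\pi\|t\|^2}$, $\mathcal{V}_\phi f(z)=\langle f,\pi(z)\phi\rangle_2$, $\nu(z)=1+\sum_i|z_i|$, $M^1_\nu(\mathbb{R}^d)=\{f\in L^2(\mathbb{R}^d):\mathcal{V}_\phi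 f\cdot\nu\in L^1(\mathbb{R}^{2d})\}$. The Heisenberg module $\mathcal{E}_L(\mathbb{R}^d)\subseteq L^2(\mathbb{R}^d)$ is the completion of $M^1_\nu(\mathbb{R}^d)$, realized inside $L^2(\mathbb{R}^d)$, in the norm $\|f\|_{\mathcal{E}_L(\mathbb{R}^d)}=\inf\{C^{1/2}:C\text{ is a Bessel bound for }\mathcal{G}(f,L)\}$. Let $\kappa:\mathcal{E}=\bigsqcup_{L}\mathcal{E}_L(\mathbb{R}^d)\to\operatorname{GL}_{2d}(\mathbb{R})$ be the projection; $\mathcal{E}$ has the topology with basis $\{s\in\mathcal{E}_L(\mathbb{R}^d):L\in U,\ \|s-f\|_{\mathcal{E}_L(\mathbb{R}^d)}<\varepsilon\}$ ($f\in M^1_\nu(\mathbb{R}^d)$, $U\subseteq\operatorname{GL}_{2d}(\mathbb{R})$ open, $\varepsilon>0$), making $\kappa$ a Banach bundle. $\Gamma(\kappa)$ is the space of continuous sections, i.e. continuous maps $\Upsilon:\operatorname{GL}_{2d}(\mathbb{R})\to\mathcal{E}$ with $\Upsilon(L)\in\mathcal{E}_L(\mathbb{R}^d)$ for all $L$; equivalently, sections such that for all $\varepsilon>0$ and $L_0$ there are $f\in M^1_\nu(\mathbb{R}^d)$ and a neighborhood $U$ of $L_0$ with $\|\Upsilon(L)-f\|_{\mathcal{E}_L(\mathbb{R}^d)}<\varepsilon$ for $L\in U$. *)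

(* Defs.v *)
From HB Require Import structures.
From mathcomp Require Import all_boot all_order all_algebra.
From mathcomp Require Import all_classical all_reals all_analysis.
From mathcomp Require Import complex.

Set Implicit Arguments.
Unset Strict Implicit.
Unset Printing Implicit Defensive.

Import Order.TTheory GRing.Theory Num.Theory.
Import numFieldNormedType.Exports.
Import ComplexField.Normc.

Local Open Scope classical_set_scope.
Local Open Scope ring_scope.

(** R^n is the type of column vectors ['cV[R]_n], with the sigma-algebra
    generated by the coordinate functions (the analogue of the library's
    structure on [n.-tuple]) and Lebesgue measure obtained by iterating the
    product with one-dimensional Lebesgue measure. *)

Definition measure_cV_display : measure_display.
Proof. exact: default_measure_display. Qed.

Section measurable_cV.
Context {R : realType} (n : nat).

Let coor : 'I_n -> 'cV[R]_n -> measurableTypeR R := fun i v => v i ord0.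

Let cV_set0 : g_sigma_preimage coor set0.
Proof. exact: sigma_algebra0. Qed.

Let cV_setC A : g_sigma_preimage coor A -> g_sigma_preimage coor (~` A).
Proof. exact: sigma_algebraC. Qed.

Let cV_bigcup (F : (set 'cV[R]_n)^nat) :
  (forall i, g_sigma_preimage coor (F i)) ->
  g_sigma_preimage coor (\bigcup_i (F i)).
Proof. exact: sigma_algebra_bigcup. Qed.

HB.instance Definition _ := @isMeasurable.Build measure_cV_display
  'cV[R]_n (g_sigma_preimage coor) cV_set0 cV_setC cV_bigcup.

Lemma measurable_coor (i : 'I_n) :
  measurable_fun [set: 'cV[R]_n] (fun v => v i ord0 : measurableTypeR R).
Proof.
move=> _ Y mY; rewrite setTI; apply: sub_sigma_algebra => /=.
rewrite -bigcup_seq/=; exists i => /=; first by rewrite mem_index_enum.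
by exists Y => //; rewrite setTI.
Qed.

Lemma measurable_fun_coorP d (T : measurableType d) (f : T -> 'cV[R]_n) :
  (forall i, measurable_fun [set: T] (fun x => f x i ord0 : measurableTypeR R)) ->
  measurable_fun [set: T] f.
Proof.
move=> mf _ A mA; rewrite setTI.
have : g_sigma_preimage coor `<=` [set B | measurable (f @^-1` B)].
  apply: smallest_sub.
    split=> /=.
    - by rewrite preimage_set0.
    - by move=> B mB; rewrite setTD preimage_setC; exact: measurableC.
    - by move=> F mF; rewrite preimage_bigcup; exact: bigcup_measurable.
  rewrite -bigcup_seq/=; apply: bigcup_sub => i _ B [C mC <-].
  by have := mf i measurableT C mC; rewrite !setTI.
exact.
Qed.

End measurable_cV.

Section lebesgue_cV.
Context {R : realType}.

Definition cons_cV n (p : 'cV[R]_n * measurableTypeR R) : 'cV[R]_n.+1 :=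
  col_mx (const_mx p.2 : 'cV[R]_1) p.1.

Lemma measurable_cons_cV n : measurable_fun setT (@cons_cV n).
Proof.
apply: measurable_fun_coorP => i; rewrite /cons_cV.
case: (@splitP 1 n i) => j ij.
- have -> : i = lshift n j :> 'I_(1 + n) by apply: val_inj.
  rewrite (_ : (fun _ => _) = snd); first exact: measurable_snd.
  by apply/funext => p; rewrite (@col_mxEu R 1 n) mxE.
- have -> : i = rshift 1 j :> 'I_(1 + n) by apply: val_inj.
  rewrite (_ : (fun _ => _) = (fun p => (p.1 : 'cV[R]_n) j ord0)); last first.
    by apply/funext => p; exact: (@col_mxEd R 1 n).
  exact: (measurableT_comp (measurable_coor j) measurable_fst).
Qed.

HB.instance Definition _ n :=
  isMeasurableFun.Build _ _ _ _ (@cons_cV n) (@measurable_cons_cV n).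

Section lebesgue_succ.
Variables (n : nat) (m : {measure set 'cV[R]_n -> \bar R}).

Definition lebesgue_succ : set 'cV[R]_n.+1 -> \bar R :=
  pushforward (m \x lebesgue_measure)%E (@cons_cV n).

Let lebesgue_succ0 : lebesgue_succ set0 = 0%E.
Proof. exact: measure0. Qed.

Let lebesgue_succ_ge0 A : (0 <= lebesgue_succ A)%E.
Proof. exact: measure_ge0. Qed.

Let lebesgue_succ_sigma_additive : semi_sigma_additive lebesgue_succ.
Proof. exact: measure_semi_sigma_additive. Qed.

HB.instance Definition _ := isMeasure.Build _ _ _ lebesgue_succ
  lebesgue_succ0 lebesgue_succ_ge0 lebesgue_succ_sigma_additive.

End lebesgue_succ.

Fixpoint lebesgue_cV n : {measure set 'cV[R]_n -> \bar R} :=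
  match n with
  | 0 => \d_(0 : 'cV[R]_0)
  | n'.+1 => lebesgue_succ (lebesgue_cV n')
  end.

End lebesgue_cV.

Section complex_functions.
Context {R : realType} {d} {T : measurableType d}.
Variable mu : {measure set T -> \bar R}.
Implicit Types f g : T -> R[i].

Definition cmeasurable f :=
  measurable_fun setT (fun t => complex.Re (f t)) /\
  measurable_fun setT (fun t => complex.Im (f t)).

Definition cintegrable f :=
  cmeasurable f /\ (\int[mu]_t (normc (f t))%:E < +oo)%E.

Definition cintegral f : R[i] :=
  ((\int[mu]_t complex.Re (f t)) +i* (\int[mu]_t complex.Im (f t)))%C.

Definition sqnorm f : \bar R := (\int[mu]_t (normc (f t) ^+ 2)%:E)%E.

Definition sqintegrable f := cmeasurable f /\ (sqnorm f < +oo)%E.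

Definition inner f g : R[i] := cintegral (fun t => f t * (g t)^*%C).

End complex_functions.

(** L^2(R^d): square-integrable functions modulo almost everywhere equality.
    An element of the quotient is used as a function through a chosen
    representative. *)
Section L2space.
Context {R : realType} (d : nat).
Local Notation mu := (lebesgue_cV d : {measure set 'cV[R]_d -> \bar R}).

Record L2fun := L2Fun {
  L2fun_fun :> 'cV[R]_d -> R[i];
  L2funP : sqintegrable mu L2fun_fun }.

HB.instance Definition _ := gen_eqMixin L2fun.
HB.instance Definition _ := gen_choiceMixin L2fun.

Definition L2_eq (f g : L2fun) : bool := `[< f = g %[ae mu] >].

Let L2_eq_refl : reflexive L2_eq.
Proof. by move=> f; apply/asboolP; exact: ae_eq_refl. Qed.

Let L2_eq_sym : symmetric L2_eq.
Proof.
by move=> f g; apply/idP/idP => /asboolP h; apply/asboolP; exact: ae_eq_sym.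
Qed.

Let L2_eq_trans : transitive L2_eq.
Proof.
move=> f g h /asboolP gf /asboolP fh; apply/asboolP; exact: ae_eq_trans gf fh.
Qed.

Canonical L2_eq_equiv := EquivRel L2_eq L2_eq_refl L2_eq_sym L2_eq_trans.

Local Open Scope quotient_scope.

Definition L2 : Type := {eq_quot L2_eq}.
HB.instance Definition _ := Choice.on L2.
HB.instance Definition _ := EqQuotient.on L2.

Definition L2_to_fun (f : L2) : 'cV[R]_d -> R[i] := repr f.
Coercion L2_to_fun : L2 >-> Funclass.

End L2space.
Arguments L2fun R d : clear implicits.
Arguments L2 R d : clear implicits.

(** The general linear group, with the subspace topology inherited from the
    space of matrices. *)
Definition GL (R : realType) (n : nat) : set 'M[R]_n :=
  [set M | M \in unitmx].
Arguments GL : clear implicits.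

Section gabor.
Context {R : realType} {d : nat}.
Local Notation Rd := 'cV[R]_d.
Local Notation R2d := 'cV[R]_(d + d).
Local Notation mu := (lebesgue_cV d : {measure set Rd -> \bar R}).
Local Notation mu2 := (lebesgue_cV (d + d) : {measure set R2d -> \bar R}).
Implicit Types (g : Rd -> R[i]) (L : 'M[R]_(d + d)).

Definition dotprod (x y : Rd) : R := \sum_i x i ord0 * y i ord0.

Definition expi (theta : R) : R[i] := (cos theta +i* sin theta)%C.

(* [z = (x, omega)]: [usubmx z] is [x] and [dsubmx z] is [omega] *)
Definition tfshift (z : R2d) g : Rd -> R[i] :=
  fun t => expi (2 * pi * dotprod t (dsubmx z)) * g (t - usubmx z).

Definition lattice_pt L (k : 'cV[int]_(d + d)) : R2d := L *m map_mx intr k.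

(* the sum of |<f, pi(Lk) g>|^2 over k in Z^{2d} *)
Definition gabor_sum g L (f : Rd -> R[i]) : \bar R :=
  \esum_(k in [set: 'cV[int]_(d + d)])
    ((normc (inner mu f (tfshift (lattice_pt L k) g)) ^+ 2)%:E).

Definition bessel_bound g L (B : R) : Prop :=
  0 < B /\ forall f : L2 R d, (gabor_sum g L f <= B%:E * sqnorm mu f)%E.

Definition gabor_frame g L : Prop :=
  exists A B : R, [/\ 0 < A, 0 < B &
    forall f : L2 R d, (A%:E * sqnorm mu f <= gabor_sum g L f)%E /\
                       (gabor_sum g L f <= B%:E * sqnorm mu f)%E].

Definition gaussian : Rd -> R[i] :=
  fun t => (expR (- pi * dotprod t t))%:C%C.

Definition stft (f : Rd -> R[i]) (z : R2d) : R[i] :=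
  inner mu f (tfshift z gaussian).

Definition weight (z : R2d) : R := 1 + \sum_i `|z i ord0|.

Definition M1nu : set (L2 R d) :=
  [set f : L2 R d | cintegrable mu2 (fun z => stft f z * (weight z)%:C%C)].

(* [+oo] when [(g, L)] has no Bessel bound *)
Definition heis_norm L g : \bar R :=
  ereal_inf [set (Num.sqrt C)%:E | C in [set C | bessel_bound g L C]].

(* The completion of [M1nu] for [heis_norm L], realized inside L^2: the
   L^2-limits of [heis_norm L]-Cauchy sequences in [M1nu]. *)
Definition heisenberg_module L : set (L2 R d) :=
  [set f : L2 R d | exists u : nat -> L2 R d,
    [/\ forall n, M1nu (u n),
        forall e : R, 0 < e -> exists N, forall m n, (N <= m)%N -> (N <= n)%N ->
          (heis_norm L (u m \- u n)%R < e%:E)%E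
      & sqnorm mu (u n \- f)%R @[n --> \oo] --> 0%E]].

End gabor.
Arguments M1nu R d : clear implicits.

Section bundle.
Context (R : realType) (d : nat).

(** The total space, i.e. the disjoint union of the Heisenberg modules; the
    bundle projection is [heis_base]. *)
Record heis_bundle := HeisBundle {
  heis_base : GL R (d + d);
  heis_vec : L2 R d;
  heis_vecP : heisenberg_module (sval heis_base) heis_vec }.

HB.instance Definition _ := gen_eqMixin heis_bundle.
HB.instance Definition _ := gen_choiceMixin heis_bundle.

Definition heis_basic (f : L2 R d) (U : set (GL R (d + d))) (e : R) :
    set heis_bundle :=
  [set s | U (heis_base s) /\
    (heis_norm (sval (heis_base s)) (heis_vec s \- f)%R < e%:E)%E].

Definition heis_basics : set (set heis_bundle) :=
  [set W | exists f U e, [/\ M1nu R d f, open U, 0 < e & W = heis_basic f U e]].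

(* The sets in [heis_basics] form a basis; declaring them as a subbase yields
   the same topology without a proof of that fact. *)
HB.instance Definition _ := @isSubBaseTopological.Build heis_bundle
  (set heis_bundle) heis_basics id.

Definition continuous_sections : set (GL R (d + d) -> heis_bundle) :=
  [set Y | continuous Y /\ forall L, heis_base (Y L) = L].

End bundle.
Arguments continuous_sections : clear implicits.

(* Main.v *)
From HB Require Import structures.
Require Import Defs.
From mathcomp Require Import all_boot all_order all_algebra.
From mathcomp Require Import all_classical all_reals all_analysis.
From mathcomp Require Import measurable_realfun real_interval complex zify ring lra.

(** Why frames persist along a continuous section.

    The lattice is deformed first, with the window fixed. Suppose that a window [f] in
    the weighted modulation space generates a frame along the lattice of [L0]. The system
    along the lattice of a nearby [L] is not a small perturbation of it, since [L k]
    and [L0 k] are far apart for large [k]. What survives is local: seen from a point of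
    the lattice of [L], the two lattices agree approximately on a bounded region, and
    this is enough when vectors at distant lattice points are almost orthogonal.
    [frame_deformation] makes this precise, with bounds that are uniform in [L].

    The almost orthogonality is the decay of the ambiguity function
    [amb f y = |<f, pi(y) f>|]: its weighted sums over all lattices near [L0], and over all
    their translates, are bounded by a common constant ([lattice_summable_amb]). This follows
    from the inversion formula [stft_inversion] of the short-time Fourier transform, by which
    [stft f] is dominated by its own convolution with a Gaussian and [amb f] by a
    convolution of [stft f] with itself. Hence everything is reduced to lattice sums of a
    Gaussian ([lattice_summable_gauss]). The inversion formula itself comes from Moyal's
    identity against indicators of boxes, with a cutoff in frequency that is removed by
    dominated convergence ([damped_moyal], [stft_box]).

    Given the decay, the argument of the deformation runs as follows. Schur's test gives a
    Bessel bound near [L0]. With the frame inequality at [L0] it shows that every [h] is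
    close to a finite combination of vectors [pi(L0 j) f] with controlled coefficients
    ([greedy_approx]). Such a combination is cut into the pieces carried by the boxes of a
    tiling of the index set. A pair of indices at distance [m] is separated by a fraction of
    at most [m / T] of the shifted tilings by boxes of side [T], and the sums of the
    interactions weighted by [m] converge. So for some tiling the cutting changes the
    squared norm and the square sum of the frame coefficients by a quantity of order [1 / T]
    ([tiling_estimate]). Each piece is then moved to the origin by a point of the lattice
    of [L], where the frame inequality at [L0] applies and only finitely many lattice points
    matter; for these, [pi(L k) f] tends to [pi(L0 k) f] as [L] tends to [L0]
    ([local_estimate]).

    Finally the window is moved. The Heisenberg norm of a difference of windows is the
    square root of its best Bessel bound, and the inequality
    [|x + y|^2 <= 2 |x|^2 + 2 |y|^2] shows that a lower frame bound survives a change of window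
    that is small in this norm ([frame_low_window]). This is used twice: at [L0], to replace
    [f0] by some [f] in the weighted modulation space; and at [L] near [L0], to replace [f] by
    the value of the section. The continuity of the section at [L0] says that this value
    remains close to [f] in the norms that vary with [L]. *)

Set Implicit Arguments.
Unset Strict Implicit.
Unset Printing Implicit Defensive.

Import Order.TTheory GRing.Theory Num.Theory.
Import numFieldNormedType.Exports.
Import ComplexField.Normc.

Local Open Scope classical_set_scope.
Local Open Scope ring_scope.

(** * Lebesgue measure on column vectors *)

Section lebesgue_cV_theory.
Context {R : realType}.
Local Notation leb1 := (@lebesgue_measure R).

(** Both sides agree on half-open intervals, and these determine the measure. *)
Lemma lebesgue_measure_translation (c : R) (A : set (measurableTypeR R)) :
  measurable A ->
  lebesgue_measure A =
  pushforward (@lebesgue_measure R) (fun x : measurableTypeR R => x + c : measurableTypeR R) A.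
Proof.
have mc : measurable_fun setT (fun x : measurableTypeR R => x + c : measurableTypeR R).
  exact: measurable_funD.
pose f : {mfun measurableTypeR R >-> measurableTypeR R} :=
  HB.pack (fun x : measurableTypeR R => x + c : measurableTypeR R)
    (isMeasurableFun.Build _ _ _ _ _ mc).
move=> mA; apply: (@lebesgue_measure_unique R (pushforward leb1 f)) => //.
move=> _ [[a b] _ <-]/=; rewrite /pushforward/=.
rewrite [X in _ = leb1 X](_ : _ = `](a - c), (b - c)]%classic).
  rewrite !lebesgue_measure_itv/= !lte_fin; rewrite ltrD2r; case: ifP => // _.
  by rewrite -!EFinB; congr (_%:E); lra.
by apply/seteqP; split => x/=; rewrite !in_itv/=; lra.
Qed.

Lemma ge0_integral_translation1 (c : R) (f : R -> \bar R) :
  measurable_fun setT f -> (forall x, 0 <= f x)%E ->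
  (\int[leb1]_x f (x + c)%R = \int[leb1]_x f x)%E.
Proof.
move=> mf f0.
have mc : measurable_fun setT (fun x : measurableTypeR R => x + c : measurableTypeR R).
  exact: measurable_funD.
pose g : {mfun measurableTypeR R >-> measurableTypeR R} :=
  HB.pack (fun x : measurableTypeR R => x + c : measurableTypeR R)
    (isMeasurableFun.Build _ _ _ _ _ mc).
have := @ge0_integral_pushforward _ _ _ _ R g mc leb1 setT f measurableT mf
  (fun y _ => f0 y).
rewrite preimage_setT => <-; apply/esym.
apply: (eq_measure_integral (pushforward leb1 g)) => A mA _.
exact: lebesgue_measure_translation.
Qed.

Definition cVbox n (A : 'I_n -> set R) : set 'cV[R]_n :=
  [set v | forall i, A i (v i ord0)].

Lemma measurable_cVbox n (A : 'I_n -> set (measurableTypeR R)) :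
  (forall i, measurable (A i)) -> measurable (cVbox A).
Proof.
move=> mA.
rewrite (_ : cVbox A = \bigcap_(i in [set: 'I_n])
   ((fun v : 'cV[R]_n => v i ord0 : measurableTypeR R) @^-1` (A i))).
  apply: fin_bigcap_measurable => // i _; rewrite -[X in measurable X]setTI.
  exact: (measurable_coor i).
by apply/seteqP; split => v /= h i; [move=> _; exact: h|exact: h].
Qed.

Lemma cons_cV0 n (p : 'cV[R]_n * measurableTypeR R) : cons_cV p ord0 ord0 = p.2.
Proof.
rewrite /cons_cV (_ : ord0 = lshift n (ord0 : 'I_1)); last exact: val_inj.
by rewrite (@col_mxEu R 1 n) mxE.
Qed.

Lemma cons_cVS n (p : 'cV[R]_n * measurableTypeR R) i :
  cons_cV p (lift ord0 i) ord0 = p.1 i ord0.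
Proof.
rewrite /cons_cV (_ : lift ord0 i = rshift 1 i); last exact: val_inj.
by rewrite (@col_mxEd R 1 n).
Qed.

Lemma lebesgue_cVbox n (A : 'I_n -> set (measurableTypeR R)) :
  (forall i, measurable (A i)) ->
  lebesgue_cV n (cVbox A) = (\prod_(i < n) leb1 (A i))%E.
Proof.
elim: n A => [|n IH] A mA.
  rewrite /= big_ord0 diracE mem_set//; by case.
rewrite big_ord_recl/= /lebesgue_succ /pushforward.
rewrite (_ : _ @^-1` _ = cVbox (A \o lift ord0) `*` A ord0).
  rewrite product_measure1E//; last by apply: measurable_cVbox => i; exact: mA.
  by rewrite IH; [rewrite muleC|move=> i; exact: mA].
apply/seteqP; split => [p/= h|p [/= h1 h2] i].
  split => /= [i|].
    by have := h (lift ord0 i); rewrite cons_cVS.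
  by have := h ord0; rewrite cons_cV0.
have [j ->|->] := unliftP ord0 i; by [rewrite cons_cVS; exact: h1|rewrite cons_cV0].
Qed.

Definition cube n (k : nat) : set 'cV[R]_n :=
  cVbox (fun=> `[- k%:R, k%:R]%classic).
Arguments cube : clear implicits.

Lemma bigcup_cube n : \bigcup_k (cube n k) = [set: 'cV[R]_n].
Proof.
apply/seteqP; split => // v _.
pose M := (\sum_i `|v i ord0|).
exists (Num.truncn M).+1 => // i; rewrite /= in_itv/= -ler_norml.
apply: le_trans (ltW (truncnS_gt M)).
by rewrite /M (bigD1 i)//= lerDl sumr_ge0.
Qed.

Lemma lebesgue_cube_lty n k : (lebesgue_cV n (cube n k) < +oo)%E.
Proof.
rewrite lebesgue_cVbox// lebesgue_measure_itv/=.
case: ifP => _; rewrite -?EFinB.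
  by rewrite prodEFin ltry.
by rewrite (_ : 0%E = (0 : R)%:E)// prodEFin ltry.
Qed.

Lemma lebesgue_cV_sigma_finite n :
  sigma_finite [set: 'cV[R]_n] (lebesgue_cV n).
Proof.
exists (cube n); first by rewrite bigcup_cube.
by move=> k; split; [exact: measurable_cVbox|exact: lebesgue_cube_lty].
Qed.

(** [lebesgue_cV n] computes to an already packaged measure, so that its
    sigma-finiteness is attached to this unpackaged copy. *)
Definition lebcV n : set 'cV[R]_n -> \bar R := lebesgue_cV n.
HB.instance Definition _ n := Measure.copy (@lebcV n) (lebesgue_cV n).
HB.instance Definition _ n := Measure_isSigmaFinite.Build _ _ _ (@lebcV n)
  (lebesgue_cV_sigma_finite n).

Lemma lebcVE n : @lebcV n = lebesgue_cV n. Proof. by []. Qed.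

Lemma ge0_integral_cVS n (f : 'cV[R]_n.+1 -> \bar R) :
  measurable_fun setT f -> (forall x, 0 <= f x)%E ->
  (\int[lebesgue_cV n.+1]_v f v =
   \int[lebesgue_cV n]_v \int[leb1]_s f (cons_cV (v, s)))%E.
Proof.
move=> mf f0; rewrite /=.
rewrite (ge0_integral_pushforward (@measurable_cons_cV R n))//=.
rewrite -lebcVE preimage_setT.
rewrite (@fubini_tonelli1 _ _ _ _ _ (@lebcV n) leb1)//.
  by apply: measurableT_comp => //; exact: (@measurable_cons_cV R n).
Qed.

Lemma integral_cVS n (f : 'cV[R]_n.+1 -> \bar R) :
  (lebesgue_cV n.+1).-integrable setT f ->
  (\int[lebesgue_cV n.+1]_v f v =
   \int[lebesgue_cV n]_v \int[leb1]_s f (cons_cV (v, s)))%E.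
Proof.
move=> /integrableP[mf intf].
have ifc : ((@lebcV n) \x leb1)%E.-integrable setT (f \o @cons_cV R n).
  apply/integrableP; split.
    by apply: measurableT_comp => //; exact: (@measurable_cons_cV R n).
  rewrite lebcVE; apply: le_lt_trans intf.
  rewrite (ge0_integral_pushforward (@measurable_cons_cV R n)) ?preimage_setT//.
  exact: measurableT_comp.
rewrite /= integral_pushforward//.
rewrite preimage_setT.
exact/esym/(integral12_prod_meas1 ifc).
Qed.

Lemma measurable_addcV n (w : 'cV[R]_n) :
  measurable_fun setT (fun v : 'cV[R]_n => v + w).
Proof.
apply: measurable_fun_coorP => i; under eq_fun do rewrite mxE.
by apply: measurable_funD => //; exact: measurable_coor.
Qed.

(** Induction on the dimension: Tonelli's theorem separates the first coordinate,
    where the one-dimensional translation invariance applies. *)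
Lemma ge0_integral_translation n (w : 'cV[R]_n) (f : 'cV[R]_n -> \bar R) :
  measurable_fun setT f -> (forall x, 0 <= f x)%E ->
  (\int[lebesgue_cV n]_v f (v + w)%R = \int[lebesgue_cV n]_v f v)%E.
Proof.
elim: n w f => [|n IH] w f mf f0.
  by apply: eq_integral => v _; congr f; apply/matrixP => -[].
rewrite (@ge0_integral_cVS n f)//.
rewrite [LHS](@ge0_integral_cVS n (fun v => f (v + w))); [|
  exact: (measurableT_comp mf (measurable_addcV w))|by []].
pose w' : 'cV[R]_n := \col_i w (lift ord0 i) ord0.
have E (v : 'cV[R]_n) (s : R) : cons_cV (v, s : measurableTypeR R) + w =
    cons_cV (v + w', s + w ord0 ord0 : measurableTypeR R).
  apply/matrixP => i j; rewrite (ord1 j) mxE.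
  have [k ->|->] := unliftP ord0 i; first by rewrite !cons_cVS/= !mxE.
  by rewrite !cons_cV0.
have mfc : measurable_fun setT (f \o @cons_cV R n).
  by apply: measurableT_comp => //; exact: (@measurable_cons_cV R n).
transitivity (\int[lebesgue_cV n]_v (fun v' => \int[leb1]_s f (cons_cV (v', s))) (v + w')%R)%E.
  apply: eq_integral => v _; under eq_integral do rewrite E.
  apply: (ge0_integral_translation1 (w ord0 ord0)
    (f := fun s => f (cons_cV (v + w', s)))) => //.
  exact: (measurableT_comp mfc (pair1_measurable _)).
apply: (IH w' (fun v' => \int[leb1]_s f (cons_cV (v', s)))%E).
  apply: (@measurable_fun_fubini_tonelli_F _ _ _ _ _ leb1 (f \o @cons_cV R n)) => //.
  by move=> x; exact: f0.
by move=> x; exact: integral_ge0.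
Qed.

Lemma integral_translation n (w : 'cV[R]_n) (f : 'cV[R]_n -> \bar R) :
  measurable_fun setT f ->
  (\int[lebesgue_cV n]_v f (v + w)%R = \int[lebesgue_cV n]_v f v)%E.
Proof.
move=> mf; rewrite integralE [RHS]integralE; congr (_ - _)%E.
  rewrite -[RHS](@ge0_integral_translation n w f^\+%E)//.
    by apply: eq_integral => v _; rewrite (funepos_comp f (fun x => x + w)).
  exact: measurable_funepos.
rewrite -[RHS](@ge0_integral_translation n w f^\-%E)//.
  by apply: eq_integral => v _; rewrite (funeneg_comp f (fun x => x + w)).
exact: measurable_funeneg.
Qed.

Lemma measurable_prod_coor n (g : 'I_n -> R -> R) :
  (forall i, measurable_fun setT (g i)) ->
  measurable_fun setT (fun v : 'cV[R]_n => \prod_i g i (v i ord0)).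
Proof.
move=> mg; apply: measurable_prod => i _.
exact: (measurableT_comp (mg i) (measurable_coor i)).
Qed.

(** This is how all Gaussian integrals and all integrals over boxes below reduce
    to dimension one. *)
Lemma ge0_integral_prod n (g : 'I_n -> R -> R) :
  (forall i, measurable_fun setT (g i)) -> (forall i x, 0 <= g i x) ->
  (\int[lebesgue_cV n]_v (\prod_i g i (v i ord0))%:E =
   \prod_(i < n) \int[leb1]_s (g i s)%:E)%E.
Proof.
elim: n g => [|n IH] g mg g0.
  rewrite big_ord0; under eq_integral do rewrite big_ord0.
  by rewrite integral_cst//= diracT mule1.
rewrite ge0_integral_cVS//; last 2 first.
  by apply/measurable_EFinP; exact: measurable_prod_coor.
  by move=> x; rewrite lee_fin prodr_ge0.
rewrite big_ord_recl -IH//.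
under eq_integral => v _.
  under eq_integral => s _.
    rewrite big_ord_recl cons_cV0/=.
    under eq_bigr do rewrite cons_cVS/=.
    rewrite EFinM.
    over.
  rewrite ge0_integralZr//; last 3 first.
    by apply/measurable_EFinP; exact: mg.
    by move=> x _; rewrite lee_fin.
    by rewrite lee_fin prodr_ge0.
  over.
rewrite ge0_integralZl//.
- by apply/measurable_EFinP; apply: (@measurable_prod_coor n (fun i => g (lift ord0 i))) => i; exact: mg.
- by move=> x _; rewrite lee_fin prodr_ge0.
- by apply: integral_ge0 => s _; rewrite lee_fin.
Qed.

End lebesgue_cV_theory.

(** * Complex integrals and the inner product of square-integrable functions *)

Section normc_theory.
Context {R : realType}.
Implicit Types z w : R[i].
Local Notation Re := complex.Re.
Local Notation Im := complex.Im.

Lemma normc_ge0 z : 0 <= normc z.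
Proof. by case: z => a b; exact: sqrtr_ge0. Qed.

Lemma sqr_normcE z : normc z ^+ 2 = Re z ^+ 2 + Im z ^+ 2.
Proof. by case: z => a b /=; rewrite sqr_sqrtr// addr_ge0 ?sqr_ge0. Qed.

Lemma normr_Re_le z : `|Re z| <= normc z.
Proof.
rewrite -(@ler_pXn2r _ 2)// ?nnegrE ?normr_ge0 ?normc_ge0// sqr_normcE.
by rewrite real_normK ?num_real// lerDl sqr_ge0.
Qed.

Lemma normr_Im_le z : `|Im z| <= normc z.
Proof.
rewrite -(@ler_pXn2r _ 2)// ?nnegrE ?normr_ge0 ?normc_ge0// sqr_normcE.
by rewrite real_normK ?num_real// lerDr sqr_ge0.
Qed.

Lemma Re_le_normc z : Re z <= normc z.
Proof. exact: le_trans (ler_norm _) (normr_Re_le z). Qed.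

Lemma normc_conj z : normc (z^*)%C = normc z.
Proof. by case: z => a b /=; rewrite sqrrN. Qed.

Lemma normcR (x : R) : normc (x%:C)%C = `|x|.
Proof. by rewrite /= expr0n addr0 sqrtr_sqr. Qed.

Lemma mulcJ z : z * (z^*)%C = (normc z ^+ 2)%:C%C.
Proof.
case: z => a b; rewrite sqr_normcE; apply/eqP; rewrite eq_complex/=.
by apply/andP; split; apply/eqP; ring.
Qed.

Lemma normc_exp2 z w : normc z * normc w <= (normc z ^+ 2 + normc w ^+ 2) / 2.
Proof. by have := sqr_ge0 (normc z - normc w); lra. Qed.

Lemma normc_expi (t : R) : normc (expi t) = 1.
Proof. by rewrite /expi/= cos2Dsin2 sqrtr1. Qed.

Lemma expiD (s t : R) : expi (s + t) = expi s * expi t.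
Proof.
apply/eqP; rewrite eq_complex/= cosD sinD; apply/andP; split; apply/eqP => //.
by rewrite addrC.
Qed.

Lemma expi0 : expi (0 : R) = 1.
Proof. by rewrite /expi cos0 sin0. Qed.

Lemma expiJ (t : R) : (expi t)^*%C = expi (- t).
Proof. by rewrite /expi/= cosN sinN. Qed.

Lemma cReD z w : Re (z + w) = Re z + Re w. Proof. by case: z w => ? ? []. Qed.
Lemma cImD z w : Im (z + w) = Im z + Im w. Proof. by case: z w => ? ? []. Qed.
Lemma cReN z : Re (- z) = - Re z. Proof. by case: z. Qed.
Lemma cImN z : Im (- z) = - Im z. Proof. by case: z. Qed.
Lemma cReM z w : Re (z * w) = Re z * Re w - Im z * Im w.
Proof. by case: z w => ? ? []. Qed.
Lemma cImM z w : Im (z * w) = Re z * Im w + Im z * Re w.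
Proof. by case: z w => ? ? []. Qed.
Lemma cReJ z : Re (z^*)%C = Re z. Proof. by case: z. Qed.
Lemma cImJ z : Im (z^*)%C = - Im z. Proof. by case: z. Qed.

Lemma conjcM z w : (z * w)^*%C = z^*%C * w^*%C.
Proof. exact: rmorphM. Qed.

Lemma complexP z w : Re z = Re w -> Im z = Im w -> z = w.
Proof. by case: z w => ? ? [? ?] /= -> ->. Qed.

Lemma ler_normc_sum (I : Type) (s : seq I) (P : pred I) (f : I -> R[i]) :
  normc (\sum_(i <- s | P i) f i) <= \sum_(i <- s | P i) normc (f i).
Proof.
elim/big_rec2: _ => [|i x y _ h]; first by rewrite normc0.
by apply: le_trans (le_normcD _ _) _; rewrite lerD2l.
Qed.

Lemma normc_sqrD z w : normc (z + w) ^+ 2 <= 2 * normc z ^+ 2 + 2 * normc w ^+ 2.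
Proof.
rewrite !sqr_normcE cReD cImD.
have := sqr_ge0 (Re z - Re w); have := sqr_ge0 (Im z - Im w); lra.
Qed.

End normc_theory.

Section cintegral_theory.
Context {R : realType} {d} {T : measurableType d}.
Variable mu : {measure set T -> \bar R}.
Implicit Types f g : T -> R[i].
Local Notation Re := complex.Re.
Local Notation Im := complex.Im.

Lemma cmeasurableD f g : cmeasurable f -> cmeasurable g ->
  cmeasurable (fun x => f x + g x).
Proof.
move=> [f1 f2] [g1 g2]; split.
- by under eq_fun do rewrite cReD; exact: measurable_funD.
- by under eq_fun do rewrite cImD; exact: measurable_funD.
Qed.

Lemma cmeasurableN f : cmeasurable f -> cmeasurable (fun x => - f x).
Proof.
move=> [f1 f2]; split.
- by under eq_fun do rewrite cReN; exact: measurable_funN.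
- by under eq_fun do rewrite cImN; exact: measurable_funN.
Qed.

Lemma cmeasurableM f g : cmeasurable f -> cmeasurable g ->
  cmeasurable (fun x => f x * g x).
Proof.
move=> [f1 f2] [g1 g2]; split.
- by under eq_fun do rewrite cReM; apply: measurable_funB; exact: measurable_funM.
- by under eq_fun do rewrite cImM; apply: measurable_funD; exact: measurable_funM.
Qed.

Lemma cmeasurableJ f : cmeasurable f -> cmeasurable (fun x => (f x)^*%C).
Proof.
move=> [f1 f2]; split; first by under eq_fun do rewrite cReJ.
by under eq_fun do rewrite cImJ; exact: measurable_funN.
Qed.

Lemma cmeasurable_cst (c : R[i]) : cmeasurable (fun _ : T => c).
Proof. by split; exact: measurable_cst. Qed.

Lemma cmeasurable_real (f : T -> R) : measurable_fun setT f ->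
  cmeasurable (fun x => (f x)%:C%C).
Proof. by move=> mf; split => //=; exact: measurable_cst. Qed.

Lemma measurable_normc2 f : cmeasurable f ->
  measurable_fun setT (fun x => normc (f x) ^+ 2).
Proof.
move=> [f1 f2]; under eq_fun do rewrite sqr_normcE.
by apply: measurable_funD; exact: measurable_funX.
Qed.

Lemma measurable_normc f : cmeasurable f ->
  measurable_fun setT (fun x => normc (f x)).
Proof.
move=> mf.
have -> : (fun x => normc (f x)) = Num.sqrt \o (fun x => normc (f x) ^+ 2).
  by apply/funext => x /=; rewrite sqrtr_sqr ger0_norm// normc_ge0.
apply: measurableT_comp; last exact: measurable_normc2.
by apply: continuous_measurable_fun; exact: sqrt_continuous.
Qed.

Lemma measurable_EFin_normc2 f : cmeasurable f ->
  measurable_fun setT (fun x => (normc (f x) ^+ 2)%:E).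
Proof. by move=> mf; apply/measurable_EFinP/measurable_normc2. Qed.

Lemma measurable_EFin_normc f : cmeasurable f ->
  measurable_fun setT (fun x => (normc (f x))%:E).
Proof. by move=> mf; apply/measurable_EFinP/measurable_normc. Qed.

Lemma cintegrable_Re f : cintegrable mu f ->
  mu.-integrable setT (fun x => (Re (f x))%:E).
Proof.
move=> [mf fi]; apply/integrableP; split; first exact/measurable_EFinP/mf.1.
apply: le_lt_trans fi; apply: ge0_le_integral => //.
- by apply/measurable_EFinP; apply: measurableT_comp => //; exact: mf.1.
- by apply/measurable_EFinP; exact: measurable_normc.
- by move=> x _; rewrite /= lee_fin normr_Re_le.
Qed.

Lemma cintegrable_Im f : cintegrable mu f ->
  mu.-integrable setT (fun x => (Im (f x))%:E).
Proof.
move=> [mf fi]; apply/integrableP; split; first exact/measurable_EFinP/mf.2.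
apply: le_lt_trans fi; apply: ge0_le_integral => //.
- by apply/measurable_EFinP; apply: measurableT_comp => //; exact: mf.2.
- by apply/measurable_EFinP; exact: measurable_normc.
- by move=> x _; rewrite /= lee_fin normr_Im_le.
Qed.

Lemma cintegrable_normc f : cintegrable mu f ->
  mu.-integrable setT (fun x => (normc (f x))%:E).
Proof.
move=> [mf fi]; apply/integrableP; split.
  by apply/measurable_EFinP; exact: measurable_normc.
by under eq_integral do rewrite /= ger0_norm ?normc_ge0//.
Qed.

Lemma cintegrable_le f (g : T -> \bar R) : cmeasurable f ->
  measurable_fun setT g -> (forall x, ((normc (f x))%:E <= g x)%E) ->
  (\int[mu]_x g x < +oo)%E -> cintegrable mu f.
Proof.
move=> mf mg fg gi; split => //; apply: le_lt_trans gi.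
apply: ge0_le_integral => //.
- by move=> x _; rewrite lee_fin normc_ge0.
- by apply/measurable_EFinP; exact: measurable_normc.
Qed.

Lemma cintegrableD f g : cintegrable mu f -> cintegrable mu g ->
  cintegrable mu (fun x => f x + g x).
Proof.
move=> fi gi.
apply: (@cintegrable_le _ (fun x => (normc (f x))%:E + (normc (g x))%:E)%E).
- exact: cmeasurableD fi.1 gi.1.
- by apply: emeasurable_funD; apply/measurable_EFinP; apply: measurable_normc;
    [exact: fi.1|exact: gi.1].
- by move=> x; rewrite -EFinD lee_fin le_normcD.
- rewrite ge0_integralD//.
  + by rewrite lte_add_pinfty//; [exact: fi.2|exact: gi.2].
  + by move=> x _; rewrite lee_fin normc_ge0.
  + by apply/measurable_EFinP/measurable_normc; exact: fi.1.
  + by move=> x _; rewrite lee_fin normc_ge0.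
  + by apply/measurable_EFinP/measurable_normc; exact: gi.1.
Qed.

Lemma cintegrableZ (c : R[i]) f : cintegrable mu f ->
  cintegrable mu (fun x => c * f x).
Proof.
move=> fi.
apply: (@cintegrable_le _ (fun x => (normc c)%:E * (normc (f x))%:E)%E).
- exact: cmeasurableM (cmeasurable_cst c) fi.1.
- by apply: emeasurable_funM => //; apply/measurable_EFinP/measurable_normc; exact: fi.1.
- by move=> x; rewrite -EFinM normcM.
- rewrite ge0_integralZl//.
  + by rewrite lte_mul_pinfty ?lee_fin ?normc_ge0//; exact: fi.2.
  + by apply/measurable_EFinP/measurable_normc; exact: fi.1.
  + by move=> x _; rewrite lee_fin normc_ge0.
  + by rewrite lee_fin normc_ge0.
Qed.

Lemma cintegrableJ f : cintegrable mu f -> cintegrable mu (fun x => (f x)^*%C).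
Proof.
move=> [mf fi]; split; first exact: cmeasurableJ.
by under eq_integral do rewrite normc_conj.
Qed.

Lemma cintegralD f g : cintegrable mu f -> cintegrable mu g ->
  cintegral mu (fun x => f x + g x) = cintegral mu f + cintegral mu g.
Proof.
move=> fi gi; apply: complexP; rewrite /cintegral/= ?cReD ?cImD/=.
- under eq_Rintegral do rewrite cReD.
  by rewrite RintegralD//; exact: cintegrable_Re.
- under eq_Rintegral do rewrite cImD.
  by rewrite RintegralD//; exact: cintegrable_Im.
Qed.

Lemma cintegralZ (c : R[i]) f : cintegrable mu f ->
  cintegral mu (fun x => c * f x) = c * cintegral mu f.
Proof.
move=> fi; have fr := cintegrable_Re fi; have fim := cintegrable_Im fi.
have iZ (a : R) (h : T -> R) : mu.-integrable setT (EFin \o h) ->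
    mu.-integrable setT (EFin \o (fun x => a * h x)).
  by move=> hi; apply: (@integrableZl _ _ _ mu setT measurableT a (EFin \o h) hi).
apply: complexP; rewrite ?cReM ?cImM/=.
- under eq_Rintegral do rewrite cReM.
  rewrite RintegralB//; [|exact: iZ|exact: iZ].
  by rewrite !RintegralZl.
- under eq_Rintegral do rewrite cImM.
  rewrite RintegralD//; [|exact: iZ|exact: iZ].
  by rewrite !RintegralZl.
Qed.

Lemma cintegralJ f : cintegrable mu f ->
  cintegral mu (fun x => (f x)^*%C) = (cintegral mu f)^*%C.
Proof.
move=> fi; apply: complexP; rewrite ?cReJ ?cImJ/=.
  by apply: eq_Rintegral => x _; rewrite cReJ.
have fim := cintegrable_Im fi.
under eq_Rintegral do rewrite cImJ -mulN1r.
by rewrite RintegralZl// mulN1r.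
Qed.

Lemma cintegral0 : cintegral mu (fun _ => 0) = 0.
Proof. by apply: complexP => /=; rewrite /Rintegral/= integral0. Qed.

(** Multiplying [f] by a unimodular constant makes its integral real and
    nonnegative; the estimate is then one for the real part. *)
Lemma normc_cintegral f : cintegrable mu f ->
  ((normc (cintegral mu f))%:E <= \int[mu]_x (normc (f x))%:E)%E.
Proof.
move=> fi; set I := cintegral mu f.
have [I0|I0] := eqVneq (normc I) 0.
  by rewrite I0; apply: integral_ge0 => x _; rewrite lee_fin normc_ge0.
have nI : 0 < normc I by rewrite lt_neqAle eq_sym I0 normc_ge0.
pose c := (I^*)%C * ((normc I)^-1)%:C%C.
have nc : normc c = 1.
  by rewrite normcM normc_conj normcR ger0_norm ?invr_ge0 ?normc_ge0// divff.
have -> : normc I = Re (c * I).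
  rewrite /c mulrAC (mulrC _ I) mulcJ cReM/= mulr0 subr0 expr2 -mulrA divff ?mulr1//.
rewrite -cintegralZ//.
have cfi := cintegrableZ c fi.
have cRe := cintegrable_Re cfi.
rewrite /=/Rintegral fineK ?integrable_fin_num//.
apply: le_integral => //; first exact: cintegrable_normc.
by move=> x _; rewrite lee_fin (le_trans (Re_le_normc _))// normcM nc mul1r.
Qed.

Lemma eq_cintegral f g : f =1 g -> cintegral mu f = cintegral mu g.
Proof. by move=> fg; congr cintegral; exact/funext. Qed.

Lemma cintegral_ae f g : cmeasurable f -> cmeasurable g -> f = g %[ae mu] ->
  cintegral mu f = cintegral mu g.
Proof.
move=> mf mg fg; apply: complexP; rewrite /=/Rintegral; congr fine.
- apply: ae_eq_integral => //.
  + exact/measurable_EFinP/mf.1.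
  + exact/measurable_EFinP/mg.1.
  + by apply: filterS fg => x /= /(_ I) ->.
- apply: ae_eq_integral => //.
  + exact/measurable_EFinP/mf.2.
  + exact/measurable_EFinP/mg.2.
  + by apply: filterS fg => x /= /(_ I) ->.
Qed.

(** The squared norm as a real number, for algebra with square-integrable
    functions; an infinite [sqnorm] is sent to [0]. *)
Definition nrm2 f : R := fine (sqnorm mu f).

Lemma nrm2_ge0 f : 0 <= nrm2 f.
Proof.
by rewrite fine_ge0//; apply: integral_ge0 => x _; rewrite lee_fin sqr_ge0.
Qed.

Lemma nrm2E f : sqintegrable mu f -> (nrm2 f)%:E = sqnorm mu f.
Proof.
move=> [_ fi]; rewrite fineK// ge0_fin_numE//.
by apply: integral_ge0 => x _; rewrite lee_fin sqr_ge0.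
Qed.

Lemma sqnorm_le f (g : T -> \bar R) : cmeasurable f ->
  measurable_fun setT g -> (forall x, ((normc (f x) ^+ 2)%:E <= g x)%E) ->
  (sqnorm mu f <= \int[mu]_x g x)%E.
Proof.
move=> mf mg fg; apply: ge0_le_integral => //.
- by move=> x _; rewrite lee_fin sqr_ge0.
- by apply/measurable_EFinP/measurable_normc2.
Qed.

Lemma sqintegrableD f g : sqintegrable mu f -> sqintegrable mu g ->
  sqintegrable mu (fun x => f x + g x).
Proof.
move=> [mf fi] [mg gi]; split; first exact: cmeasurableD.
apply: le_lt_trans (sqnorm_le (cmeasurableD mf mg) (g := fun x =>
    (2%:E * (normc (f x) ^+ 2)%:E + 2%:E * (normc (g x) ^+ 2)%:E)%E) _ _) _.
- by apply: emeasurable_funD; apply: emeasurable_funM => //; exact: measurable_EFin_normc2.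
- by move=> x; rewrite -!EFinM -EFinD lee_fin normc_sqrD.
- rewrite ge0_integralD//; last 4 first.
  + by move=> x _; rewrite -EFinM lee_fin mulr_ge0 ?sqr_ge0.
  + by apply: emeasurable_funM => //; exact: measurable_EFin_normc2.
  + by move=> x _; rewrite -EFinM lee_fin mulr_ge0 ?sqr_ge0.
  + by apply: emeasurable_funM => //; exact: measurable_EFin_normc2.
  rewrite !ge0_integralZl ?lee_fin//; [|exact: measurable_EFin_normc2|by move=> x _; rewrite lee_fin sqr_ge0
    |exact: measurable_EFin_normc2|by move=> x _; rewrite lee_fin sqr_ge0].
  by rewrite lte_add_pinfty// lte_mul_pinfty.
Qed.

Lemma sqnormZ (c : R[i]) f : cmeasurable f ->
  sqnorm mu (fun x => c * f x) = ((normc c ^+ 2)%:E * sqnorm mu f)%E.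
Proof.
move=> mf; rewrite /sqnorm; under eq_integral do rewrite normcM exprMn EFinM.
rewrite ge0_integralZl//.
- by apply/measurable_EFinP/measurable_normc2.
- by move=> x _; rewrite lee_fin sqr_ge0.
- by rewrite lee_fin sqr_ge0.
Qed.

Lemma sqintegrableZ (c : R[i]) f : sqintegrable mu f ->
  sqintegrable mu (fun x => c * f x).
Proof.
move=> [mf fi]; split; first exact: cmeasurableM (cmeasurable_cst c) mf.
by rewrite sqnormZ// lte_mul_pinfty// lee_fin sqr_ge0.
Qed.

Lemma nrm2Z (c : R[i]) f : sqintegrable mu f ->
  nrm2 (fun x => c * f x) = normc c ^+ 2 * nrm2 f.
Proof.
move=> fi; apply: EFin_inj; rewrite nrm2E; last exact: sqintegrableZ.
by rewrite EFinM nrm2E// sqnormZ//; exact: fi.1.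
Qed.

Lemma sqintegrable0 : sqintegrable mu (fun _ => 0).
Proof.
split; first exact: cmeasurable_cst.
by rewrite /sqnorm; under eq_integral do rewrite normc0 expr0n/=; rewrite integral0.
Qed.

Lemma sqintegrable_sum (I : Type) (s : seq I) (f : I -> T -> R[i]) :
  (forall i, sqintegrable mu (f i)) ->
  sqintegrable mu (fun x => \sum_(i <- s) f i x).
Proof.
move=> mf; elim: s => [|i s IH].
  by under eq_fun do rewrite big_nil; exact: sqintegrable0.
by under eq_fun do rewrite big_cons; exact: sqintegrableD.
Qed.

Lemma sqintegrableB f g : sqintegrable mu f -> sqintegrable mu g ->
  sqintegrable mu (fun x => f x - g x).
Proof.
move=> fi gi; have := sqintegrableD fi (sqintegrableZ (-1) gi).
by under eq_fun do rewrite mulN1r.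
Qed.

Lemma sqintegrable_mul f g : sqintegrable mu f -> sqintegrable mu g ->
  cintegrable mu (fun x => f x * (g x)^*%C).
Proof.
move=> [mf fi] [mg gi].
apply: (@cintegrable_le _ (fun x =>
    ((normc (f x) ^+ 2)%:E + (normc (g x) ^+ 2)%:E)%E)).
- by apply: cmeasurableM => //; exact: cmeasurableJ.
- by apply: emeasurable_funD; exact: measurable_EFin_normc2.
- move=> x; rewrite -EFinD lee_fin normcM normc_conj.
  by have := sqr_ge0 (normc (f x)); have := sqr_ge0 (normc (g x));
    have := normc_exp2 (f x) (g x); lra.
- rewrite ge0_integralD//; [by rewrite lte_add_pinfty|
    by move=> x _; rewrite lee_fin sqr_ge0|exact: measurable_EFin_normc2|
    by move=> x _; rewrite lee_fin sqr_ge0|exact: measurable_EFin_normc2].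
Qed.

(** Minimizing over [t] the integral of the nonnegative function
    [(t |f| - |g|)^2]. The absolute values are inside the integral because this form
    supplies the integrability needed for Fubini's theorem. *)
Lemma CauchySchwarz_abs f g : sqintegrable mu f -> sqintegrable mu g ->
  (\int[mu]_x (normc (f x) * normc (g x))%:E <=
   (Num.sqrt (nrm2 f) * Num.sqrt (nrm2 g))%:E)%E.
Proof.
move=> fi gi; have [mf _] := fi; have [mg _] := gi.
have [_ Ifin] := sqintegrable_mul fi gi.
have IE : (\int[mu]_x (normc (f x) * normc (g x))%:E)%E =
    (\int[mu]_x (normc (f x * (g x)^*%C))%:E)%E.
  by apply: eq_integral => x _; rewrite normcM normc_conj.
rewrite IE; set I := (\int[mu]_x _)%E in Ifin *.
have I0 : (0 <= I)%E by apply: integral_ge0 => x _; rewrite lee_fin normc_ge0.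
have Ifn : I \is a fin_num by rewrite ge0_fin_numE.
rewrite -(fineK Ifn) lee_fin; set J := fine I.
have J0 : 0 <= J by exact: fine_ge0.
have key (t : R) : 0 <= t -> 2 * t * J <= t ^+ 2 * nrm2 f + nrm2 g.
  move=> t0; rewrite -lee_fin [X in (X <= _)%E]EFinM fineK// EFinD.
  rewrite [X in (_ <= X + _)%E]EFinM !nrm2E//.
  rewrite -ge0_integralZl//; last 3 first.
    by apply/measurable_EFinP; apply: measurable_normc;
      apply: cmeasurableM => //; exact: cmeasurableJ.
    by move=> x _; rewrite lee_fin normc_ge0.
    by rewrite lee_fin mulr_ge0.
  rewrite -ge0_integralZl//; last 3 first.
    exact: measurable_EFin_normc2.
    by move=> x _; rewrite lee_fin sqr_ge0.
    by rewrite lee_fin sqr_ge0.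
  rewrite -ge0_integralD//; last 4 first.
    by move=> x _; rewrite -EFinM lee_fin mulr_ge0 ?sqr_ge0.
    by apply: emeasurable_funM => //; exact: measurable_EFin_normc2.
    by move=> x _; rewrite lee_fin sqr_ge0.
    exact: measurable_EFin_normc2.
  apply: ge0_le_integral => //.
  - by move=> x _; rewrite -EFinM lee_fin !mulr_ge0// normc_ge0.
  - apply: emeasurable_funM => //; apply/measurable_EFinP/measurable_normc.
    by apply: cmeasurableM => //; exact: cmeasurableJ.
  - by apply: emeasurable_funD; [apply: emeasurable_funM => //|]; exact: measurable_EFin_normc2.
  - move=> x _; rewrite -!EFinM -EFinD lee_fin normcM normc_conj.
    have := sqr_ge0 (t * normc (f x) - normc (g x)).
    rewrite sqrrB exprMn; set a := normc (f x); set b := normc (g x).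
    by rewrite -mulr_natl; lra.
rewrite -sqrtrM ?nrm2_ge0// -[leLHS]ger0_norm// -sqrtr_sqr.
apply: ler_wsqrtr.
have f0 := nrm2_ge0 f; have g0 := nrm2_ge0 g.
have [f00|fn0] := eqVneq (nrm2 f) 0.
  rewrite f00 mul0r.
  have : J <= 0.
    rewrite leNgt; apply/negP => Jp.
    (* when [f] is null the bound for large [t] forces [J = 0] *)
    have := key ((nrm2 g + 1) / J) (divr_ge0 (addr_ge0 g0 ler01) J0).
    rewrite f00 mulr0 add0r -mulrA -[_ / J * J]mulrA mulVf ?gt_eqF// mulr1; lra.
  move=> J1; have -> : J = 0 by apply/eqP; rewrite eq_le J1 J0.
  by rewrite expr0n.
have fp : 0 < nrm2 f by rewrite lt_neqAle eq_sym fn0.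
have := key (J / nrm2 f) (divr_ge0 J0 f0).
have -> : 2 * (J / nrm2 f) * J = 2 * (J ^+ 2 / nrm2 f) by field.
have -> : (J / nrm2 f) ^+ 2 * nrm2 f = J ^+ 2 / nrm2 f by field.
move=> h; have : J ^+ 2 / nrm2 f <= nrm2 g by lra.
by rewrite ler_pdivrMr// mulrC.
Qed.

Lemma CauchySchwarz f g : sqintegrable mu f -> sqintegrable mu g ->
  normc (inner mu f g) <= Num.sqrt (nrm2 f) * Num.sqrt (nrm2 g).
Proof.
move=> fi gi; rewrite -lee_fin; apply: le_trans (CauchySchwarz_abs fi gi).
apply: le_trans (normc_cintegral (sqintegrable_mul fi gi)) _.
by under eq_integral do rewrite normcM normc_conj.
Qed.

Lemma CauchySchwarz2 f g : sqintegrable mu f -> sqintegrable mu g ->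
  normc (inner mu f g) ^+ 2 <= nrm2 f * nrm2 g.
Proof.
move=> fi gi; rewrite -[leRHS]sqr_sqrtr ?mulr_ge0 ?nrm2_ge0//.
rewrite ler_pXn2r ?nnegrE ?normc_ge0 ?sqrtr_ge0// sqrtrM ?nrm2_ge0//.
exact: CauchySchwarz.
Qed.

Lemma innerDl f g h : sqintegrable mu f -> sqintegrable mu g ->
  sqintegrable mu h ->
  inner mu (fun x => f x + g x) h = inner mu f h + inner mu g h.
Proof.
move=> fi gi hi; rewrite /inner -cintegralD; [|exact: sqintegrable_mul..].
by apply: eq_cintegral => x; rewrite mulrDl.
Qed.

Lemma innerZl (c : R[i]) f h : sqintegrable mu f -> sqintegrable mu h ->
  inner mu (fun x => c * f x) h = c * inner mu f h.
Proof.
move=> fi hi; rewrite /inner -cintegralZ; [|exact: sqintegrable_mul..].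
by apply: eq_cintegral => x; rewrite mulrA.
Qed.

Lemma innerC f g : sqintegrable mu f -> sqintegrable mu g ->
  inner mu g f = (inner mu f g)^*%C.
Proof.
move=> fi gi; rewrite /inner -cintegralJ; last exact: sqintegrable_mul.
by apply: eq_cintegral => x; rewrite rmorphM/= conjcK mulrC.
Qed.

Lemma innerDr f g h : sqintegrable mu f -> sqintegrable mu g ->
  sqintegrable mu h ->
  inner mu h (fun x => f x + g x) = inner mu h f + inner mu h g.
Proof.
move=> fi gi hi; rewrite innerC//; last exact: sqintegrableD.
by rewrite innerDl// rmorphD/= (innerC fi hi) (innerC gi hi).
Qed.

Lemma innerZr (c : R[i]) f h : sqintegrable mu f -> sqintegrable mu h ->
  inner mu h (fun x => c * f x) = c^*%C * inner mu h f.
Proof.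
move=> fi hi; rewrite innerC//; last exact: sqintegrableZ.
by rewrite innerZl// rmorphM/= (innerC fi hi).
Qed.

Lemma inner_suml (I : Type) (s : seq I) (f : I -> T -> R[i]) h :
  (forall i, sqintegrable mu (f i)) -> sqintegrable mu h ->
  inner mu (fun x => \sum_(i <- s) f i x) h = \sum_(i <- s) inner mu (f i) h.
Proof.
move=> fi hi; elim: s => [|i s IH].
  rewrite big_nil /inner -[RHS]cintegral0; apply: eq_cintegral => x.
  by rewrite big_nil mul0r.
rewrite big_cons -IH -innerDl//; last exact: sqintegrable_sum.
by congr inner; apply/funext => x; rewrite big_cons.
Qed.

Lemma inner_sumr (I : Type) (s : seq I) (f : I -> T -> R[i]) h :
  (forall i, sqintegrable mu (f i)) -> sqintegrable mu h ->
  inner mu h (fun x => \sum_(i <- s) f i x) = \sum_(i <- s) inner mu h (f i).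
Proof.
move=> fi hi; rewrite innerC//; last exact: sqintegrable_sum.
by rewrite inner_suml// rmorph_sum; apply: eq_bigr => i _; rewrite (innerC (fi i) hi).
Qed.

Lemma inner_nrm2 f : sqintegrable mu f -> inner mu f f = (nrm2 f)%:C%C.
Proof.
move=> fi; apply: complexP; rewrite /=/Rintegral/nrm2/sqnorm.
  by congr fine; apply: eq_integral => x _; rewrite mulcJ.
rewrite (_ : (fun x => _) = (fun _ => 0%E)) ?integral0//.
by apply/funext => x; rewrite mulcJ.
Qed.

Lemma nrm2D f g : sqintegrable mu f -> sqintegrable mu g ->
  nrm2 (fun x => f x + g x) = nrm2 f + nrm2 g + 2 * Re (inner mu f g).
Proof.
move=> fi gi; have fgi := sqintegrableD fi gi.
have := inner_nrm2 fgi; rewrite innerDl// !innerDr// !inner_nrm2//.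
rewrite (@innerC f g)// => /(congr1 (@complex.Re R)); rewrite !cReD cReJ/= => <-; ring.
Qed.

Lemma nrm2B f g : sqintegrable mu f -> sqintegrable mu g ->
  nrm2 (fun x => f x - g x) = nrm2 f + nrm2 g - 2 * Re (inner mu f g).
Proof.
move=> fi gi; have Ngi := sqintegrableZ (-1) gi.
have -> : (fun x => f x - g x) = (fun x => f x + (-1) * g x).
  by apply/funext => x; rewrite mulN1r.
rewrite nrm2D// nrm2Z// innerZr// normcN normc1 expr1n mul1r.
by rewrite rmorphN1 mulN1r cReN mulrN.
Qed.

Lemma nrm2D_le f g : sqintegrable mu f -> sqintegrable mu g ->
  nrm2 (fun x => f x + g x) <= 2 * nrm2 f + 2 * nrm2 g.
Proof.
move=> fi gi; have := nrm2_ge0 (fun x => f x - g x).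
by rewrite nrm2B// nrm2D//; lra.
Qed.

Lemma sqrt_nrm2D f g : sqintegrable mu f -> sqintegrable mu g ->
  Num.sqrt (nrm2 (fun x => f x + g x)) <= Num.sqrt (nrm2 f) + Num.sqrt (nrm2 g).
Proof.
move=> fi gi; rewrite nrm2D//.
rewrite -[leRHS]ger0_norm ?addr_ge0 ?sqrtr_ge0// -sqrtr_sqr; apply: ler_wsqrtr.
rewrite sqrrD !sqr_sqrtr ?nrm2_ge0//.
have := le_trans (Re_le_normc _) (CauchySchwarz fi gi).
by rewrite -mulr_natl; lra.
Qed.

Lemma nrm2_ae f g : cmeasurable f -> cmeasurable g -> f = g %[ae mu] ->
  nrm2 f = nrm2 g.
Proof.
move=> mf mg fg; congr fine; apply: ae_eq_integral => //.
- by apply/measurable_EFinP/measurable_normc2.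
- by apply/measurable_EFinP/measurable_normc2.
- by apply: filterS fg => x /= /(_ I) ->.
Qed.

Lemma inner_ae f g h : cmeasurable f -> cmeasurable g -> cmeasurable h ->
  f = g %[ae mu] -> inner mu f h = inner mu g h.
Proof.
move=> mf mg mh fg; apply: cintegral_ae.
- by apply: cmeasurableM => //; exact: cmeasurableJ.
- by apply: cmeasurableM => //; exact: cmeasurableJ.
- by apply: filterS fg => x /= /(_ I) ->.
Qed.

End cintegral_theory.

Section cFubini.
Context {R : realType} {d1 d2} {T1 : measurableType d1} {T2 : measurableType d2}.
Variables (m1 : {sigma_finite_measure set T1 -> \bar R})
          (m2 : {sigma_finite_measure set T2 -> \bar R}).
Local Notation Re := complex.Re.
Local Notation Im := complex.Im.

Lemma Rintegral_prod1 (f : T1 * T2 -> R) :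
  (m1 \x m2)%E.-integrable setT (EFin \o f) ->
  (\int[m1]_x \int[m2]_y f (x, y)) = fine (\int[m1 \x m2]_z (f z)%:E)%E.
Proof.
move=> fi; rewrite -(integral12_prod_meas1 fi) /Rintegral; congr fine.
have mF := measurable_fubini_F fi.
apply: ae_eq_integral => //.
- by apply/measurable_EFinP; apply: (measurableT_comp _ mF); exact: fine_measurable.
- apply: filterS (ae_integrable1 fi) => x /= h _.
  by rewrite fineK//; exact: integrable_fin_num.
Qed.

Lemma Rintegral_prod2 (f : T1 * T2 -> R) :
  (m1 \x m2)%E.-integrable setT (EFin \o f) ->
  (\int[m2]_y \int[m1]_x f (x, y)) = fine (\int[m1 \x m2]_z (f z)%:E)%E.
Proof.
move=> fi; rewrite -(integral21_prod_meas1 fi) /Rintegral; congr fine.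
have mG := measurable_fubini_G fi.
apply: ae_eq_integral => //.
- by apply/measurable_EFinP; apply: (measurableT_comp _ mG); exact: fine_measurable.
- apply: filterS (ae_integrable2 fi) => x /= h _.
  by rewrite fineK//; exact: integrable_fin_num.
Qed.

Lemma cFubini (f : T1 * T2 -> R[i]) : cmeasurable f ->
  (\int[m1]_x \int[m2]_y (normc (f (x, y)))%:E < +oo)%E ->
  cintegral m1 (fun x => cintegral m2 (fun y => f (x, y))) =
  cintegral m2 (fun y => cintegral m1 (fun x => f (x, y))).
Proof.
move=> mf fi.
have ifn : cintegrable (m1 \x m2)%E f.
  split => //.
  by rewrite (@fubini_tonelli1 _ _ _ _ _ m1 m2)//;
    [exact/measurable_EFinP/measurable_normc
    |move=> x; rewrite lee_fin normc_ge0].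
have iR := cintegrable_Re ifn; have iI := cintegrable_Im ifn.
apply: complexP => /=.
  by rewrite (Rintegral_prod1 iR) (Rintegral_prod2 iR).
by rewrite (Rintegral_prod1 iI) (Rintegral_prod2 iI).
Qed.

Lemma measurable_Rintegral (g : T1 * T2 -> R) : measurable_fun setT g ->
  measurable_fun setT (fun x => \int[m2]_y g (x, y)).
Proof.
move=> mg; rewrite /Rintegral.
apply: (measurableT_comp (fine_measurable measurableT)).
under eq_fun do rewrite integralE.
have mEg : measurable_fun setT (EFin \o g) by exact/measurable_EFinP.
apply: emeasurable_funB.
  rewrite (_ : (fun x => _) = fubini_F m2 ((EFin \o g)^\+)%E).
    apply: measurable_fun_fubini_tonelli_F; last by move=> x; exact: funepos_ge0.
    exact: measurable_funepos.
  apply/funext => x; rewrite /fubini_F; apply: eq_integral => y _.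
  by rewrite (funepos_comp (EFin \o g) (fun y => (x, y))).
rewrite (_ : (fun x => _) = fubini_F m2 ((EFin \o g)^\-)%E).
  apply: measurable_fun_fubini_tonelli_F; last by move=> x; exact: funeneg_ge0.
  exact: measurable_funeneg.
apply/funext => x; rewrite /fubini_F; apply: eq_integral => y _.
by rewrite (funeneg_comp (EFin \o g) (fun y => (x, y))).
Qed.

Lemma cmeasurable_cintegral (f : T1 * T2 -> R[i]) : cmeasurable f ->
  cmeasurable (fun x => cintegral m2 (fun y => f (x, y))).
Proof.
move=> [f1 f2]; split => /=.
  exact: (@measurable_Rintegral (fun z => Re (f z))).
exact: (@measurable_Rintegral (fun z => Im (f z))).
Qed.

End cFubini.

(** * Fourier integrals of Gaussians *)

Section gauss_fourier.
Context {R : realType}.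
Local Notation mu := (@lebesgue_measure R).

(** Differentiation under the integral sign with the partial derivative given by a
    formula. *)
Lemma is_derive_under_integral d (Y : measurableType d)
    (nu : {measure set Y -> \bar R}) (f df : R -> Y -> R) (G : Y -> R) (b u v : R) :
  u < b < v ->
  (forall x, nu.-integrable setT (EFin \o f x)) ->
  (forall (x : R) y, is_derive x 1 (f ^~ y) (df x y)) ->
  nu.-integrable setT (EFin \o G) ->
  (forall x y, u < x < v -> `|df x y| <= G y) ->
  is_derive b 1 (fun x => \int[nu]_y f x y) (\int[nu]_y df b y).
Proof.
move=> ubv fi fd Gi dG.
have G0 y : 0 <= G y by apply: le_trans (dG b y ubv).
have d1 x y : partial1of2 f x y = df x y.
  by rewrite partial1of2E; exact: (@derive_val _ _ _ _ _ _ _ (fd x y)).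
have Ib : `]u, v[%classic b by rewrite /= in_itv.
have H1 x : `]u, v[%classic x -> nu.-integrable setT (EFin \o f x) by [].
have H2 x y : `]u, v[%classic x -> [set: Y] y -> derivable (f ^~ y) x 1.
  by move=> _ _; exact: (@ex_derive _ _ _ _ _ _ _ (fd x y)).
have H3 x y : `]u, v[%classic x -> [set: Y] y -> `|partial1of2 f x y| <= G y.
  by rewrite /= in_itv/= => xuv _; rewrite d1; exact: dG.
apply: DeriveDef.
  exact: (derivable_under_integral measurableT Ib H1 H2 G0 Gi H3).
rewrite -derive1E (differentiation_under_integral measurableT Ib H1 H2 G0 Gi H3).
by apply: eq_Rintegral => y _; rewrite d1.
Qed.

Lemma integral_translation1 (c : R) (f : R -> \bar R) :
  measurable_fun setT f ->
  (\int[mu]_x f (x + c)%R = \int[mu]_x f x)%E.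
Proof.
move=> mf; rewrite integralE [RHS]integralE; congr (_ - _)%E.
  rewrite -[RHS](@ge0_integral_translation1 R c f^\+%E)//.
    by apply: eq_integral => v _; rewrite (funepos_comp f (fun x => x + c)).
  exact: measurable_funepos.
rewrite -[RHS](@ge0_integral_translation1 R c f^\-%E)//.
  by apply: eq_integral => v _; rewrite (funeneg_comp f (fun x => x + c)).
exact: measurable_funeneg.
Qed.

Lemma is_derive_compR (f g : R -> R) (x a b : R) :
  is_derive (g x) 1 f a -> is_derive x 1 g b ->
  is_derive x 1 (fun y => f (g y)) (a * b).
Proof. exact: is_derive1_comp. Qed.

Lemma is_derive_addl (s x : R) : is_derive x 1 (fun h : R => s + h) 1.
Proof.
rewrite (_ : (fun h => s + h) = shift s); last by apply/funext => h; rewrite /= addrC.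
exact: is_derive_shift.
Qed.

Definition gaussw (a : R) (s : R) : R := expR (- (a * s ^+ 2)).

Lemma gaussw_ge0 a s : 0 <= gaussw a s. Proof. exact: expR_ge0. Qed.

Lemma measurable_gaussw a : measurable_fun setT (gaussw a).
Proof.
apply: measurableT_comp => //; apply: measurable_funN.
by apply: measurable_funM => //; exact: measurable_funX.
Qed.

Lemma integral_gaussw a : 0 < a ->
  (\int[mu]_s (gaussw a s)%:E)%E = (Num.sqrt (pi / a))%:E.
Proof.
move=> a0; pose sg := (Num.sqrt (2 * a))^-1 : R.
have a20 : 0 < 2 * a by rewrite mulr_gt0.
have sg0 : sg != 0 by rewrite invr_eq0 sqrtr_eq0 -ltNge.
have sg2 : sg ^+ 2 *+ 2 = a^-1.
  rewrite exprVn sqr_sqrtr ?ltW// -mulr_natl; field.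
  by rewrite gt_eqF//.
have pk : normal_peak sg = (Num.sqrt (pi / a))^-1.
  by rewrite /normal_peak -mulrnAl sg2 mulrC.
have pk0 : 0 < Num.sqrt (pi / a) by rewrite sqrtr_gt0 divr_gt0// pi_gt0.
have := integral_normal_pdf (0:R) sg.
rewrite /normal_pdf (negbTE sg0) pk.
under eq_integral.
  move=> s _; rewrite /normal_fun subr0 sg2 invrK mulNr (mulrC _ a) -/(gaussw a s) EFinM.
  over.
rewrite ge0_integralZl//; last 2 first.
- by apply/measurable_EFinP; exact: measurable_gaussw.
- by move=> s _; rewrite lee_fin gaussw_ge0.
move=> /(congr1 (fun x => (Num.sqrt (pi / a))%:E * x)%E).
by rewrite muleA -EFinM divff ?gt_eqF// mul1e mule1.
Qed.

Lemma integrable_gaussw a : 0 < a -> mu.-integrable setT (EFin \o gaussw a).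
Proof.
move=> a0; apply/integrableP; split.
  by apply/measurable_EFinP; exact: measurable_gaussw.
under eq_integral do rewrite /= ger0_norm ?gaussw_ge0//.
by rewrite integral_gaussw// ltry.
Qed.

(** Half of the exponent of the Gaussian absorbs the linear factor. *)
Lemma mul_gaussw_le a s : 0 < a ->
  `|s| * gaussw a s <= (1 + 2 / a) * gaussw (a / 2) s.
Proof.
move=> a0; have -> : gaussw a s = gaussw (a / 2) s * gaussw (a / 2) s.
  by rewrite /gaussw -expRD; congr expR; field.
rewrite mulrA ler_wpM2r ?gaussw_ge0//.
have h : 1 + a / 2 * s ^+ 2 <= expR (a / 2 * s ^+ 2) by exact: expR_ge1Dx.
have gp : 0 < gaussw (a / 2) s by exact: expR_gt0.
rewrite -[gaussw _ _]invrK ler_pdivrMr ?invr_gt0// /gaussw -expRN opprK.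
have s2 := sqr_ge0 s.
have s1 : `|s| <= 1 + s ^+ 2.
  by have := sqr_ge0 (`|s| - 1); rewrite sqrrB real_normK ?num_real//
    mulr1 -mulr_natl; have := normr_ge0 s; lra.
apply: le_trans (ler_wpM2l _ h); last first.
  by rewrite addr_ge0// divr_ge0// ltW.
apply: (le_trans s1).
have -> : (1 + 2 / a) * (1 + a / 2 * s ^+ 2) =
    1 + s ^+ 2 + (2 / a + a / 2 * s ^+ 2) by field; rewrite gt_eqF.
have a0' := ltW a0; rewrite lerDl; apply: addr_ge0; first by rewrite divr_ge0.
by rewrite mulr_ge0// divr_ge0.
Qed.

Lemma integrable_le_gaussw (f : R -> R) (C a : R) : 0 < a ->
  measurable_fun setT f -> (forall s, `|f s| <= C * gaussw a s) ->
  mu.-integrable setT (EFin \o f).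
Proof.
move=> a0 mf fC; apply: (@le_integrable _ _ _ mu setT _ _
  (fun s => C%:E * (gaussw a s)%:E)%E) => //.
- exact/measurable_EFinP.
- by move=> s _; rewrite /= lee_fin (le_trans (fC s))// ler_norm.
- exact: (@integrableZl _ _ _ mu setT measurableT C (EFin \o gaussw a)
    (integrable_gaussw a0)).
Qed.

Section one_variable.
Variables (a theta : R).
Hypothesis a0 : 0 < a.

Lemma measurable_phase (f : R -> R) (b : R) : measurable_fun setT f ->
  measurable_fun setT (fun s : R => f (theta + b * s)).
Proof.
move=> mf; apply: (measurableT_comp mf).
by apply: measurable_funD => //; exact: measurable_funM.
Qed.

Lemma measurable_cosR : measurable_fun setT (@cos R).
Proof. by apply: continuous_measurable_fun; exact: continuous_cos. Qed.

Lemma measurable_sinR : measurable_fun setT (@sin R).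
Proof. by apply: continuous_measurable_fun; exact: continuous_sin. Qed.

Lemma norm_cos_le1 (x : R) : `|cos x| <= 1.
Proof. by rewrite ler_norml cos_geN1 cos_le1. Qed.

Lemma norm_sin_le1 (x : R) : `|sin x| <= 1.
Proof. by rewrite ler_norml sin_geN1 sin_le1. Qed.

Lemma measurable_gausscos b :
  measurable_fun setT (fun s => gaussw a s * cos (theta + b * s)).
Proof.
by apply: measurable_funM; [exact: measurable_gaussw|
  apply: measurable_phase; exact: measurable_cosR].
Qed.

Lemma measurable_gausssin b :
  measurable_fun setT (fun s => gaussw a s * sin (theta + b * s)).
Proof.
by apply: measurable_funM; [exact: measurable_gaussw|
  apply: measurable_phase; exact: measurable_sinR].
Qed.

Lemma integrable_gausscos b :
  mu.-integrable setT (EFin \o (fun s => gaussw a s * cos (theta + b * s))).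
Proof.
apply: (@integrable_le_gaussw _ 1 a) => //; first exact: measurable_gausscos.
move=> s; rewrite mul1r normrM ger0_norm ?gaussw_ge0// ler_piMr ?gaussw_ge0//.
exact: norm_cos_le1.
Qed.

Lemma integrable_sgausssin b :
  mu.-integrable setT (EFin \o (fun s => s * (gaussw a s * sin (theta + b * s)))).
Proof.
apply: (@integrable_le_gaussw _ (1 + 2 / a) (a / 2)) => //.
- by rewrite divr_gt0.
- by apply: measurable_funM => //; exact: measurable_gausssin.
- move=> s; apply: le_trans (mul_gaussw_le s a0).
  rewrite !normrM ler_wpM2l// (ger0_norm (gaussw_ge0 _ _)).
  by rewrite ler_piMr ?gaussw_ge0// norm_sin_le1.
Qed.

Lemma is_derive_gaussw (x : R) :
  is_derive x 1 (gaussw a) (- (2 * a * x) * gaussw a x).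
Proof.
rewrite /gaussw.
have h : is_derive x 1 (fun s : R => - (a * s ^+ 2)) (- (2 * a * x)).
  apply: is_derive_eq.
  by rewrite /GRing.scale/=; ring.
have := @is_derive_compR expR _ x _ _ (is_derive_expR _) h.
by rewrite mulrC.
Qed.

Lemma is_derive_phase (x b : R) :
  is_derive x 1 (fun s : R => theta + b * s) b.
Proof.
by apply: is_derive_eq; rewrite /GRing.scale/=; ring.
Qed.

Lemma is_derive_phase2 (x s : R) :
  is_derive x 1 (fun b : R => theta + b * s) s.
Proof.
by apply: is_derive_eq; rewrite /GRing.scale/=; ring.
Qed.

(** The integral of [g (s + h)] over [s] does not depend on [h]. Differentiating it
    under the integral sign at [h = 0] shows that the derivative of [g] has integral
    zero, which is integration by parts without boundary terms. *)
Lemma gauss_by_parts b :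
  \int[mu]_s (s * (gaussw a s * sin (theta + b * s))) =
  b / (2 * a) * \int[mu]_s (gaussw a s * cos (theta + b * s)).
Proof.
pose g (s : R) := gaussw a s * sin (theta + b * s).
pose dg (s : R) := b * (gaussw a s * cos (theta + b * s)) -
   2 * a * (s * (gaussw a s * sin (theta + b * s))).
have g' (s : R) : is_derive s 1 g (dg s).
  have h1 := is_derive_gaussw s.
  have h2 := @is_derive_compR (@sin R) _ s _ _ (is_derive_sin _) (is_derive_phase s b).
  apply: (is_derive_eq (is_deriveM h1 h2)).
  by rewrite /dg/GRing.scale/=; ring.
have dgb s : `|dg s| <= (`|b| + 2 * a * (1 + 2 / a)) * gaussw (a / 2) s.
  rewrite mulrDl; apply: le_trans (ler_normB _ _) _; apply: lerD.
    rewrite normrM ler_wpM2l// normrM (ger0_norm (gaussw_ge0 _ _)).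
    apply: (@le_trans _ _ (gaussw a s)).
      by rewrite ler_piMr ?gaussw_ge0// norm_cos_le1.
    rewrite ler_expR lerN2; apply: ler_wpM2r; first exact: sqr_ge0.
    by move: a0; lra.
  have a20 : 0 <= 2 * a by rewrite mulr_ge0// ltW.
  rewrite normrM (ger0_norm a20) -(mulrA (2 * a)); apply: ler_wpM2l => //.
  apply: le_trans (mul_gaussw_le s a0).
  rewrite !normrM ler_wpM2l// (ger0_norm (gaussw_ge0 _ _)).
  by rewrite ler_piMr ?gaussw_ge0// norm_sin_le1.
set C := `|b| + _ in dgb.
have C0 : 0 <= C by rewrite addr_ge0// mulr_ge0 ?addr_ge0 ?divr_ge0 ?mulr_ge0 ?ltW.
have a40 : 0 < a / 4 by rewrite divr_gt0.
have gsh (h s : R) : -1 < h < 1 ->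
    gaussw (a / 2) (s + h) <= expR (a / 2) * gaussw (a / 4) s.
  move=> /andP[h1 h2]; rewrite /gaussw -expRD ler_expR.
  have : h ^+ 2 <= 1 by rewrite expr2; nra.
  have := sqr_ge0 (s + 2 * h); rewrite !expr2; nra.
have D : is_derive (0:R) 1 (fun h => \int[mu]_s g (s + h)) (\int[mu]_s dg (s + 0)).
  apply: (@is_derive_under_integral _ _ mu (fun h s => g (s + h)) (fun h s => dg (s + h))
    (fun s => C * expR (a / 2) * gaussw (a / 4) s) 0 (-1) 1).
  - by rewrite ltrN10 ltr01.
  - move=> h; apply: (@integrable_le_gaussw _ (expR (a * h ^+ 2)) (a / 2)).
    + by rewrite divr_gt0.
    + apply: (measurableT_comp (measurable_gausssin b)).
      exact: measurable_funD.
    + move=> s; rewrite /g normrM (ger0_norm (gaussw_ge0 _ _)).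
      apply: (@le_trans _ _ (gaussw a (s + h))).
        by rewrite ler_piMr ?gaussw_ge0// norm_sin_le1.
      rewrite /gaussw -expRD ler_expR.
      have := sqr_ge0 (s + 2 * h); rewrite !expr2; nra.
  - move=> h s.
    have hd := is_derive_addl s h.
    by have := @is_derive_compR g _ h _ _ (g' (s + h)) hd; rewrite mulr1.
  - apply: (@integrable_le_gaussw _ (C * expR (a / 2)) (a / 4)) => //.
      by apply: measurable_funM => //; exact: measurable_gaussw.
    by move=> s; rewrite ger0_norm// !mulr_ge0// ?expR_ge0 ?gaussw_ge0.
  - move=> h s hh; apply: le_trans (dgb _) _.
    by rewrite -mulrA ler_wpM2l// gsh.
have E h : \int[mu]_s g (s + h) = \int[mu]_s g s.
  rewrite /Rintegral; congr fine.
  apply: (@integral_translation1 h (fun s => (g s)%:E)).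
  by apply/measurable_EFinP; exact: measurable_gausssin.
have dg0 : \int[mu]_s dg s = 0.
  have := @derive_val _ _ _ _ _ _ _ D.
  under [in X in X = _ -> _]eq_fun do rewrite E.
  rewrite derive_cst => ->.
  by apply: eq_Rintegral => s _; rewrite addr0.
have ig1 := integrable_gausscos b; have ig2 := integrable_sgausssin b.
move: dg0; rewrite /dg RintegralB//; last 2 first.
- exact: (@integrableZl _ _ _ mu setT measurableT b _ ig1).
- exact: (@integrableZl _ _ _ mu setT measurableT (2 * a) _ ig2).
rewrite !RintegralZl//.
set I1 := Rintegral _ _ _; set I2 := Rintegral _ _ _ => h.
have -> : b / (2 * a) * I1 = (b * I1) / (2 * a) by field; rewrite gt_eqF.
have -> : b * I1 = 2 * a * I2 by lra.
by field; rewrite gt_eqF.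
Qed.

Let F b := \int[mu]_s (gaussw a s * cos (theta + b * s)).

(** Differentiation in the frequency [b] brings down a factor [s], which integration
    by parts turns into a multiple of [b]. *)
Let is_derive_F (b : R) : is_derive b 1 F (- (b / (2 * a)) * F b).
Proof.
have D : is_derive b 1 (fun b : R => \int[mu]_s (gaussw a s * cos (theta + b * s)))
    (\int[mu]_s (- (s * (gaussw a s * sin (theta + b * s))))).
  apply: (@is_derive_under_integral _ _ mu _ (fun b s => - (s * (gaussw a s * sin (theta + b * s))))
    (fun s => (1 + 2 / a) * gaussw (a / 2) s) b (b - 1) (b + 1)).
  - by apply/andP; split; lra.
  - by move=> x; exact: integrable_gausscos.
  - move=> x s; have h := @is_derive_compR (@cos R) _ x _ _ (is_derive_cos _) (is_derive_phase2 x s).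
    have := is_deriveZ (gaussw a s) h.
    rewrite /GRing.scale/= => H; apply: (is_derive_eq H); ring.
  - apply: (@integrable_le_gaussw _ (1 + 2 / a) (a / 2)); first by rewrite divr_gt0.
      by apply: measurable_funM => //; exact: measurable_gaussw.
    by move=> s; rewrite ger0_norm// mulr_ge0 ?gaussw_ge0// addr_ge0// divr_ge0 ?ltW.
  - move=> x s _; rewrite normrN; apply: le_trans (mul_gaussw_le s a0).
    rewrite !normrM ler_wpM2l// (ger0_norm (gaussw_ge0 _ _)).
    by rewrite ler_piMr ?gaussw_ge0// norm_sin_le1.
apply: (is_derive_eq D).
under eq_Rintegral do rewrite -mulN1r.
rewrite RintegralZl//; last exact: integrable_sgausssin.
by rewrite gauss_by_parts mulN1r mulNr.
Qed.

(** By [is_derive_F] the Fourier integral solves a linear differential equation in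
    [b], so that its product with [expR (b ^+ 2 / (4 * a))] is constant; the constant is
    the Gaussian integral. *)
Lemma Rintegral_gausscos b :
  \int[mu]_s (gaussw a s * cos (theta + b * s)) =
  cos theta * (Num.sqrt (pi / a) * expR (- (b ^+ 2 / (4 * a)))).
Proof.
rewrite -/(F b).
have a4 : 4 * a != 0 by rewrite mulf_neq0// gt_eqF.
pose H (x : R) := F x * expR (x ^+ 2 / (4 * a)).
have dH (x : R) : is_derive x 1 H 0.
  have h : is_derive x 1 (fun x : R => x ^+ 2 / (4 * a)) (x / (2 * a)).
    apply: is_derive_eq; rewrite /GRing.scale/=; field.
    by rewrite gt_eqF.
  have h2 := @is_derive_compR expR _ x _ _ (is_derive_expR _) h.
  apply: (is_derive_eq (is_deriveM (is_derive_F x) h2)).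
  by rewrite /GRing.scale/=; ring.
have HE : H b = H 0 by exact: is_derive_0_is_cst.
have F0 : F 0 = cos theta * Num.sqrt (pi / a).
  rewrite /F; under eq_Rintegral do rewrite mul0r addr0 mulrC.
  rewrite RintegralZl//; last exact: integrable_gaussw.
  by rewrite /Rintegral integral_gaussw.
have : F b = H b * expR (- (b ^+ 2 / (4 * a))).
  by rewrite /H -mulrA -expRD subrr expR0 mulr1.
by rewrite HE /H F0 expr0n/= mul0r expR0 mulr1 -mulrA.
Qed.

End one_variable.

Lemma integral_gausscos (a theta b : R) : 0 < a ->
  (\int[mu]_s (gaussw a s * cos (theta + b * s))%:E)%E =
  (cos theta * (Num.sqrt (pi / a) * expR (- (b ^+ 2 / (4 * a)))))%:E.
Proof.
move=> a0; rewrite -(Rintegral_gausscos theta a0) /Rintegral fineK//.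
by apply: integrable_fin_num => //; exact: integrable_gausscos.
Qed.

Lemma ge0_integral_gausscV n (a : 'I_n -> R) : (forall i, 0 < a i) ->
  (\int[lebesgue_cV n]_v (expR (- \sum_i a i * v i ord0 ^+ 2))%:E)%E =
  (\prod_i Num.sqrt (pi / a i))%:E.
Proof.
move=> a0; under eq_integral.
  move=> v _; rewrite -sumrN expR_sum; over.
rewrite (@ge0_integral_prod R n (fun i => gaussw (a i)))//.
- by rewrite -prodEFin; apply: eq_bigr => i _; rewrite integral_gaussw.
- by move=> i; exact: measurable_gaussw.
- by move=> i x; exact: gaussw_ge0.
Qed.

Lemma measurable_gausscos_cV n (a b : 'I_n -> R) (theta : R) :
  measurable_fun setT (fun v : 'cV[R]_n =>
     expR (- \sum_i a i * v i ord0 ^+ 2) * cos (theta + \sum_i b i * v i ord0)).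
Proof.
apply: measurable_funM.
  apply: measurableT_comp => //; apply: measurable_funN.
  apply: measurable_sum => i; apply: measurable_funM => //.
  by apply: measurable_funX; exact: measurable_coor.
apply: (measurableT_comp measurable_cosR); apply: measurable_funD => //.
by apply: measurable_sum => i; apply: measurable_funM => //; exact: measurable_coor.
Qed.

Lemma integrable_gausscos_cV n (a b : 'I_n -> R) (theta : R) :
  (forall i, 0 < a i) ->
  (lebesgue_cV n).-integrable setT (fun v : 'cV[R]_n =>
     (expR (- \sum_i a i * v i ord0 ^+ 2) * cos (theta + \sum_i b i * v i ord0))%:E).
Proof.
move=> a0; apply/integrableP; split.
  by apply/measurable_EFinP; exact: measurable_gausscos_cV.
apply: (@le_lt_trans _ _ (\int[lebesgue_cV n]_v (expR (- \sum_i a i * v i ord0 ^+ 2))%:E)%E);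
  last by rewrite ge0_integral_gausscV// ltry.
apply: ge0_le_integral => //.
- by apply/measurable_EFinP/measurableT_comp => //; exact: measurable_gausscos_cV.
- apply/measurable_EFinP; apply: measurableT_comp => //; apply: measurable_funN.
  apply: measurable_sum => i; apply: measurable_funM => //.
  by apply: measurable_funX; exact: measurable_coor.
- move=> v _; rewrite /= lee_fin normrM ger0_norm ?expR_ge0//.
  by rewrite ler_piMr ?expR_ge0// norm_cos_le1.
Qed.

(** The phase [theta] is what makes the induction on the dimension work: it
    collects the contributions of the coordinates that are held fixed. *)
Lemma integral_gausscos_cV n (a b : 'I_n -> R) (theta : R) :
  (forall i, 0 < a i) ->
  (\int[lebesgue_cV n]_v
     (expR (- \sum_i a i * v i ord0 ^+ 2) * cos (theta + \sum_i b i * v i ord0))%:E)%E =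
  (cos theta * \prod_i (Num.sqrt (pi / a i) * expR (- (b i ^+ 2 / (4 * a i)))))%:E.
Proof.
elim: n a b theta => [|n IH] a b theta a0.
  under eq_integral do rewrite !big_ord0 oppr0 expR0 mul1r addr0.
  by rewrite integral_cst//= diracT mule1 big_ord0 mulr1.
rewrite [LHS](@integral_cVS R n (fun v => (expR (- \sum_i a i * v i ord0 ^+ 2) *
  cos (theta + \sum_i b i * v i ord0))%:E)); last exact: integrable_gausscos_cV.
pose c := Num.sqrt (pi / a ord0) * expR (- (b ord0 ^+ 2 / (4 * a ord0))).
rewrite big_ord_recl mulrCA EFinM -(IH (a \o lift ord0) (b \o lift ord0) theta); last by move=> i; exact: a0.
rewrite -integralZl//; last by apply: integrable_gausscos_cV => i; exact: a0.
apply: eq_integral => v _.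
set E := expR (- \sum_i _); set S := \sum_i _.
transitivity (\int[mu]_s (E%:E * (gaussw (a ord0) s * cos ((theta + S) + b ord0 * s))%:E))%E.
  apply: eq_integral => s _; rewrite !big_ord_recl cons_cV0/= -EFinM.
  under eq_bigr do rewrite cons_cVS/=.
  under [in X in cos X]eq_bigr do rewrite cons_cVS/=.
  have -> : theta + (b ord0 * s + \sum_(i < n) b (lift ord0 i) * v i ord0) =
      theta + S + b ord0 * s by rewrite /S/=; ring.
  rewrite opprD expRD /E /gaussw/=; congr (_%:E).
  by rewrite mulrAC mulrC !mulrA.
rewrite integralZl//; last exact: integrable_gausscos.
by rewrite integral_gausscos// -!EFinM; congr (_%:E); ring.
Qed.

End gauss_fourier.

(** * Time-frequency shifts and the short-time Fourier transform *)

Section cmeasurable_more.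
Context {R : realType} {d1 d2} {T1 : measurableType d1} {T2 : measurableType d2}.

Lemma cmeasurable_comp (f : T2 -> R[i]) (g : T1 -> T2) : cmeasurable f ->
  measurable_fun setT g -> cmeasurable (fun x => f (g x)).
Proof.
by move=> [f1 f2] mg; split; [exact: (measurableT_comp f1 mg)|
  exact: (measurableT_comp f2 mg)].
Qed.

Lemma cmeasurable_expi (f : T1 -> R) : measurable_fun setT f ->
  cmeasurable (fun x => expi (f x)).
Proof.
move=> mf; split => /=.
  exact: (measurableT_comp measurable_cosR mf).
exact: (measurableT_comp measurable_sinR mf).
Qed.

Lemma measurable_dotprod d (f g : T1 -> 'cV[R]_d) :
  measurable_fun setT f -> measurable_fun setT g ->
  measurable_fun setT (fun x => dotprod (f x) (g x)).
Proof.
move=> mf mg; apply: measurable_sum => i; apply: measurable_funM.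
  exact: (measurableT_comp (measurable_coor i) mf).
exact: (measurableT_comp (measurable_coor i) mg).
Qed.

Lemma measurable_cVB d (f g : T1 -> 'cV[R]_d) :
  measurable_fun setT f -> measurable_fun setT g ->
  measurable_fun setT (fun x => f x - g x).
Proof.
move=> mf mg; apply: measurable_fun_coorP => i.
under eq_fun do rewrite !mxE.
apply: measurable_funB.
  exact: (measurableT_comp (measurable_coor i) mf).
exact: (measurableT_comp (measurable_coor i) mg).
Qed.

Lemma measurable_usubmx d (f : T1 -> 'cV[R]_(d + d)) :
  measurable_fun setT f -> measurable_fun setT (fun x => usubmx (f x)).
Proof.
move=> mf; apply: measurable_fun_coorP => i; under eq_fun do rewrite mxE.
exact: (measurableT_comp (measurable_coor (lshift d i)) mf).
Qed.

Lemma measurable_dsubmx d (f : T1 -> 'cV[R]_(d + d)) :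
  measurable_fun setT f -> measurable_fun setT (fun x => dsubmx (f x)).
Proof.
move=> mf; apply: measurable_fun_coorP => i; under eq_fun do rewrite mxE.
exact: (measurableT_comp (measurable_coor (rshift d i)) mf).
Qed.

End cmeasurable_more.

Section dotprod_theory.
Context {R : realType} {d : nat}.
Implicit Types x y w : 'cV[R]_d.

Lemma dotprodC x y : dotprod x y = dotprod y x.
Proof. by apply: eq_bigr => i _; rewrite mulrC. Qed.

Lemma dotprodDl x y w : dotprod (x + y) w = dotprod x w + dotprod y w.
Proof. by rewrite -big_split; apply: eq_bigr => i _; rewrite mxE mulrDl. Qed.

Lemma dotprodDr x y w : dotprod w (x + y) = dotprod w x + dotprod w y.
Proof. by rewrite dotprodC dotprodDl !(dotprodC w). Qed.

Lemma dotprodZl (c : R) x w : dotprod (c *: x) w = c * dotprod x w.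
Proof. by rewrite mulr_sumr; apply: eq_bigr => i _; rewrite mxE mulrA. Qed.

Lemma dotprodZr (c : R) x w : dotprod w (c *: x) = c * dotprod w x.
Proof. by rewrite dotprodC dotprodZl dotprodC. Qed.

Lemma dotprodNl x w : dotprod (- x) w = - dotprod x w.
Proof. by rewrite -scaleN1r dotprodZl mulN1r. Qed.

Lemma dotprodNr x w : dotprod w (- x) = - dotprod w x.
Proof. by rewrite dotprodC dotprodNl dotprodC. Qed.

Lemma dotprod_ge0 x : 0 <= dotprod x x.
Proof. by apply: sumr_ge0 => i _; rewrite -expr2 sqr_ge0. Qed.

Lemma dotprod0l x : dotprod 0 x = 0.
Proof. by rewrite -(scale0r 0) dotprodZl mul0r. Qed.

Lemma dotprod0r x : dotprod x 0 = 0.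
Proof. by rewrite dotprodC dotprod0l. Qed.

End dotprod_theory.

Section translation.
Context {R : realType} {d : nat}.
Local Notation Rd := 'cV[R]_d.
Local Notation mu := (lebesgue_cV d : {measure set Rd -> \bar R}).

Lemma cintegral_translation (w : Rd) (f : Rd -> R[i]) : cmeasurable f ->
  cintegral mu (fun t => f (t + w)) = cintegral mu f.
Proof.
move=> [f1 f2]; apply: complexP => /=; rewrite /Rintegral; congr fine.
- apply: (integral_translation w (f := fun t => (complex.Re (f t))%:E)).
  exact/measurable_EFinP.
- apply: (integral_translation w (f := fun t => (complex.Im (f t))%:E)).
  exact/measurable_EFinP.
Qed.

Lemma sqnorm_translation (w : Rd) (f : Rd -> R[i]) : cmeasurable f ->
  sqnorm mu (fun t => f (t + w)) = sqnorm mu f.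
Proof.
move=> mf; apply: (integral_translation w (f := fun t => (normc (f t) ^+ 2)%:E)).
exact/measurable_EFinP/measurable_normc2.
Qed.

End translation.

Section tfshift_theory.
Context {R : realType} {d : nat}.
Local Notation Rd := 'cV[R]_d.
Local Notation R2d := 'cV[R]_(d + d).
Local Notation mu := (lebesgue_cV d : {measure set Rd -> \bar R}).
Implicit Types (y z p : R2d) (f g h u : Rd -> R[i]).

Lemma usubmxD y z : usubmx (y + z) = usubmx y + usubmx z.
Proof. by apply/matrixP => i j; rewrite !mxE. Qed.

Lemma dsubmxD y z : dsubmx (y + z) = dsubmx y + dsubmx z.
Proof. by apply/matrixP => i j; rewrite !mxE. Qed.

Lemma usubmx0 : usubmx (0 : R2d) = 0.
Proof. by apply/matrixP => i j; rewrite !mxE. Qed.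

Lemma dsubmx0 : dsubmx (0 : R2d) = 0.
Proof. by apply/matrixP => i j; rewrite !mxE. Qed.

Lemma cmeasurable_tfshift z g : cmeasurable g -> cmeasurable (tfshift z g).
Proof.
move=> mg; apply: cmeasurableM.
  apply: cmeasurable_expi; apply: measurable_funM => //.
  exact: measurable_dotprod.
apply: (cmeasurable_comp mg).
exact: (measurable_addcV (- usubmx z)).
Qed.

Lemma normc_tfshift z g t : normc (tfshift z g t) = normc (g (t - usubmx z)).
Proof. by rewrite /tfshift normcM normc_expi mul1r. Qed.

Lemma sqnorm_tfshift z g : cmeasurable g ->
  sqnorm mu (tfshift z g) = sqnorm mu g.
Proof.
move=> mg; rewrite -(sqnorm_translation (- usubmx z) mg).
by apply: eq_integral => t _; rewrite normc_tfshift.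
Qed.

Lemma sqintegrable_tfshift z g : sqintegrable mu g ->
  sqintegrable mu (tfshift z g).
Proof.
move=> [mg gi]; split; first exact: cmeasurable_tfshift.
by rewrite sqnorm_tfshift.
Qed.

Lemma nrm2_tfshift z g : cmeasurable g -> nrm2 mu (tfshift z g) = nrm2 mu g.
Proof. by move=> mg; rewrite /nrm2 sqnorm_tfshift. Qed.

Lemma inner_tfshift z g h : cmeasurable g -> cmeasurable h ->
  inner mu (tfshift z g) (tfshift z h) = inner mu g h.
Proof.
move=> mg mh.
have mgh : cmeasurable (fun t => g t * (h t)^*%C).
  by apply: cmeasurableM => //; exact: cmeasurableJ.
rewrite /inner -(cintegral_translation (- usubmx z) mgh).
apply: eq_cintegral => t; rewrite /tfshift conjcM mulrACA mulcJ normc_expi.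
by rewrite expr1n mul1r.
Qed.

Lemma tfshift0 g : tfshift 0 g = g.
Proof.
by apply/funext => t; rewrite /tfshift usubmx0 dsubmx0 subr0 dotprod0r mulr0 expi0 mul1r.
Qed.

(** Time-frequency shifts compose up to a phase only; the estimates below
    therefore involve absolute values of inner products. *)
Lemma tfshift_comp y z g : tfshift y (tfshift z g) =
  (fun t => expi (- (2 * pi * dotprod (usubmx y) (dsubmx z))) * tfshift (y + z) g t).
Proof.
apply/funext => t; rewrite /tfshift !mulrA -!expiD usubmxD dsubmxD opprD addrA.
congr (expi _ * _); rewrite dotprodDl dotprodNl dotprodDr; ring.
Qed.

Lemma tfshift_split y z g : tfshift y g =
  (fun t => expi (2 * pi * dotprod (usubmx z) (dsubmx (y - z))) *
     tfshift z (tfshift (y - z) g) t).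
Proof.
apply/funext => t; rewrite tfshift_comp mulrA -expiD subrr expi0 mul1r.
by rewrite addrC subrK.
Qed.

(** Shifting both arguments multiplies an inner product by a phase. *)
Lemma normc_inner_tfshift p y u g :
  sqintegrable mu u -> sqintegrable mu g ->
  normc (inner mu (tfshift p u) (tfshift y g)) =
  normc (inner mu u (tfshift (y - p) g)).
Proof.
move=> ui gi; rewrite (tfshift_split y p g) innerZr; last 2 first.
- by do 2 apply: sqintegrable_tfshift.
- exact: sqintegrable_tfshift.
rewrite normcM normc_conj normc_expi mul1r inner_tfshift//; first exact: ui.1.
by apply: cmeasurable_tfshift; exact: gi.1.
Qed.

Lemma normc_innerC f g : sqintegrable mu f -> sqintegrable mu g ->
  normc (inner mu f g) = normc (inner mu g f).
Proof. by move=> fi gi; rewrite (innerC gi fi) normc_conj. Qed.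

Lemma normc_inner_tfshiftN y g : sqintegrable mu g ->
  normc (inner mu g (tfshift (- y) g)) = normc (inner mu g (tfshift y g)).
Proof.
move=> gi; have := @normc_inner_tfshift (- y) 0 g g gi gi.
rewrite tfshift0 sub0r opprK => <-.
by rewrite normc_innerC//; exact: sqintegrable_tfshift.
Qed.

End tfshift_theory.

Section gaussian_theory.
Context {R : realType} {d : nat}.
Local Notation Rd := 'cV[R]_d.
Local Notation R2d := 'cV[R]_(d + d).
Local Notation mu := (lebesgue_cV d : {measure set Rd -> \bar R}).
Local Notation phi := (@gaussian R d).

Lemma measurable_gauss_real d' (T : measurableType d') (f : T -> Rd) (c : R) :
  measurable_fun setT f ->
  measurable_fun setT (fun x => expR (c * dotprod (f x) (f x))).
Proof.
move=> mf; apply: measurableT_comp => //; apply: measurable_funM => //.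
exact: measurable_dotprod.
Qed.

Lemma cmeasurable_gaussian : cmeasurable phi.
Proof.
by apply: cmeasurable_real; exact: (measurable_gauss_real (f := id)).
Qed.

Lemma normc_gaussian (t : Rd) : normc (phi t) = expR (- pi * dotprod t t).
Proof. by rewrite /gaussian normcR ger0_norm// expR_ge0. Qed.

Lemma normc_gaussian_le1 (t : Rd) : normc (phi t) <= 1.
Proof.
rewrite normc_gaussian -[leRHS]expR0 ler_expR mulNr oppr_le0.
by rewrite mulr_ge0// ?dotprod_ge0// pi_ge0.
Qed.

(** The squared norm of the Gaussian window. *)
Definition cphi : R := \prod_(i < d) Num.sqrt (pi / (2 * pi)).

Lemma cphi_gt0 : 0 < cphi.
Proof.
apply: prodr_gt0 => i _; rewrite sqrtr_gt0 divr_gt0// ?pi_gt0//.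
by rewrite mulr_gt0// pi_gt0.
Qed.

Lemma sqnorm_gaussian : sqnorm mu phi = cphi%:E.
Proof.
have p2 : 0 < 2 * pi :> R by rewrite mulr_gt0// pi_gt0.
rewrite /cphi -(ge0_integral_gausscV (fun=> p2)).
apply: eq_integral => t _; rewrite normc_gaussian expr2 -expRD; congr (expR _)%:E.
rewrite -mulrDr /dotprod -mulr_sumr.
under [in RHS]eq_bigr do rewrite expr2.
ring.
Qed.

Lemma sqintegrable_gaussian : sqintegrable mu phi.
Proof.
by split; [exact: cmeasurable_gaussian|rewrite sqnorm_gaussian ltry].
Qed.

Lemma nrm2_gaussian : nrm2 mu phi = cphi.
Proof. by rewrite /nrm2 sqnorm_gaussian. Qed.

Lemma Rintegral_gausscos_cV (a : R) (w : Rd) (theta : R) : 0 < a ->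
  \int[mu]_t (expR (- a * dotprod t t) * cos (theta + dotprod t w)) =
  cos theta * ((\prod_(i < d) Num.sqrt (pi / a)) * expR (- (dotprod w w / (4 * a)))).
Proof.
move=> a0; have := @integral_gausscos_cV R d (fun=> a) (fun i => w i ord0) theta (fun=> a0).
rewrite /Rintegral; set I := (X in X = _ -> _) => IE.
transitivity (fine I).
  congr fine; apply: eq_integral => t _; congr (expR _ * cos (_ + _))%:E.
    by rewrite mulNr /dotprod mulr_sumr; congr (- _).
  by apply: eq_bigr => i _; rewrite mulrC.
rewrite IE/=; congr (_ * _); rewrite big_split/= -expR_sum; congr (_ * expR _).
by rewrite sumrN /dotprod mulr_suml; congr (- _).
Qed.

(** Translating the variable by half of the time shift centres the product of the
    two Gaussians; what remains is the Fourier integral of a Gaussian. *)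
Lemma inner_gaussian (z : R2d) : inner mu phi (tfshift z phi) =
  (cphi * expR (- (pi / 2) * (dotprod (usubmx z) (usubmx z) + dotprod (dsubmx z) (dsubmx z))))%:C%C
  * expi (- (pi * dotprod (usubmx z) (dsubmx z))).
Proof.
set x := usubmx z; set w := dsubmx z.
have mfg : cmeasurable (fun t => phi t * (tfshift z phi t)^*%C).
  apply: cmeasurableM; first exact: cmeasurable_gaussian.
  by apply: cmeasurableJ; apply: cmeasurable_tfshift; exact: cmeasurable_gaussian.
pose hx : Rd := (2^-1) *: x.
have p2 : 0 < 2 * pi :> R by rewrite mulr_gt0// pi_gt0.
rewrite /inner -(cintegral_translation hx mfg).
have E t : phi (t + hx) * (tfshift z phi (t + hx))^*%C =
  (expR (- (pi / 2) * dotprod x x))%:C%C * ((expR (- (2 * pi) * dotprod t t))%:C%C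
    * expi (- (pi * dotprod x w) + dotprod t (- (2 * pi) *: w))).
  rewrite /tfshift conjcM.
  rewrite expiJ /gaussian conjc_real.
  rewrite mulrCA mulrC mulrA -!rmorphM/= -!expRD.
  congr ((expR _)%:C%C * expi _).
    rewrite -/x !(dotprodDl, dotprodDr, dotprodNl, dotprodNr, dotprodZl, dotprodZr, opprK).
    by rewrite (dotprodC x t); field.
  by rewrite -/w dotprodDl !dotprodZr /hx dotprodZl; field.
have p2n : 2 * pi != 0 :> R by rewrite gt_eqF.
have Fint (th : R) : \int[mu]_t (expR (- (2 * pi) * dotprod t t) *
      cos (th + dotprod t (- (2 * pi) *: w))) =
    cos th * (cphi * expR (- (pi / 2) * dotprod w w)).
  rewrite Rintegral_gausscos_cV//; congr (_ * (_ * expR _)).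
  have pin : pi != 0 :> R by rewrite gt_eqF// pi_gt0.
  by rewrite dotprodZl dotprodZr; move: (pi : R) pin => p pin; field.
have EJ t : (expR (- (2 * pi) * dotprod t t))%:C%C
    * expi (- (pi * dotprod x w) + dotprod t (- (2 * pi) *: w)) =
  ((expR (- (2 * pi) * dotprod t t) * cos (- (pi * dotprod x w) + dotprod t (- (2 * pi) *: w)))
  +i* (expR (- (2 * pi) * dotprod t t) * cos (- (pi * dotprod x w) - pi / 2 + dotprod t (- (2 * pi) *: w))))%C.
  apply: complexP; rewrite ?cReM ?cImM/= mul0r ?subr0 ?addr0//.
  rewrite addrAC; congr (_ * _).
  by rewrite cosB cos_pihalf sin_pihalf mulr0 add0r mulr1.
rewrite (eq_cintegral _ E).
transitivity ((expR (- (pi / 2) * dotprod x x))%:C%C *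
  ((cos (- (pi * dotprod x w)) * (cphi * expR (- (pi / 2) * dotprod w w)))
   +i* (cos (- (pi * dotprod x w) - pi / 2) * (cphi * expR (- (pi / 2) * dotprod w w))))%C); last first.
  rewrite cosB cos_pihalf sin_pihalf mulr0 add0r mulr1 mulrDr expRD.
  by apply: complexP; rewrite ?cReM ?cImM/=; ring.
rewrite cintegralZ.
  congr (_ * _); rewrite /cintegral; congr (_ +i* _)%C.
    rewrite -Fint; apply: eq_Rintegral => t _.
    by rewrite EJ.
  rewrite -Fint; apply: eq_Rintegral => t _.
  by rewrite EJ.
have mD (u : Rd) : measurable_fun setT (fun t : Rd => dotprod t u).
  exact: measurable_dotprod.
split.
  apply: cmeasurableM.
    by apply: cmeasurable_real; exact: (measurable_gauss_real (f := id)).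
  by apply: cmeasurable_expi; exact: measurable_funD.
under eq_integral do rewrite normcM normc_expi mulr1 normcR ger0_norm ?expR_ge0//.
have := ge0_integral_gausscV (fun _ : 'I_d => p2).
set I := integral _ _ _ => IE.
have -> : (\int[mu]_t (expR (- (2 * pi) * dotprod t t))%:E)%E = I.
  apply: eq_integral => t _; congr (expR _)%:E; rewrite mulNr /dotprod mulr_sumr.
  by congr (- _); apply: eq_bigr => i _; rewrite expr2.
by rewrite IE ltry.
Qed.

Lemma dotprod_split (z : R2d) :
  dotprod (usubmx z) (usubmx z) + dotprod (dsubmx z) (dsubmx z) =
  \sum_i z i ord0 ^+ 2.
Proof.
rewrite big_split_ord/=; congr (_ + _); apply: eq_bigr => i _;
  by rewrite !mxE expr2.
Qed.

Lemma normc_inner_gaussian (z : R2d) : normc (inner mu phi (tfshift z phi)) =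
  cphi * expR (- (pi / 2) * \sum_i z i ord0 ^+ 2).
Proof.
rewrite inner_gaussian dotprod_split normcM normc_expi mulr1 normcR ger0_norm//.
by rewrite mulr_ge0 ?expR_ge0// ltW// cphi_gt0.
Qed.

Lemma cmeasurable_tfgauss :
  cmeasurable (fun p : Rd * R2d => tfshift p.2 phi p.1).
Proof.
have m1 : measurable_fun setT (fun p : Rd * R2d => p.1 - usubmx p.2).
  apply: measurable_cVB; first exact: measurable_fst.
  apply: measurable_usubmx; exact: measurable_snd.
apply: cmeasurableM.
  apply: cmeasurable_expi; apply: measurable_funM => //.
  apply: measurable_dotprod; first exact: measurable_fst.
  apply: measurable_dsubmx; exact: measurable_snd.
by apply: cmeasurable_real; exact: measurable_gauss_real.
Qed.

Lemma cmeasurable_tfgaussC :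
  cmeasurable (fun p : R2d * Rd => tfshift p.1 phi p.2).
Proof.
exact: (cmeasurable_comp cmeasurable_tfgauss (g := fun p : R2d * Rd => (p.2, p.1))
  (measurable_fun_pair measurable_snd measurable_fst)).
Qed.

Lemma cmeasurable_stft (f : Rd -> R[i]) : cmeasurable f -> cmeasurable (stft f).
Proof.
move=> mf.
apply: (@cmeasurable_cintegral R _ _ _ _ (@lebcV R d)
  (fun p : R2d * Rd => f p.2 * (tfshift p.1 phi p.2)^*%C)).
apply: cmeasurableM.
  exact: (cmeasurable_comp mf measurable_snd).
by apply: cmeasurableJ; exact: cmeasurable_tfgaussC.
Qed.

Lemma normc_stft_le (f : Rd -> R[i]) z : sqintegrable mu f ->
  normc (stft f z) <= Num.sqrt (nrm2 mu f) * Num.sqrt cphi.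
Proof.
move=> fi; rewrite /stft.
have := CauchySchwarz fi (sqintegrable_tfshift z sqintegrable_gaussian).
by rewrite nrm2_tfshift ?nrm2_gaussian//; exact: cmeasurable_gaussian.
Qed.

End gaussian_theory.

(** * Boxes and an approximate identity *)

Section boxes.
Context {R : realType}.

Definition cbox n (a b : 'I_n -> R) : set 'cV[R]_n :=
  cVbox (fun i => `[a i, b i]%classic).

Definition cboxes n : set (set 'cV[R]_n) :=
  [set B | exists a b, B = cbox a b].

Lemma measurable_cbox n (a b : 'I_n -> R) : measurable (cbox a b).
Proof. by apply: measurable_cVbox => i; exact: measurable_itv. Qed.

Lemma cboxI n (a b a' b' : 'I_n -> R) : cbox a b `&` cbox a' b' =
  cbox (fun i => Num.max (a i) (a' i)) (fun i => Num.min (b i) (b' i)).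
Proof.
apply/seteqP; split => v /=.
  move=> [h h'] i; have := h i; have := h' i.
  by rewrite /= !in_itv/= ge_max le_min => /andP[-> ->] /andP[-> ->].
move=> h; split => i; have := h i; rewrite /= !in_itv/= ge_max le_min.
  by move=> /andP[/andP[-> _] /andP[-> _]].
by move=> /andP[/andP[_ ->] /andP[_ ->]].
Qed.

(** A half-space bounding one coordinate is a countable union of boxes. *)
Lemma measurable_cboxes n : @measurable _ 'cV[R]_n = <<s @cboxes n >>.
Proof.
apply/seteqP; split; last first.
  apply: smallest_sub; first exact: sigma_algebra_measurable.
  by move=> B [a [b ->]]; exact: measurable_cbox.
apply: smallest_sub; first exact: smallest_sigma_algebra.
rewrite -bigcup_seq/=; apply: bigcup_sub => i _ B [C mC <-]; rewrite setTI.
pose S : set (set R) := [set C | <<s @cboxes n >> ((fun v : 'cV[R]_n => v i ord0) @^-1` C)].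
suff : (@measurable _ (measurableTypeR R)) `<=` S by apply.
rewrite RGenCInfty.measurableE; apply: smallest_sub.
  split => /=.
  - by rewrite /S/= preimage_set0; exact: sigma_algebra0.
  - by move=> A SA; rewrite /S/= setTD preimage_setC; exact: sigma_algebraC.
  - by move=> G SG; rewrite /S/= preimage_bigcup; exact: sigma_algebra_bigcup.
move=> _ [x ->]; rewrite /S/=.
rewrite (_ : _ @^-1` _ = \bigcup_k cbox (fun j => if j == i then x else - k%:R)
   (fun j => k%:R)).
  by apply: sigma_algebra_bigcup => k; apply: sub_sigma_algebra; eexists; eexists.
apply/seteqP; split => v /=.
  rewrite in_itv/= andbT => xv.
  have : [set: 'cV[R]_n] v by [].
  rewrite -bigcup_cube => -[k _ vk]; exists k => // j.
  have := vk j; rewrite /= !in_itv/= => /andP[h1 ->]; rewrite andbT.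
  by case: eqVneq => // ->.
by move=> [k _ /(_ i)]; rewrite /= in_itv/= eqxx in_itv/= andbT => /andP[].
Qed.

Lemma setI_closed_cboxes n : setI_closed (@cboxes n).
Proof.
by move=> _ _ [a [b ->]] [a' [b' ->]]; rewrite cboxI; eexists; eexists.
Qed.

(** The boxes form a pi-system that generates the measurable sets, so that inside
    a fixed cube the vanishing of the integrals extends from boxes to all measurable
    sets. *)
Lemma ae_eq0_cbox n (w : 'cV[R]_n -> R) :
  measurable_fun setT w ->
  (forall k, (lebesgue_cV n).-integrable (@cube R n k) (EFin \o w)) ->
  (forall a b, (\int[lebesgue_cV n]_(x in cbox a b) (w x)%:E = 0)%E) ->
  ae_eq (lebesgue_cV n) setT (EFin \o w) (cst 0%E).
Proof.
move=> mw wi w0.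
have mcube k : measurable (@cube R n k) by exact: measurable_cVbox.
have cubeE k : @cube R n k = cbox (fun=> - k%:R) (fun=> k%:R) by [].
suff H k : ae_eq (lebesgue_cV n) (@cube R n k) (EFin \o w) (cst 0%E).
  have : {ae lebesgue_cV n, forall x, forall k, @cube R n k x -> (EFin \o w) x = 0%E}.
    apply/ae_foralln => k; exact: H.
  apply: filterS => x h _.
  have : [set: 'cV[R]_n] x by [].
  by rewrite -bigcup_cube => -[k _]; exact: h.
apply: integral_ae_eq => // E ED mE.
rewrite [RHS]integral0.
suff : (\int[lebesgue_cV n]_(x in E `&` @cube R n k) (w x)%:E = 0)%E.
  by rewrite (setIidl ED).
pose P : set_system 'cV[R]_n := fun A =>
  (\int[lebesgue_cV n]_(x in A `&` @cube R n k) (w x)%:E = 0)%E.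
have sub A : (lebesgue_cV n).-integrable (@cube R n k) (EFin \o w) ->
    measurable A -> (lebesgue_cV n).-integrable (A `&` @cube R n k) (EFin \o w).
  by move=> h mA; apply: integrableS h => //; exact: measurableI.
apply: (@dynkin_induction _ 'cV[R]_n (@cboxes n) P (measurable_cboxes n) (@setI_closed_cboxes n)).
- by rewrite /P setTI cubeE w0.
- by move=> _ [a [b ->]]; rewrite /P cubeE cboxI w0.
- move=> A mA PA; rewrite /P.
  have := w0 (fun=> - k%:R) (fun=> k%:R); rewrite -cubeE.
  have -> : @cube R n k = (A `&` @cube R n k) `|` (~` A `&` @cube R n k).
    by rewrite -setIUl setUv setTI.
  rewrite integral_setU_EFin//.
  + rewrite -[X in (X + _ = _ -> _)%E]/(\int[lebesgue_cV n]_(x in A `&` _) _)%E PA add0e.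
    by move=> <-; rewrite setIUr setIA setICl set0I set0U setIA setIid.
  + exact: measurableI.
  + by apply: measurableI => //; exact: measurableC.
  + exact: measurable_funTS.
  + rewrite disj_set2E; apply/eqP; rewrite setIACA setICr set0I//.
- move=> F mF tF PF; rewrite /P setI_bigcupl integral_bigcup//.
  + by apply: eseries0 => i _ _; exact: PF.
  + exact: trivIset_setIr.
  + by move=> j; exact: measurableI.
  + by rewrite -setI_bigcupl; apply: sub => //; exact: bigcupT_measurable.
- by rewrite -measurable_cboxes.
Qed.

(** This discards the faces of a box, on which the smoothed indicators of
    [asmooth_cvg] do not converge to the indicator. *)
Lemma ae_neq_coor n (i : 'I_n) (c : R) :
  {ae lebesgue_cV n, forall v : 'cV[R]_n, v i ord0 != c}.
Proof.
exists (cVbox (fun j : 'I_n => if j == i then [set c] else setT)); split.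
- by apply: measurable_cVbox => j; case: ifP.
- rewrite lebesgue_cVbox; last by move=> j; case: ifP.
  rewrite (bigD1 i)//= eqxx lebesgue_measure_set1 mul0e//.
- move=> v /= /negP/negPn/eqP vc j /=; case: eqVneq => // ->; exact: vc.
Qed.

End boxes.

Section delta_kernel.
Context {R : realType}.
Local Notation mu := (@lebesgue_measure R).

Lemma measurable_gaussw_shift (c s : R) :
  measurable_fun setT (fun t : R => gaussw c (s - t)).
Proof.
apply: (measurableT_comp (measurable_gaussw c)).
by apply: measurable_funB.
Qed.

Lemma integral_gaussw_shift (c s : R) : 0 < c ->
  (\int[mu]_t (gaussw c (s - t))%:E)%E = (Num.sqrt (pi / c))%:E.
Proof.
move=> c0; rewrite -integral_gaussw//.
rewrite -(@ge0_integral_translation1 R (- s) (fun t => (gaussw c t)%:E)).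
- by apply: eq_integral => t _; rewrite /gaussw -sqrrN opprB.
- by apply/measurable_EFinP; exact: measurable_gaussw.
- by move=> t; rewrite lee_fin gaussw_ge0.
Qed.

Lemma integrable_gaussw_shift (c s : R) : 0 < c ->
  mu.-integrable setT (EFin \o (fun t => gaussw c (s - t))).
Proof.
move=> c0; apply/integrableP; split.
  by apply/measurable_EFinP; exact: measurable_gaussw_shift.
under eq_integral do rewrite /= ger0_norm ?gaussw_ge0//.
by rewrite integral_gaussw_shift// ltry.
Qed.

Variables (a b : R).
Local Notation J := (\1_(`[a, b]%classic) : R -> R).

(** An approximate identity as [al] tends to infinity: a Gaussian of width of order
    [al] to the power [-1/2] and of mass [Num.sqrt (al / (1/2 + al))]. The summand
    [2^-1] is the contribution of the Gaussian window in [cintegral_damp_tf]. *)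
Definition akernel (al r : R) : R := Num.sqrt al * gaussw (pi * (2^-1 + al)) r.

Definition asmooth (al s : R) : R := \int[mu]_t (J t * akernel al (s - t)).

Lemma akernel_ge0 al r : 0 <= akernel al r.
Proof. by rewrite mulr_ge0 ?sqrtr_ge0 ?gaussw_ge0. Qed.

Lemma measurable_itv_indic : measurable_fun setT J.
Proof. exact: measurable_indic. Qed.

Lemma itv_indic_ge0 t : 0 <= J t. Proof. by rewrite indicE. Qed.
Lemma itv_indic_le1 t : J t <= 1. Proof. by rewrite indicE; case: (_ \in _). Qed.

Lemma measurable_Jkernel al s :
  measurable_fun setT (fun t => J t * akernel al (s - t)).
Proof.
apply: measurable_funM; first exact: measurable_itv_indic.
by apply: measurable_funM => //; exact: measurable_gaussw_shift.
Qed.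

Lemma pi_half_gt0 (al : R) : 0 < al -> 0 < pi * (2^-1 + al).
Proof. by move=> al0; rewrite mulr_gt0 ?pi_gt0// addr_gt0. Qed.

Lemma integrable_akernel al s : 0 < al ->
  mu.-integrable setT (EFin \o (fun t => akernel al (s - t))).
Proof.
move=> al0.
exact: (@integrableZl _ _ _ mu setT measurableT (Num.sqrt al) _
  (integrable_gaussw_shift s (pi_half_gt0 al0))).
Qed.

Lemma integrable_Jkernel al s : 0 < al ->
  mu.-integrable setT (EFin \o (fun t => J t * akernel al (s - t))).
Proof.
move=> al0; apply: (le_integrable _ _ _ (integrable_akernel s al0)) => //.
  by apply/measurable_EFinP; exact: measurable_Jkernel.
move=> t _; rewrite /= lee_fin normrM ler_piMl//.
by rewrite ger0_norm ?itv_indic_ge0// itv_indic_le1.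
Qed.

Lemma asmooth_ge0 al s : 0 <= asmooth al s.
Proof. by apply: Rintegral_ge0 => t _; rewrite mulr_ge0 ?akernel_ge0 ?itv_indic_ge0. Qed.

Lemma asmoothE al s : 0 < al ->
  (\int[mu]_t (J t * akernel al (s - t))%:E)%E = (asmooth al s)%:E.
Proof.
move=> al0; rewrite /asmooth /Rintegral fineK//.
by apply: integrable_fin_num => //; exact: integrable_Jkernel.
Qed.

(** A Gaussian bound that is uniform in [al], which serves as the dominating
    function in the limit. *)
Lemma asmooth_le al s : 0 < al ->
  asmooth al s <= expR (pi * (a ^+ 2 + b ^+ 2) / 2) * gaussw (pi / 4) s.
Proof.
move=> al0; set C := expR _; set g := gaussw _ _.
have C0 : 0 <= C * g by rewrite mulr_ge0 ?expR_ge0 ?gaussw_ge0.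
have pial : 0 < pi * al by rewrite mulr_gt0// pi_gt0.
have E : (\int[mu]_t ((C * g * Num.sqrt al) * gaussw (pi * al) (s - t)) = C * g).
  rewrite RintegralZl//; last exact: integrable_gaussw_shift.
  rewrite /Rintegral integral_gaussw_shift//= -mulrA -sqrtrM ?ltW//.
  have -> : al * (pi / (pi * al)) = 1.
    by rewrite mulrA (mulrC al) divff// gt_eqF.
  by rewrite sqrtr1 mulr1.
rewrite -E; apply: le_Rintegral => //; first exact: integrable_Jkernel.
  exact: (@integrableZl _ _ _ mu setT measurableT (C * g * Num.sqrt al) _
    (integrable_gaussw_shift s pial)).
move=> t _; rewrite indicE; have [|_] := boolP (t \in _); last first.
  by rewrite mul0r mulr_ge0 ?gaussw_ge0// mulr_ge0// sqrtr_ge0.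
rewrite inE/= in_itv/= => /andP[at_ tb]; rewrite mul1r /akernel.
rewrite [leRHS](_ : _ = Num.sqrt al * (C * g * gaussw (pi * al) (s - t))); last by ring.
apply: ler_wpM2l; first exact: sqrtr_ge0.
rewrite /C /g /gaussw -!expRD ler_expR.
have t2 : t ^+ 2 <= a ^+ 2 + b ^+ 2.
  have [t0|t0] := leP 0 t.
    apply: (@le_trans _ _ (b ^+ 2)); last by rewrite lerDr sqr_ge0.
    by rewrite ler_sqr ?nnegrE// (le_trans t0).
  apply: (@le_trans _ _ (a ^+ 2)); last by rewrite lerDl sqr_ge0.
  by rewrite -sqrrN -[leRHS]sqrrN ler_sqr ?nnegrE ?oppr_ge0 ?lerN2 ?(le_trans at_)// ltW.
have p0 : 0 <= pi :> R := pi_ge0 R.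
have st : s ^+ 2 <= 2 * (s - t) ^+ 2 + 2 * t ^+ 2.
  by have := sqr_ge0 (s - 2 * t); rewrite !expr2; lra.
have := ler_wpM2l p0 t2; have := ler_wpM2l p0 st.
by rewrite !mulrDr !mulrDl; lra.
Qed.

Lemma cvg_le_harmonic (u : R^nat) (l C : R) :
  (forall k, `|u k - l| <= C * harmonic k) -> u k @[k --> \oo] --> l.
Proof.
move=> h.
have hC : (fun k => C * harmonic k : R) @ \oo --> (0 : R).
  by rewrite -(mulr0 C); apply: cvgMr; exact: cvg_harmonic.
have h1 : (fun k => l - C * harmonic k : R) @ \oo --> l.
  by rewrite -[X in _ --> X](subr0 l); apply: cvgB => //; exact: cvg_cst.
have h2 : (fun k => l + C * harmonic k : R) @ \oo --> l.
  by rewrite -[X in _ --> X](addr0 l); apply: cvgD => //; exact: cvg_cst.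
apply: (squeeze_cvgr _ h1 h2); apply: nearW => k.
by have := h k; rewrite ler_distl.
Qed.

(** Away from the endpoints the indicator is constant near [s]. The mass of the
    kernel differs from [1] by at most [1 / al], and its tails have size
    [expR (- c * al)]; both errors are dominated by a multiple of [1 / al]. *)
Lemma asmooth_cvg (s : R) : s != a -> s != b ->
  asmooth k.+1%:R s @[k --> \oo] --> J s.
Proof.
move=> sa sb.
(* the indicator is constant on the interval of radius [de] around [s] *)
have [de de0 Jde] : exists2 de : R, 0 < de & forall t, `|s - t| < de -> J t = J s.
  exists (Num.min `|s - a| `|s - b|).
    by rewrite lt_min !normr_gt0 !subr_eq0 sa.
  move=> t; rewrite lt_min => /andP[h1 h2]; rewrite !indicE.
  suff -> : (t \in `[a, b]%classic) = (s \in `[a, b]%classic) :> bool by [].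
  have := ler_norm (s - t); have := ler_norm (t - s); rewrite distrC => h3 h4.
  have [sa'|sa'|sa'] := ltgtP s a; last by rewrite sa' eqxx in sa.
    have ha : `|s - a| = a - s by rewrite distrC ger0_norm// subr_ge0 ltW.
    rewrite ha in h1.
    by apply/idP/idP; rewrite !inE/= !in_itv/= => /andP[? ?]; lra.
  have [sb'|sb'|sb'] := ltgtP s b; last by rewrite sb' eqxx in sb.
    have ha : `|s - a| = s - a by rewrite ger0_norm// subr_ge0 ltW.
    have hb : `|s - b| = b - s by rewrite distrC ger0_norm// subr_ge0 ltW.
    rewrite ha in h1; rewrite hb in h2.
    by apply/idP/idP; rewrite !inE/= !in_itv/= => /andP[? ?]; lra.
  have hb : `|s - b| = s - b by rewrite ger0_norm// subr_ge0 ltW.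
  rewrite hb in h2.
  by apply/idP/idP; rewrite !inE/= !in_itv/= => /andP[? ?]; lra.
have pi0 : 0 < pi :> R := pi_gt0 R.
pose c := pi * de ^+ 2 / 2.
have c0 : 0 < c by rewrite divr_gt0// mulr_gt0// exprn_gt0.
apply: (@cvg_le_harmonic _ _ (Num.sqrt 2 / c + 1)) => k.
set al : R := k.+1%:R.
have al0 : 0 < al by rewrite ltr0n.
have ia := integrable_akernel s al0; have iJ := integrable_Jkernel s al0.
pose F := \int[mu]_t akernel al (s - t).
have FE : F = Num.sqrt (al / (2^-1 + al)).
  rewrite /F /akernel RintegralZl//; last exact: (integrable_gaussw_shift s (pi_half_gt0 al0)).
  rewrite /Rintegral integral_gaussw_shift ?pi_half_gt0//= -sqrtrM ?ltW//.
  congr Num.sqrt; have : pi != 0 :> R by rewrite gt_eqF.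
  by move: (pi : R) => p p0; field; rewrite p0 gt_eqF// addr_gt0.
have F0 : 0 <= F by rewrite FE sqrtr_ge0.
have q0 : 0 < 2^-1 + al by rewrite addr_gt0.
have F2 : F ^+ 2 = al / (2^-1 + al) by rewrite FE sqr_sqrtr// divr_ge0 ?ltW.
have F21 : 1 - F ^+ 2 = 2^-1 / (2^-1 + al) by rewrite F2; field; rewrite gt_eqF.
have F1 : F <= 1.
  rewrite -(@ler_pXn2r _ 2)// ?nnegrE// expr1n -subr_ge0 F21.
  by rewrite divr_ge0// ltW.
have FH : `|1 - F| <= harmonic k.
  rewrite ger0_norm ?subr_ge0//; apply: (@le_trans _ _ (1 - F ^+ 2)).
    by rewrite lerB// expr2 ler_piMl.
  rewrite F21 /harmonic/= ler_pdivrMr// -ler_pdivrMl ?invr_gt0// invrK -/al; lra.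
have main : `|asmooth al s - J s * F| <= Num.sqrt 2 * expR (- (c * al)).
  have -> : asmooth al s - J s * F = \int[mu]_t ((J t - J s) * akernel al (s - t)).
    rewrite /F -RintegralZl// /asmooth -RintegralB//.
      by apply: eq_Rintegral => t _; rewrite mulrBl.
    exact: (@integrableZl _ _ _ mu setT measurableT (J s) _ ia).
  have iB : mu.-integrable setT (EFin \o (fun t => (J t - J s) * akernel al (s - t))).
    have := integrableB measurableT iJ (@integrableZl _ _ _ mu setT measurableT (J s) _ ia).
    by apply: eq_integrable => // t _; rewrite /= mulrBl.
  apply: le_trans (le_normr_Rintegral measurableT iB) _.
  have pial2 : 0 < pi * al / 2 by rewrite divr_gt0// mulr_gt0.
  have -> : Num.sqrt 2 * expR (- (c * al)) =
      \int[mu]_t ((expR (- (c * al)) * Num.sqrt al) * gaussw (pi * al / 2) (s - t)).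
    rewrite RintegralZl//; last exact: integrable_gaussw_shift.
    rewrite /Rintegral integral_gaussw_shift//= -mulrA -sqrtrM ?ltW// mulrC.
    congr (_ * Num.sqrt _); have : pi != 0 :> R by rewrite gt_eqF.
    by move: (pi : R) => p p0; field; rewrite p0 gt_eqF.
  apply: le_Rintegral => //.
  - apply: (@eq_integrable _ _ _ mu setT measurableT (fun t => `|((J t - J s) * akernel al (s - t))%:E|)%E) => //.
    exact: integrable_abse.
  - exact: (@integrableZl _ _ _ mu setT measurableT (expR (- (c * al)) * Num.sqrt al) _
      (integrable_gaussw_shift s pial2)).
  move=> t _; rewrite normrM (ger0_norm (akernel_ge0 _ _)).
  have [st|st] := ltP `|s - t| de.
    by rewrite Jde// subrr normr0 mul0r !mulr_ge0 ?expR_ge0 ?sqrtr_ge0 ?gaussw_ge0.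
  have J1 : `|J t - J s| <= 1.
    by rewrite ler_norml; have := itv_indic_ge0 t; have := itv_indic_ge0 s; have := itv_indic_le1 t; have := itv_indic_le1 s; lra.
  apply: (@le_trans _ _ (akernel al (s - t))).
    by rewrite ler_piMl ?akernel_ge0.
  rewrite /akernel mulrAC [leRHS]mulrC; apply: ler_wpM2l; first exact: sqrtr_ge0.
  rewrite /gaussw -expRD ler_expR /c.
  have st2 : de ^+ 2 <= (s - t) ^+ 2.
    by rewrite -[leRHS]real_normK ?num_real// ler_sqr ?nnegrE// ltW.
  have s0 : 0 <= (s - t) ^+ 2 by exact: sqr_ge0.
  have k1 := ler_wpM2l (ltW (mulr_gt0 pi0 al0)) st2.
  have k2 := mulr_ge0 (ltW pi0) s0.
  lra.
have eb : expR (- (c * al)) <= c^-1 * harmonic k.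
  rewrite /harmonic/= -/al -invfM expRN lef_pV2 ?posrE ?mulr_gt0 ?expR_gt0//.
  by apply: le_trans (expR_ge1Dx _); rewrite lerDr.
have -> : asmooth al s - J s = (asmooth al s - J s * F) - J s * (1 - F) by ring.
apply: le_trans (ler_normB _ _) _; rewrite mulrDl mul1r; apply: lerD.
  have h := ler_wpM2l (sqrtr_ge0 (2:R)) eb.
  by apply: (le_trans main); apply: (le_trans h); rewrite mulrA.
rewrite normrM (ger0_norm (itv_indic_ge0 _)); apply: le_trans FH.
by rewrite ler_piMl// itv_indic_le1.
Qed.

End delta_kernel.

(** * Moyal's identity with damping in frequency *)

Section limits_of_integrals.
Context {R : realType} {d} {T : measurableType d}.
Variable mu : {measure set T -> \bar R}.

Lemma cintegral_real (r : T -> R) :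
  cintegral mu (fun x => (r x)%:C%C) = (\int[mu]_x r x)%:C%C.
Proof.
apply: complexP => //=; rewrite /Rintegral.
by rewrite (_ : (fun x => _) = (fun=> 0%E)) ?integral0//; apply/funext => x.
Qed.

Lemma Rdominated (u_ : nat -> T -> R) (u : T -> R) (g : T -> R) :
  (forall k, measurable_fun setT (u_ k)) -> measurable_fun setT u ->
  {ae mu, forall x, u_ k x @[k --> \oo] --> u x} ->
  mu.-integrable setT (EFin \o g) -> (forall k x, `|u_ k x| <= g x) ->
  (\int[mu]_x u_ k x) @[k --> \oo] --> \int[mu]_x u x.
Proof.
move=> mu_ mu1 uu gi ug.
have [||||//|ui _ cv] := @dominated_convergence _ _ _ mu setT measurableT
  (fun k x => (u_ k x)%:E) (fun x => (u x)%:E) (EFin \o g).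
- by move=> k; exact/measurable_EFinP.
- exact/measurable_EFinP.
- by apply: filterS uu => x h _; apply: cvg_EFin => //; exact: nearW.
- exact: gi.
- by apply: nearW => x k _; rewrite /= lee_fin.
apply: fine_cvg; rewrite fineK//.
exact: integrable_fin_num ui.
Qed.

Lemma cdominated (f_ : nat -> T -> R[i]) (f : T -> R[i]) (g : T -> R) :
  (forall k, cmeasurable (f_ k)) -> cmeasurable f ->
  {ae mu, forall x, complex.Re (f_ k x) @[k --> \oo] --> complex.Re (f x)} ->
  {ae mu, forall x, complex.Im (f_ k x) @[k --> \oo] --> complex.Im (f x)} ->
  mu.-integrable setT (EFin \o g) -> (forall k x, normc (f_ k x) <= g x) ->
  complex.Re (cintegral mu (f_ k)) @[k --> \oo] --> complex.Re (cintegral mu f) /\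
  complex.Im (cintegral mu (f_ k)) @[k --> \oo] --> complex.Im (cintegral mu f).
Proof.
move=> mf_ mf hR hI gi fg; split => /=.
- apply: (Rdominated (g := g)) => //.
  + by move=> k; have [] := mf_ k.
  + by have [] := mf.
  + by move=> k x; apply: le_trans (normr_Re_le _) (fg _ _).
- apply: (Rdominated (g := g)) => //.
  + by move=> k; have [] := mf_ k.
  + by have [] := mf.
  + by move=> k x; apply: le_trans (normr_Im_le _) (fg _ _).
Qed.

End limits_of_integrals.

Section Fubini_cV.
Context {R : realType} {m n : nat}.
Local Notation mu := (lebesgue_cV m : {measure set 'cV[R]_m -> \bar R}).
Local Notation nu := (lebesgue_cV n : {measure set 'cV[R]_n -> \bar R}).

Lemma cFubini_cV (f : 'cV[R]_m * 'cV[R]_n -> R[i]) : cmeasurable f ->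
  (\int[mu]_x \int[nu]_y (normc (f (x, y)))%:E < +oo)%E ->
  cintegral mu (fun x => cintegral nu (fun y => f (x, y))) =
  cintegral nu (fun y => cintegral mu (fun x => f (x, y))).
Proof. exact: (@cFubini R _ _ _ _ (@lebcV R m) (@lebcV R n)). Qed.

Lemma tonelli_cV (f : 'cV[R]_m * 'cV[R]_n -> R) : measurable_fun setT f ->
  (forall p, 0 <= f p) ->
  (\int[mu]_x \int[nu]_y (f (x, y))%:E = \int[nu]_y \int[mu]_x (f (x, y))%:E)%E.
Proof.
move=> mf f0.
apply: (@fubini_tonelli _ _ _ _ R (@lebcV R m) (@lebcV R n) (fun p => (f p)%:E)).
  exact/measurable_EFinP.
by move=> p; rewrite lee_fin.
Qed.

Lemma measurable_integral_cV (f : 'cV[R]_m * 'cV[R]_n -> R) :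
  measurable_fun setT f -> (forall p, 0 <= f p) ->
  measurable_fun setT (fun x => (\int[nu]_y (f (x, y))%:E)%E).
Proof.
move=> mf f0.
apply: (@measurable_fun_fubini_tonelli_F _ _ _ _ R (@lebcV R n) (fun p => (f p)%:E)).
  exact/measurable_EFinP.
by move=> p; rewrite lee_fin.
Qed.

Lemma cmeasurable_cintegral_cV (f : 'cV[R]_m * 'cV[R]_n -> R[i]) :
  cmeasurable f -> cmeasurable (fun x => cintegral nu (fun y => f (x, y))).
Proof. exact: (@cmeasurable_cintegral R _ _ _ _ (@lebcV R n)). Qed.

End Fubini_cV.

Section damped_moyal.
Context {R : realType} {d : nat}.
Local Notation Rd := 'cV[R]_d.
Local Notation R2d := 'cV[R]_(d + d).
Local Notation mu := (lebesgue_cV d : {measure set Rd -> \bar R}).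
Local Notation mu2 := (lebesgue_cV (d + d) : {measure set R2d -> \bar R}).
Local Notation phi := (@gaussian R d).
Variable al : R.
Hypothesis al0 : 0 < al.

(** A Gaussian cutoff in frequency, which tends to [1] as [al] tends to infinity. *)
Definition damp (z : R2d) : R := expR (- (pi / al) * dotprod (dsubmx z) (dsubmx z)).

(** What the cutoff [damp] becomes after integrating out the phase space, see
    [cintegral_damp_tf]. *)
Definition damp_kernel (r : Rd) : R := cphi (R := R) (d := d) * \prod_i akernel al (r i ord0).

Lemma damp_ge0 z : 0 <= damp z. Proof. exact: expR_ge0. Qed.

Lemma damp_le1 z : damp z <= 1.
Proof.
rewrite -[leRHS]expR0 ler_expR mulNr oppr_le0 mulr_ge0 ?dotprod_ge0//.
by rewrite divr_ge0 ?pi_ge0// ltW.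
Qed.

Lemma measurable_damp : measurable_fun setT damp.
Proof.
apply: (@measurable_gauss_real R d _ _ (@dsubmx R d d 1)).
exact: (@measurable_dsubmx R _ _ d id).
Qed.

(** Translating the time variable by [t] removes the dependence on [t]. *)
Lemma integral_damp_tfgauss (t : Rd) :
  (\int[mu2]_z (damp z * normc (tfshift z phi t))%:E)%E =
  (\int[mu2]_z (damp z * normc (phi (usubmx z)))%:E)%E.
Proof.
have mdt : measurable_fun setT (fun z => (damp z * normc (tfshift z phi t))%:E).
  apply/measurable_EFinP; apply: measurable_funM; first exact: measurable_damp.
  apply: measurable_normc.
  exact: (cmeasurable_comp cmeasurable_tfgaussC (pair2_measurable t)).
rewrite -(integral_translation (col_mx t 0) mdt).
apply: eq_integral => z _; rewrite normc_tfshift /damp usubmxD dsubmxD col_mxKu col_mxKd addr0.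
rewrite opprD addrCA subrr addr0 !normc_gaussian.
by rewrite dotprodNl dotprodNr opprK.
Qed.

Lemma integral_damp_phi_lty :
  (\int[mu2]_z (damp z * normc (phi (usubmx z)))%:E < +oo)%E.
Proof.
pose av : R2d := col_mx (const_mx pi) (const_mx (pi / al)).
have av0 i : 0 < av i ord0.
  have [j ->|j ->] := split_ordP i; rewrite ?col_mxEu ?col_mxEd mxE ?pi_gt0//.
  by rewrite divr_gt0 ?pi_gt0.
have := ge0_integral_gausscV av0; set I := integral _ _ _ => IE.
rewrite (_ : integral _ _ _ = I); first by rewrite IE ltry.
apply: eq_integral => z _; rewrite normc_gaussian /damp -expRD; congr (expR _)%:E.
rewrite [in RHS]big_split_ord/= [RHS]opprD [LHS]addrC /dotprod !mulNr !mulr_sumr.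
congr (- _ + - _); apply: eq_bigr => i _.
  by rewrite col_mxEu !mxE expr2.
by rewrite col_mxEd !mxE expr2.
Qed.

Lemma cmeasurable_damp : cmeasurable (fun z => (damp z)%:C%C).
Proof. exact: cmeasurable_real measurable_damp. Qed.

Lemma cmeasurable_tf1 (t : Rd) : cmeasurable (fun z => tfshift z phi t).
Proof. exact: (cmeasurable_comp cmeasurable_tfgaussC (pair2_measurable t)). Qed.

Lemma normc_tf_le1 z (t : Rd) : normc (tfshift z phi t) <= 1.
Proof. by rewrite normc_tfshift normc_gaussian_le1. Qed.

Lemma cintegrable_damp_tf (s t : Rd) : cintegrable mu2
  (fun z => (damp z)%:C%C * (tfshift z phi t * (tfshift z phi s)^*%C)).
Proof.
apply: (@cintegrable_le _ _ _ _ _ (fun z => (damp z * normc (tfshift z phi t))%:E)).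
- apply: cmeasurableM; first exact: cmeasurable_damp.
  by apply: cmeasurableM; [|apply: cmeasurableJ]; exact: cmeasurable_tf1.
- apply/measurable_EFinP; apply: measurable_funM; first exact: measurable_damp.
  by apply: measurable_normc; exact: cmeasurable_tf1.
- move=> z; rewrite lee_fin normcM (normcM (tfshift z phi t)) normcR ger0_norm ?damp_ge0// normc_conj.
  rewrite ler_wpM2l ?damp_ge0// ler_piMr ?normc_ge0//; exact: normc_tf_le1.
- by rewrite integral_damp_tfgauss integral_damp_phi_lty.
Qed.

(** The phase-space integral factors: in the time variable the product of two
    Gaussians has its centre at the midpoint of [s] and [t], in the frequency variable
    one finds the Fourier transform of the cutoff at [t - s]. *)
Lemma cintegral_damp_tf (s t : Rd) : cintegral mu2
  (fun z => (damp z)%:C%C * (tfshift z phi t * (tfshift z phi s)^*%C)) =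
  (damp_kernel (t - s))%:C%C.
Proof.
have [mI _] := cintegrable_damp_tf s t.
pose r := t - s; pose hc : Rd := 2^-1 *: (t + s).
rewrite -(cintegral_translation (col_mx hc 0) mI).
pose av : R2d := col_mx (const_mx (2 * pi)) (const_mx (pi / al)).
pose bv : R2d := col_mx 0 ((2 * pi) *: r).
have pi0 : 0 < pi :> R := pi_gt0 R.
have av0 i : 0 < av i ord0.
  have [j ->|j ->] := split_ordP i; rewrite ?col_mxEu ?col_mxEd mxE ?mulr_gt0//.
  by rewrite invr_gt0.
pose c0 := expR (- (pi / 2) * dotprod r r).
pose Ee (z : R2d) := expR (- \sum_i av i ord0 * z i ord0 ^+ 2).
pose Eb (z : R2d) := \sum_i bv i ord0 * z i ord0.
have ebE z : Eb z = 2 * pi * dotprod r (dsubmx z).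
  rewrite /Eb big_split_ord/= big1 ?add0r; last by move=> i _; rewrite col_mxEu mxE mul0r.
  by rewrite /dotprod mulr_sumr; apply: eq_bigr => i _; rewrite col_mxEd !mxE mulrA.
have eeE z : Ee z = expR (- (2 * pi) * dotprod (usubmx z) (usubmx z)) * damp z.
  rewrite /damp -expRD; congr expR; rewrite [in LHS]big_split_ord/= [LHS]opprD.
  rewrite /dotprod !mulNr !mulr_sumr; congr (- _ + - _); apply: eq_bigr => i _.
    by rewrite col_mxEu !mxE expr2.
  by rewrite col_mxEd !mxE expr2.
have E z : (damp (z + col_mx hc 0))%:C%C * (tfshift (z + col_mx hc 0) phi t
    * (tfshift (z + col_mx hc 0) phi s)^*%C) =
    ((c0 * (Ee z * cos (0 + Eb z))) +i* (c0 * (Ee z * cos (- (pi / 2) + Eb z))))%C.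
  have -> : cos (- (pi / 2) + Eb z) = sin (Eb z).
    by rewrite addrC cosB cos_pihalf sin_pihalf mulr0 add0r mulr1.
  rewrite add0r; transitivity ((c0 * Ee z)%:C%C * expi (Eb z)); last first.
    by apply: complexP; rewrite ?cReM ?cImM/=; ring.
  rewrite /tfshift conjcM expiJ {1}/damp !usubmxD !dsubmxD col_mxKu col_mxKd addr0.
  rewrite -/(damp z) /gaussian conjc_real.
  set w := dsubmx z; set x := usubmx z.
  transitivity ((damp z * (expR (- pi * dotprod (t - (x + hc)) (t - (x + hc))) *
      expR (- pi * dotprod (s - (x + hc)) (s - (x + hc)))))%:C%C *
      (expi (2 * pi * dotprod t w) * expi (- (2 * pi * dotprod s w)))).
    by rewrite !rmorphM/=; ring.
  rewrite -expiD ebE /r; congr (_%:C%C * expi _); last first.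
    by rewrite -/w dotprodDl dotprodNl; move: (dotprod t w) (dotprod s w) (pi : R) => ? ? ?; ring.
  rewrite eeE /c0 [RHS]mulrA [RHS]mulrC; congr (_ * _); rewrite -!expRD; congr expR.
  rewrite -/x /r /hc; move: (pi : R) => p.
  rewrite !(dotprodDl, dotprodDr, dotprodNl, dotprodNr, dotprodZl, dotprodZr, opprD, opprK, scalerDr).
  by rewrite (dotprodC x t) (dotprodC x s) (dotprodC s t); field.
rewrite (eq_cintegral _ E).
have I th : \int[mu2]_z (c0 * (Ee z * cos (th + Eb z))) =
    cos th * damp_kernel r.
  rewrite RintegralZl//; last exact: (integrable_gausscos_cV (fun i => bv i ord0) th av0).
  rewrite /Rintegral (integral_gausscos_cV (fun i => bv i ord0) th av0)/=.
  rewrite mulrCA; congr (_ * _).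
  rewrite big_split_ord/= /damp_kernel /cphi.
  have -> : c0 = \prod_i expR (- (pi / 2) * (r i ord0) ^+ 2).
    rewrite -expR_sum /c0; congr expR; rewrite /dotprod mulr_sumr.
    by apply: eq_bigr => i _; rewrite expr2.
  rewrite mulrCA -big_split/=; congr (_ * _).
    apply: eq_bigr => i _; rewrite !col_mxEu !mxE expr0n/= mul0r oppr0 expR0 mulr1//.
  apply: eq_bigr => i _; rewrite !col_mxEd !mxE /akernel /gaussw mulrCA -expRD.
  congr (Num.sqrt _ * expR _).
    by move: (pi : R) pi0 => p p0; field; rewrite !gt_eqF.
  move: (t i ord0 - s i ord0) => y.
  by move: (pi : R) pi0 => p p0; field; rewrite !gt_eqF.
apply: complexP => /=.
- by rewrite I cos0 mul1r.
- by rewrite I cosN cos_pihalf mul0r.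
Qed.

(** Moyal's identity expresses the exchange of the phase-space integral with the
    two time integrals inside [stft f] and [stft h]. Without a cutoff this exchange is
    not absolutely convergent; with the cutoff in frequency it is, for every [f] in L^2. *)
Lemma damped_moyal (f h : Rd -> R[i]) :
  sqintegrable mu f -> sqintegrable mu h -> cintegrable mu h ->
  cintegral mu2 (fun z => (damp z)%:C%C * (stft f z * (stft h z)^*%C)) =
  cintegral mu (fun s => f s *
    cintegral mu (fun t => (h t)^*%C * (damp_kernel (t - s))%:C%C)).
Proof.
move=> fi hi hI.
have [mf _] := fi; have [mh _] := hi.
have mV := cmeasurable_stft mh.
have gi := @sqintegrable_gaussian R d.
have mtf := @cmeasurable_tfgaussC R d.
pose M := (\int[mu2]_z (damp z * normc (phi (usubmx z)))%:E)%E.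
have M0 : (0 <= M)%E.
  by apply: integral_ge0 => z _; rewrite lee_fin mulr_ge0 ?damp_ge0 ?normc_ge0.
(* [H1] dominates the integrands of both exchanges of integrals *)
pose H1 (p : R2d * Rd) := damp p.1 * (normc (h p.2) * normc (tfshift p.1 phi p.2)).
have mH1 : measurable_fun setT H1.
  apply: measurable_funM; first exact: (measurableT_comp measurable_damp measurable_fst).
  apply: measurable_funM; last exact: measurable_normc.
  by apply: measurable_normc; exact: (cmeasurable_comp mh measurable_snd).
have H10 p : 0 <= H1 p by rewrite !mulr_ge0 ?damp_ge0 ?normc_ge0.
have mtf1 z : cmeasurable (tfshift z phi).
  by apply: cmeasurable_tfshift; exact: cmeasurable_gaussian.
have H1fin : (\int[mu2]_z \int[mu]_t (H1 (z, t))%:E < +oo)%E.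
  rewrite tonelli_cV//.
  apply: (@le_lt_trans _ _ (\int[mu]_t (M * (normc (h t))%:E))%E).
    apply: ge0_le_integral => //.
    - by move=> t _; apply: integral_ge0 => z _; rewrite lee_fin.
    - exact: (@measurable_integral_cV R d (d + d) (fun p => H1 (p.2, p.1))
        (measurableT_comp mH1 (measurable_fun_pair measurable_snd measurable_fst)) (fun p => H10 _)).
    - apply: emeasurable_funM => //; exact: measurable_EFin_normc.
    - move=> t _; rewrite /M -(integral_damp_tfgauss t) /H1 [X in (X <= _)%E]/=.
      have m1 : measurable_fun setT (fun z => (damp z * normc (tfshift z phi t))%:E).
        apply/measurable_EFinP; apply: measurable_funM; first exact: measurable_damp.
        by apply: measurable_normc; exact: cmeasurable_tf1.
      rewrite muleC -ge0_integralZl//.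
      + apply: ge0_le_integral => //.
        * by move=> z _; rewrite lee_fin; exact: (H10 (z, t)).
        * by apply/measurable_EFinP; exact: (measurableT_comp mH1 (pair2_measurable t)).
        * exact: measurable_funeM.
        * by move=> z _; rewrite -EFinM lee_fin mulrCA.
      + by move=> z _; rewrite lee_fin mulr_ge0 ?damp_ge0 ?normc_ge0.
      + by rewrite lee_fin normc_ge0.
  rewrite ge0_integralZl//.
  - by rewrite lte_mul_pinfty ?ge0_fin_numE ?integral_damp_phi_lty//; case: hI.
  - exact: measurable_EFin_normc.
  - by move=> t _; rewrite lee_fin normc_ge0.
have VH z : ((damp z * normc (stft h z))%:E <= \int[mu]_t (H1 (z, t))%:E)%E.
  have hz := sqintegrable_mul hi (sqintegrable_tfshift z gi).
  have := normc_cintegral hz; rewrite /stft /inner => hle.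
  rewrite EFinM /H1; cbn [fst snd]; under eq_integral do rewrite EFinM.
  rewrite ge0_integralZl ?lee_fin ?damp_ge0//.
  - apply: lee_wpmul2l; first by rewrite lee_fin damp_ge0.
    apply: (le_trans hle); under eq_integral do rewrite normcM normc_conj.
    by [].
  - apply/measurable_EFinP; apply: measurable_funM; exact: measurable_normc.
  - by move=> t _; rewrite lee_fin mulr_ge0 ?normc_ge0.
have mdV : measurable_fun setT (fun z => damp z * normc (stft h z)).
  by apply: measurable_funM; [exact: measurable_damp|exact: measurable_normc].
have dVfin : (\int[mu2]_z (damp z * normc (stft h z))%:E < +oo)%E.
  apply: le_lt_trans H1fin; apply: ge0_le_integral => //.
  - by move=> z _; rewrite lee_fin mulr_ge0 ?damp_ge0 ?normc_ge0.
  - exact/measurable_EFinP.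
  - exact: measurable_integral_cV.
have mdVJ : cmeasurable (fun z => (damp z)%:C%C * (stft h z)^*%C).
  by apply: cmeasurableM; [exact: cmeasurable_damp|exact: cmeasurableJ].
pose G1 (p : R2d * Rd) := ((damp p.1)%:C%C * (stft h p.1)^*%C) *
   (f p.2 * (tfshift p.1 phi p.2)^*%C).
have mG1 : cmeasurable G1.
  apply: cmeasurableM; first exact: (cmeasurable_comp mdVJ measurable_fst).
  apply: cmeasurableM; first exact: (cmeasurable_comp mf measurable_snd).
  exact: cmeasurableJ.
pose K1 := Num.sqrt (nrm2 mu f) * Num.sqrt (nrm2 mu phi).
have K10 : 0 <= K1 by rewrite mulr_ge0 ?sqrtr_ge0.
transitivity (cintegral mu2 (fun z => cintegral mu (fun s => G1 (z, s)))).
  apply: eq_cintegral => z; rewrite /G1; cbn [fst snd]; rewrite cintegralZ; last first.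
    by apply: sqintegrable_mul => //; exact: sqintegrable_tfshift.
  by rewrite -[cintegral _ _]/(stft f z); ring.
rewrite cFubini_cV; [|by []|]; last first.
  apply: (@le_lt_trans _ _ (\int[mu2]_z (K1%:E * (damp z * normc (stft h z))%:E))%E).
    apply: ge0_le_integral => //.
    - by move=> z _; apply: integral_ge0 => s _; rewrite lee_fin normc_ge0.
    - apply: (@measurable_integral_cV R (d + d) d (fun p => normc (G1 p))).
        exact: measurable_normc.
      by move=> p; exact: normc_ge0.
    - by apply: emeasurable_funM => //; exact/measurable_EFinP.
    - move=> z _; rewrite /G1; cbn [fst snd].
      under eq_integral => s _.
        rewrite !normcM !normc_conj normcR (ger0_norm (damp_ge0 z)) EFinM.
        over.
      rewrite ge0_integralZl//.
      + rewrite muleC lee_wpmul2r ?lee_fin ?mulr_ge0 ?damp_ge0 ?normc_ge0//.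
        apply: le_trans (CauchySchwarz_abs fi (sqintegrable_tfshift z gi)) _.
        by rewrite nrm2_tfshift//; exact: cmeasurable_gaussian.
      + apply/measurable_EFinP; apply: measurable_funM; exact: measurable_normc.
      + by move=> s _; rewrite lee_fin mulr_ge0 ?normc_ge0.
      + by rewrite lee_fin mulr_ge0 ?damp_ge0 ?normc_ge0.
  rewrite ge0_integralZl//.
  - by rewrite lte_mul_pinfty.
  - exact/measurable_EFinP.
  - by move=> z _; rewrite lee_fin mulr_ge0 ?damp_ge0 ?normc_ge0.
apply: eq_cintegral => s.
transitivity (cintegral mu2 (fun z => f s * ((damp z)%:C%C * (stft h z)^*%C * (tfshift z phi s)^*%C))).
  by apply: eq_cintegral => z; rewrite /G1; cbn [fst snd]; ring.
have iin : cintegrable mu2 (fun z => (damp z)%:C%C * (stft h z)^*%C * (tfshift z phi s)^*%C).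
  apply: (@cintegrable_le _ _ _ _ _ (fun z => (damp z * normc (stft h z))%:E)) => //.
  - by apply: cmeasurableM => //; apply: cmeasurableJ; exact: cmeasurable_tf1.
  - exact/measurable_EFinP.
  - move=> z; rewrite lee_fin !normcM !normc_conj normcR (ger0_norm (damp_ge0 z)).
    by rewrite ler_piMr ?mulr_ge0 ?damp_ge0 ?normc_ge0// normc_tf_le1.
rewrite cintegralZ//; congr (_ * _).
pose G2 (p : R2d * Rd) := ((damp p.1)%:C%C * (tfshift p.1 phi s)^*%C) *
  ((h p.2)^*%C * tfshift p.1 phi p.2).
have mG2 : cmeasurable G2.
  apply: cmeasurableM.
    apply: cmeasurableM; first exact: (cmeasurable_comp cmeasurable_damp measurable_fst).
    by apply: cmeasurableJ; exact: (cmeasurable_comp (cmeasurable_tf1 s) measurable_fst).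
  apply: cmeasurableM => //.
  by apply: cmeasurableJ; exact: (cmeasurable_comp mh measurable_snd).
transitivity (cintegral mu2 (fun z => cintegral mu (fun t => G2 (z, t)))).
  apply: eq_cintegral => z; rewrite /G2; cbn [fst snd].
  have hz := sqintegrable_mul hi (sqintegrable_tfshift z gi).
  have hzJ := cintegrableJ hz.
  rewrite mulrAC /stft /inner -cintegralJ// -cintegralZ//.
  by apply: eq_cintegral => t; rewrite (conjcM (h t)) (conjcK (tfshift z phi t)).
rewrite cFubini_cV; [|by []|]; last first.
  apply: le_lt_trans H1fin; apply: ge0_le_integral => //.
  - by move=> z _; apply: integral_ge0 => t _; rewrite lee_fin normc_ge0.
  - apply: (@measurable_integral_cV R (d + d) d (fun p => normc (G2 p))).
      exact: measurable_normc.
    by move=> p; exact: normc_ge0.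
  - exact: measurable_integral_cV.
  - move=> z _; apply: ge0_le_integral => //.
    + by move=> t _; rewrite lee_fin normc_ge0.
    + apply: measurable_EFin_normc.
      exact: (cmeasurable_comp mG2 (pair1_measurable z)).
    + apply/measurable_EFinP; exact: (measurableT_comp mH1 (pair1_measurable z)).
    + move=> t _; rewrite lee_fin /G2 /H1; cbn [fst snd]; rewrite !normcM !normc_conj normcR (ger0_norm (damp_ge0 z)).
      rewrite ler_wpM2r ?mulr_ge0 ?normc_ge0//.
      by rewrite ler_piMr ?damp_ge0// normc_tf_le1.
apply: eq_cintegral => t; rewrite -cintegral_damp_tf -cintegralZ; last first.
  exact: cintegrable_damp_tf.
by apply: eq_cintegral => z; rewrite /G2; cbn [fst snd]; ring.
Qed.

End damped_moyal.

(** * Inversion of the short-time Fourier transform *)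

Section cFubini_kernel.
Context {R : realType} {m n : nat}.
Local Notation mu := (lebesgue_cV m : {measure set 'cV[R]_m -> \bar R}).
Local Notation nu := (lebesgue_cV n : {measure set 'cV[R]_n -> \bar R}).

(** For the kernels used below the Cauchy-Schwarz inequality bounds the partial
    integrals uniformly in [z]. *)
Lemma cFubini_kernel (F : 'cV[R]_m -> R[i]) (K : 'cV[R]_m * 'cV[R]_n -> R[i]) (C : R) :
  cintegrable mu F -> cmeasurable K ->
  (forall z, (\int[nu]_t (normc (K (z, t)))%:E <= C%:E)%E) ->
  cintegral mu (fun z => F z * cintegral nu (fun t => K (z, t))) =
  cintegral nu (fun t => cintegral mu (fun z => F z * K (z, t))).
Proof.
move=> FI mK KC; have [mF Ffin] := FI.
have mKz z : cmeasurable (fun t => K (z, t)).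
  exact: (cmeasurable_comp mK (pair1_measurable z)).
have mG : cmeasurable (fun p : 'cV[R]_m * 'cV[R]_n => F p.1 * K p).
  by apply: cmeasurableM => //; exact: (cmeasurable_comp mF measurable_fst).
transitivity (cintegral mu (fun z => cintegral nu (fun t => F z * K (z, t)))).
  apply: eq_cintegral => z; rewrite cintegralZ//.
  by split; [exact: mKz|apply: le_lt_trans (KC z) _; rewrite ltry].
rewrite (cFubini_cV mG)//; cbn [fst snd].
apply: (@le_lt_trans _ _ (\int[mu]_z (C%:E * (normc (F z))%:E))%E).
  apply: ge0_le_integral => //.
  - by move=> z _; apply: integral_ge0 => t _; rewrite lee_fin normc_ge0.
  - apply: (@measurable_integral_cV R m n (fun p => normc (F p.1 * K p))).
      exact: measurable_normc.
    by move=> p; exact: normc_ge0.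
  - by apply: measurable_funeM; exact: measurable_EFin_normc.
  - move=> z _; under eq_integral do rewrite normcM EFinM.
    rewrite ge0_integralZl ?lee_fin ?normc_ge0//.
    + by rewrite muleC lee_wpmul2r ?lee_fin ?normc_ge0.
    + exact: measurable_EFin_normc.
    + by move=> t _; rewrite lee_fin normc_ge0.
have := integrableZl measurableT C (cintegrable_normc FI).
move=> /integrable_lty => /(_ measurableT).
by [].
Qed.

End cFubini_kernel.

Section box_indicator.
Context {R : realType} {d : nat}.
Local Notation Rd := 'cV[R]_d.
Local Notation mu := (lebesgue_cV d : {measure set Rd -> \bar R}).
Variables a b : 'I_d -> R.

(** The indicator of a box, written as a product so that its integrals against
    [damp_kernel] split into coordinates. *)
Definition boxind (t : Rd) : R := \prod_i \1_(`[a i, b i]%classic) (t i ord0).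

Lemma boxindE t : boxind t = \1_(cbox a b) t.
Proof.
rewrite /boxind indicE; case: (boolP (t \in cbox a b)) => /=.
  rewrite inE => tab; rewrite big1// => i _; rewrite indicE mem_set//; exact: tab.
rewrite notin_setE => /existsNP[i ti].
rewrite (bigD1 i)//= indicE memNset ?mul0r//.
Qed.

Lemma boxind_ge0 t : 0 <= boxind t. Proof. by rewrite boxindE indicE. Qed.
Lemma boxind_idem t : boxind t ^+ 2 = boxind t.
Proof. by rewrite boxindE indicE; case: (_ \in _); rewrite ?expr1n ?expr0n. Qed.

Lemma measurable_boxind : measurable_fun setT boxind.
Proof.
apply: (measurable_prod_coor (g := fun i => \1_(`[a i, b i]%classic))) => i.
exact: measurable_itv_indic.
Qed.

Lemma integral_boxind_lty : (\int[mu]_t (boxind t)%:E < +oo)%E.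
Proof.
under eq_integral do rewrite boxindE.
rewrite integral_indic// ?setIT; last exact: measurable_cbox.
rewrite lebesgue_cVbox//; under eq_bigr do rewrite lebesgue_measure_itv/=.
rewrite (eq_bigr (fun i => (if a i < b i then b i - a i else 0)%:E)); last first.
  by move=> i _; rewrite lte_fin; case: ifP.
by rewrite prodEFin ltry.
Qed.

Lemma cmeasurable_boxind : cmeasurable (fun t => (boxind t)%:C%C).
Proof. exact: cmeasurable_real measurable_boxind. Qed.

Lemma cintegrable_boxind : cintegrable mu (fun t => (boxind t)%:C%C).
Proof.
split; first exact: cmeasurable_boxind.
by under eq_integral do rewrite normcR ger0_norm ?boxind_ge0//; exact: integral_boxind_lty.
Qed.

Lemma sqintegrable_boxind : sqintegrable mu (fun t => (boxind t)%:C%C).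
Proof.
split; first exact: cmeasurable_boxind; rewrite /sqnorm.
under eq_integral do rewrite normcR ger0_norm ?boxind_ge0// boxind_idem.
exact: integral_boxind_lty.
Qed.

Lemma integral_boxind_asmooth (al : R) (s : Rd) : 0 < al ->
  cintegral mu (fun t => ((boxind t)%:C^*)%C * (damp_kernel al (t - s))%:C%C) =
  (cphi (R := R) (d := d) * \prod_i asmooth (a i) (b i) al (s i ord0))%:C%C.
Proof.
move=> al0.
rewrite (@eq_cintegral _ _ _ _ _ (fun t => (boxind t * damp_kernel al (t - s))%:C%C)); last first.
  move=> t; rewrite conjc_real; move: (boxind t) (damp_kernel _ _) => x y.
  by apply: complexP => /=; ring.
rewrite cintegral_real; congr (_%:C)%C.
pose g i (x : R) := \1_(`[a i, b i]%classic) x * akernel al (s i ord0 - x).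
rewrite (_ : (fun t => _) = (fun t : Rd => cphi (R := R) (d := d) * \prod_i g i (t i ord0))); last first.
  apply/funext => t; rewrite /damp_kernel mulrCA -big_split/=; congr (_ * _).
  apply: eq_bigr => i _; rewrite /g !mxE /akernel /gaussw.
  by rewrite -[t i ord0 - s i ord0]opprB sqrrN.
have gE : (\int[mu]_t (\prod_i g i (t i ord0))%:E)%E =
    (\prod_i asmooth (a i) (b i) al (s i ord0))%:E.
  rewrite ge0_integral_prod.
  - by rewrite -prodEFin; apply: eq_bigr => i _; rewrite asmoothE.
  - by move=> i; exact: measurable_Jkernel.
  - by move=> i x; rewrite mulr_ge0 ?itv_indic_ge0 ?akernel_ge0.
rewrite /Rintegral; under eq_integral do rewrite EFinM.
rewrite ge0_integralZl ?gE//.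
- by apply/measurable_EFinP; apply: measurable_prod_coor => i; exact: measurable_Jkernel.
- move=> t _; rewrite lee_fin; apply: prodr_ge0 => i _.
  by rewrite mulr_ge0 ?itv_indic_ge0 ?akernel_ge0.
- by rewrite lee_fin ltW// cphi_gt0.
Qed.

End box_indicator.

Section inversion.
Context {R : realType} {d : nat}.
Local Notation Rd := 'cV[R]_d.
Local Notation R2d := 'cV[R]_(d + d).
Local Notation mu := (lebesgue_cV d : {measure set Rd -> \bar R}).
Local Notation mu2 := (lebesgue_cV (d + d) : {measure set R2d -> \bar R}).
Local Notation phi := (@gaussian R d).
Local Notation c0 := (@cphi R d).

Variable f : Rd -> R[i].
Hypotheses (fi : sqintegrable mu f) (FI : cintegrable mu2 (stft f)).

Section against_box.
Variables a b : 'I_d -> R.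
Let chi (t : Rd) : R[i] := (boxind a b t)%:C%C.

Lemma damp_cvg (z : R2d) : damp k.+1%:R z @[k --> \oo] --> (1 : R).
Proof.
rewrite -[X in _ --> X]expR0 /damp.
apply: (@cvg_comp _ _ _ (fun k : nat => - (pi / k.+1%:R) * dotprod (dsubmx z) (dsubmx z)) expR _ (nbhs (0 : R))); last first.
  exact: continuous_expR.
apply: (@cvg_le_harmonic _ _ _ (pi * dotprod (dsubmx z) (dsubmx z))) => k.
rewrite subr0 mulNr normrN ger0_norm; first by rewrite /harmonic/= mulrAC.
by rewrite mulr_ge0 ?dotprod_ge0// divr_ge0 ?pi_ge0.
Qed.

(** The dominating function for the time side of [damped_moyal]. *)
Lemma boxind_gaussw_integrable : mu.-integrable setT
  (EFin \o (fun s => normc (f s) * (c0 * \prod_i (expR (pi * (a i ^+ 2 + b i ^+ 2) / 2) * gaussw (pi / 4) (s i ord0))))).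
Proof.
pose g i (x : R) := expR (pi * (a i ^+ 2 + b i ^+ 2) / 2) * gaussw (pi / 4) x.
have mg i : measurable_fun setT (g i) by apply: measurable_funM => //; exact: measurable_gaussw.
have g0 i x : 0 <= g i x by rewrite mulr_ge0 ?expR_ge0 ?gaussw_ge0.
pose G (s : Rd) := c0 * \prod_i g i (s i ord0).
have mG : measurable_fun setT G by apply: measurable_funM => //; exact: measurable_prod_coor.
have G0 s : 0 <= G s by rewrite mulr_ge0 ?prodr_ge0// ltW// cphi_gt0.
have pi8 : 0 < pi / 2 :> R by rewrite divr_gt0 ?pi_gt0.
have Gi : sqintegrable mu (fun s => (G s)%:C%C).
  split; first exact: cmeasurable_real.
  rewrite /sqnorm.
  under eq_integral => s _.
    rewrite normcR ger0_norm// /G exprMn -[X in _ * X]prodrXl EFinM; over.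
  rewrite ge0_integralZl ?lee_fin ?sqr_ge0//.
  - rewrite (@ge0_integral_prod _ _ (fun i x => g i x ^+ 2)).
    + rewrite (eq_bigr (fun i => (expR (pi * (a i ^+ 2 + b i ^+ 2) / 2) ^+ 2 * Num.sqrt (pi / (pi / 2)))%:E)).
        by rewrite prodEFin -EFinM ltry.
      move=> i _; rewrite EFinM -integral_gaussw// -ge0_integralZl ?lee_fin ?sqr_ge0//.
      * apply: eq_integral => x _; rewrite -EFinM /g exprMn; congr (_ * _)%:E.
        by rewrite /gaussw expr2 -expRD; congr expR; move: (pi : R) => p; field.
      * by apply/measurable_EFinP; exact: measurable_gaussw.
      * by move=> x _; rewrite lee_fin gaussw_ge0.
    + by move=> i; exact: measurable_funX.
    + by move=> i x; rewrite sqr_ge0.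
  - apply/measurable_EFinP; apply: (@measurable_prod_coor _ _ (fun i x => g i x ^+ 2)) => i.
    exact: measurable_funX.
  - by move=> s _; rewrite lee_fin prodr_ge0// => i _; rewrite sqr_ge0.
apply/integrableP; split.
  by apply/measurable_EFinP; apply: measurable_funM => //; apply: measurable_normc; case: fi.
apply: (@le_lt_trans _ _ (\int[mu]_s (normc (f s) * normc ((G s)%:C%C))%:E)%E).
  rewrite le_eqVlt; apply/orP; left; apply/eqP; apply: eq_integral => s _.
  by rewrite normcR -[LHS]/(`|normc (f s) * G s|%:E) normrM (ger0_norm (normc_ge0 _)).
by apply: le_lt_trans (CauchySchwarz_abs fi Gi) _; rewrite ltry.
Qed.

(** The damped identity in the limit. On the phase-space side the cutoff disappears
    since [stft f] is integrable; on the time side the smoothed indicators converge to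
    the indicator off the faces of the box. Boxes suffice for the inversion formula. *)
Lemma stft_box : cintegral mu2 (fun z => stft f z * (stft chi z)^*%C) =
  c0%:C%C * cintegral mu (fun s => f s * chi s).
Proof.
have [mf _] := fi; have [mF _] := FI.
have chi2 : sqintegrable mu chi := sqintegrable_boxind a b.
have [mchi _] := chi2.
have chi1 : cintegrable mu chi := cintegrable_boxind a b.
have mV := cmeasurable_stft mchi.
pose C := Num.sqrt (nrm2 mu chi) * Num.sqrt c0.
pose u k z := (damp k.+1%:R z)%:C%C * (stft f z * (stft chi z)^*%C).
pose v k (s : Rd) := f s * cintegral mu (fun t => (chi t)^*%C * (damp_kernel k.+1%:R (t - s))%:C%C).
have k0 (k : nat) : 0 < k.+1%:R :> R by rewrite ltr0n.
have uv k : cintegral mu2 (u k) = cintegral mu (v k) by exact: damped_moyal.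
have vE k s : v k s = f s * (c0 * \prod_i asmooth (a i) (b i) k.+1%:R (s i ord0))%:C%C.
  by rewrite /v integral_boxind_asmooth.
have [ur ui] : complex.Re (cintegral mu2 (u k)) @[k --> \oo] -->
      complex.Re (cintegral mu2 (fun z => stft f z * (stft chi z)^*%C)) /\
    complex.Im (cintegral mu2 (u k)) @[k --> \oo] -->
      complex.Im (cintegral mu2 (fun z => stft f z * (stft chi z)^*%C)).
  apply: (cdominated (g := fun z => C * normc (stft f z))).
  - move=> k; apply: cmeasurableM; first exact: cmeasurable_damp.
    by apply: cmeasurableM => //; exact: cmeasurableJ.
  - by apply: cmeasurableM => //; exact: cmeasurableJ.
  - apply: nearW => z; rewrite /u.
    rewrite -[X in _ --> X]mul1r; under eq_fun do rewrite cReM/= mul0r subr0.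
    by apply: cvgM; [exact: damp_cvg|exact: cvg_cst].
  - apply: nearW => z; rewrite /u.
    rewrite -[X in _ --> X]mul1r; under eq_fun do rewrite cImM/= mul0r addr0.
    by apply: cvgM; [exact: damp_cvg|exact: cvg_cst].
  - exact: (integrableZl measurableT C (cintegrable_normc FI)).
  - move=> k z; rewrite /u normcM (normcM (stft f z)) normc_conj normcR (ger0_norm (damp_ge0 _ _)).
    apply: (@le_trans _ _ (1 * (normc (stft f z) * C))); last by rewrite mul1r mulrC.
    apply: ler_pM; rewrite ?damp_ge0 ?mulr_ge0 ?normc_ge0//; first exact: damp_le1.
    by apply: ler_wpM2l; rewrite ?normc_ge0//; exact: normc_stft_le.
have aeJ : {ae mu, forall s : Rd, \prod_i asmooth (a i) (b i) k.+1%:R (s i ord0) @[k --> \oo] --> boxind a b s}.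
  have : {ae mu, forall s : Rd, forall i, s i ord0 != a i /\ s i ord0 != b i}.
    apply: (filter_forall (F := almost_everywhere mu)) => i.
    by apply: filterI; exact: ae_neq_coor.
  apply: filterS => s hs; rewrite /boxind.
  apply: cvg_big => //; last by move=> i _; have [] := hs i; exact: asmooth_cvg.
  by move=> x; exact: mul_continuous.
have [vr vi] : complex.Re (cintegral mu (v k)) @[k --> \oo] -->
      complex.Re (cintegral mu (fun s => f s * (c0 * boxind a b s)%:C%C)) /\
    complex.Im (cintegral mu (v k)) @[k --> \oo] -->
      complex.Im (cintegral mu (fun s => f s * (c0 * boxind a b s)%:C%C)).
  apply: (cdominated (g := fun s => normc (f s) * (c0 * \prod_i (expR (pi * (a i ^+ 2 + b i ^+ 2) / 2) * gaussw (pi / 4) (s i ord0))))).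
  - move=> k; apply: cmeasurableM => //.
    apply: (@cmeasurable_cintegral_cV R d d (fun p => (chi p.2)^*%C * (damp_kernel k.+1%:R (p.2 - p.1))%:C%C)).
    apply: cmeasurableM.
      by apply: cmeasurableJ; exact: (cmeasurable_comp mchi measurable_snd).
    apply: cmeasurable_real; apply: measurable_funM => //.
    apply: (measurableT_comp (f := fun r : Rd => \prod_i akernel k.+1%:R (r i ord0))).
      apply: (measurable_prod_coor (g := fun=> akernel k.+1%:R)) => i.
      by apply: measurable_funM => //; exact: measurable_gaussw.
    by apply: measurable_cVB; [exact: measurable_snd|exact: measurable_fst].
  - apply: cmeasurableM => //; apply: cmeasurable_real; apply: measurable_funM => //.
    exact: measurable_boxind.
  - apply: filterS aeJ => s hs; under eq_fun do rewrite vE cReM/= mulr0 subr0.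
    rewrite cReM/= mulr0 subr0; apply: cvgM; first exact: cvg_cst.
    by apply: cvgM; first exact: cvg_cst.
  - apply: filterS aeJ => s hs; under eq_fun do rewrite vE cImM/= mulr0 add0r.
    rewrite cImM/= mulr0 add0r; apply: cvgM; first exact: cvg_cst.
    by apply: cvgM; first exact: cvg_cst.
  - exact: boxind_gaussw_integrable.
  - move=> k s; rewrite vE normcM normcR ger0_norm; last first.
      apply: mulr_ge0; first by rewrite ltW// cphi_gt0.
      by apply: prodr_ge0 => i _; exact: asmooth_ge0.
    apply: ler_wpM2l; rewrite ?normc_ge0//; apply: ler_wpM2l; first by rewrite ltW// cphi_gt0.
    by apply: ler_prod => i _; rewrite asmooth_ge0 asmooth_le.
rewrite -cintegralZ; last first.
  by have := sqintegrable_mul fi chi2; under eq_fun do rewrite conjc_real.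
transitivity (cintegral mu (fun s => f s * (c0 * boxind a b s)%:C%C)); last first.
  by apply: eq_cintegral => s; rewrite rmorphM/= mulrCA.
apply: complexP.
- have E : (fun k => complex.Re (cintegral mu2 (u k))) = (fun k => complex.Re (cintegral mu (v k))).
    by apply/funext => k; rewrite uv.
  by rewrite E in ur; exact: (cvg_unique _ ur vr).
- have E : (fun k => complex.Im (cintegral mu2 (u k))) = (fun k => complex.Im (cintegral mu (v k))).
    by apply/funext => k; rewrite uv.
  by rewrite E in ui; exact: (cvg_unique _ ui vi).
Qed.

End against_box.

(** The inverse transform applied to [stft f]. *)
Definition synth (t : Rd) : R[i] := cintegral mu2 (fun z => stft f z * tfshift z phi t).

Lemma cmeasurable_synth : cmeasurable synth.
Proof.
have [mF _] := FI.
apply: (@cmeasurable_cintegral_cV R d (d + d) (fun p => stft f p.2 * tfshift p.2 phi p.1)).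
apply: cmeasurableM; first exact: (cmeasurable_comp mF measurable_snd).
exact: cmeasurable_tfgauss.
Qed.

Lemma cintegrable_stft_tf t : cintegrable mu2 (fun z => stft f z * tfshift z phi t).
Proof.
have [mF Ffin] := FI.
apply: (cintegrable_le (g := fun z => (normc (stft f z))%:E)) Ffin.
- by apply: cmeasurableM => //; exact: cmeasurable_tf1.
- exact: measurable_EFin_normc.
- by move=> z; rewrite lee_fin normcM ler_piMr ?normc_ge0// normc_tf_le1.
Qed.

Lemma normc_synth_le t : normc (synth t) <= fine (\int[mu2]_z (normc (stft f z))%:E)%E.
Proof.
have [mF Ffin] := FI.
have I0 : (0 <= \int[mu2]_z (normc (stft f z))%:E)%E.
  by apply: integral_ge0 => z _; rewrite lee_fin normc_ge0.
have mm := cintegrable_stft_tf t.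
rewrite -lee_fin fineK ?ge0_fin_numE//.
apply: le_trans (normc_cintegral mm) _; apply: ge0_le_integral => //.
- by move=> z _; rewrite lee_fin normc_ge0.
- by apply: measurable_EFin_normc; case: mm.
- exact: measurable_EFin_normc.
- by move=> z _; rewrite lee_fin normcM ler_piMr ?normc_ge0// normc_tf_le1.
Qed.

Lemma cintegrable_synth_box a b : cintegrable mu (fun t => synth t * (boxind a b t)%:C%C).
Proof.
set N := fine (\int[mu2]_z (normc (stft f z))%:E)%E.
apply: (@cintegrable_le _ _ _ _ _ (fun t => (N%:E * (boxind a b t)%:E)%E)).
- by apply: cmeasurableM; [exact: cmeasurable_synth|exact: cmeasurable_boxind].
- by apply: measurable_funeM; apply/measurable_EFinP; exact: measurable_boxind.
- move=> t; rewrite -EFinM lee_fin normcM normcR ger0_norm ?boxind_ge0//.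
  by apply: ler_wpM2r; rewrite ?boxind_ge0// normc_synth_le.
- have := integrableZl measurableT N (cintegrable_normc (cintegrable_boxind a b)).
  move=> /integrable_lty => /(_ measurableT); apply: le_lt_trans.
  rewrite le_eqVlt; apply/orP; left; apply/eqP; apply: eq_integral => t _ /=.
  by rewrite -[X in _ = (N%:E * X)%E]/((normc (boxind a b t)%:C%C)%:E) normcR ger0_norm ?boxind_ge0.
Qed.

Lemma synth_box a b : cintegral mu (fun t => synth t * (boxind a b t)%:C%C) =
  c0%:C%C * cintegral mu (fun s => f s * (boxind a b s)%:C%C).
Proof.
rewrite -stft_box.
have chi2 := sqintegrable_boxind a b; have [mchi _] := chi2.
have phi2 := @sqintegrable_gaussian R d.
pose K (p : R2d * Rd) := tfshift p.1 phi p.2 * (boxind a b p.2)%:C%C.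
have mK : cmeasurable K.
  apply: cmeasurableM; first exact: cmeasurable_tfgaussC.
  exact: (cmeasurable_comp mchi measurable_snd).
rewrite (_ : cintegral mu2 _ = cintegral mu2 (fun z => stft f z * cintegral mu (fun t => K (z, t)))).
  rewrite (@cFubini_kernel _ _ _ _ _ (Num.sqrt c0 * Num.sqrt (nrm2 mu (fun t => (boxind a b t)%:C%C))))//.
    apply: eq_cintegral => t; rewrite /synth mulrC -cintegralZ; last exact: cintegrable_stft_tf.
    by apply: eq_cintegral => z; rewrite /K; cbn [fst snd]; rewrite mulrC mulrA.
  move=> z; under eq_integral do rewrite /K normcM; cbn [fst snd].
  apply: le_trans (CauchySchwarz_abs (sqintegrable_tfshift z phi2) chi2) _.
  by rewrite nrm2_tfshift ?nrm2_gaussian//; exact: cmeasurable_gaussian.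
apply: eq_cintegral => z; congr (_ * _); rewrite /stft.
rewrite -innerC//; last exact: sqintegrable_tfshift.
by apply: eq_cintegral => t; rewrite conjc_real.
Qed.

(** By [synth_box] both functions have the same integral over every box. *)
Lemma synthE : synth = (fun t => c0%:C%C * f t) %[ae mu].
Proof.
have [mf _] := fi.
pose w t := synth t - c0%:C%C * f t.
have mw : cmeasurable w.
  apply: cmeasurableD; first exact: cmeasurable_synth.
  by apply: cmeasurableN; apply: cmeasurableM => //; exact: cmeasurable_cst.
have fb a b : cintegrable mu (fun t => f t * (boxind a b t)%:C%C).
  have := sqintegrable_mul fi (sqintegrable_boxind a b).
  by under eq_fun do rewrite conjc_real.
have wbE a b t : w t * (boxind a b t)%:C%C = synth t * (boxind a b t)%:C%C +
    (- c0%:C%C) * (f t * (boxind a b t)%:C%C).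
  by rewrite /w mulrBl mulNr mulrA.
have wbi a b : cintegrable mu (fun t => w t * (boxind a b t)%:C%C).
  under eq_fun do rewrite wbE.
  by apply: cintegrableD; [exact: cintegrable_synth_box|exact: cintegrableZ].
have wb0 a b : cintegral mu (fun t => w t * (boxind a b t)%:C%C) = 0.
  under eq_cintegral do rewrite wbE.
  rewrite cintegralD; [|exact: cintegrable_synth_box|exact: cintegrableZ].
  by rewrite cintegralZ// synth_box mulNr subrr.
(* one argument for the real and the imaginary part *)
have aux (T : R[i] -> R) : (T = @complex.Re R \/ T = @complex.Im R) ->
    ae_eq mu setT (fun t => (T (w t))%:E) (cst 0%E).
  move=> TE.
  have TM z (r : R) : T (z * r%:C%C) = T z * r.
    by case: TE => ->; case: z => x y /=; ring.
  have mT : measurable_fun setT (fun t => T (w t)) by case: TE => ->; case: mw.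
  have Tint u : T (cintegral mu u) = fine (\int[mu]_t (T (u t))%:E)%E by case: TE => ->.
  have Ti u : cintegrable mu u -> mu.-integrable setT (fun t => (T (u t))%:E).
    by move=> ui; case: TE => ->; [exact: cintegrable_Re|exact: cintegrable_Im].
  have restr a b : (EFin \o (fun t => T (w t))) \_ (cbox a b) =
      (fun t => (T (w t * (boxind a b t)%:C%C))%:E).
    rewrite restrict_EFin patch_indic; apply/funext => t /=.
    by rewrite TM boxindE.
  apply: (@ae_eq0_cbox _ _ (fun t => T (w t))) => //.
  - move=> k; apply/integrable_mkcond; first exact: measurable_cVbox.
    by rewrite -/(cbox (fun=> - k%:R) (fun=> k%:R)) restr; exact: Ti.
  - move=> a b; rewrite integral_mkcond restr.
    have := Tint (fun t => w t * (boxind a b t)%:C%C).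
    rewrite wb0 => h; have fn := integrable_fin_num measurableT (Ti _ (wbi a b)).
    by rewrite -(fineK fn) -h; case: TE => ->.
have hR := aux _ (or_introl erefl); have hI := aux _ (or_intror erefl).
apply: filterS2 hR hI => t /(_ I) hr /(_ I) hi _.
have : w t = 0 by apply: complexP; [case: hr|case: hi].
by move/eqP; rewrite subr_eq0 => /eqP.
Qed.

(** Pair the pointwise inversion formula [synthE] with [h] and exchange the
    integrals. *)
Theorem stft_inversion (h : Rd -> R[i]) : sqintegrable mu h ->
  c0%:C%C * inner mu h f = cintegral mu2 (fun z => (stft f z)^*%C * stft h z).
Proof.
move=> hh; have [mh _] := hh; have [mf _] := fi.
have phi2 := @sqintegrable_gaussian R d.
pose K (p : R2d * Rd) := h p.2 * (tfshift p.1 phi p.2)^*%C.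
have mK : cmeasurable K.
  apply: cmeasurableM; first exact: (cmeasurable_comp mh measurable_snd).
  by apply: cmeasurableJ; exact: cmeasurable_tfgaussC.
transitivity (cintegral mu (fun t => h t * (synth t)^*%C)).
  rewrite -cintegralZ; last exact: sqintegrable_mul.
  apply: cintegral_ae.
  - by apply: cmeasurableM; [exact: cmeasurable_cst|apply: cmeasurableM => //; exact: cmeasurableJ].
  - by apply: cmeasurableM => //; apply: cmeasurableJ; exact: cmeasurable_synth.
  - apply: filterS synthE => t /(_ I) E _.
    by rewrite E conjcM conjc_real mulrCA.
rewrite (@cFubini_kernel _ _ _ _ K (Num.sqrt (nrm2 mu h) * Num.sqrt c0))//.
- apply: eq_cintegral => t; rewrite /synth -cintegralJ; last exact: cintegrable_stft_tf.
  rewrite -cintegralZ; last by apply: cintegrableJ; exact: cintegrable_stft_tf.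
  by apply: eq_cintegral => z; rewrite (conjcM (stft f z)) mulrCA.
- exact: cintegrableJ.
- move=> z; under eq_integral do rewrite /K normcM normc_conj; cbn [fst snd].
  apply: le_trans (CauchySchwarz_abs hh (sqintegrable_tfshift z phi2)) _.
  by rewrite nrm2_tfshift ?nrm2_gaussian//; exact: cmeasurable_gaussian.
Qed.

End inversion.

(** * Weighted lattice sums *)

Lemma ler_sum_uniq {R : numDomainType} (I : eqType) (s t : seq I) (F : I -> R) :
  uniq s -> {subset s <= t} -> (forall i, 0 <= F i) ->
  \sum_(i <- s) F i <= \sum_(i <- t) F i.
Proof.
move=> + + F0; elim: s t => [|x s IH] t /=; first by rewrite big_nil sumr_ge0.
move=> /andP[xs us] st.
have xt : x \in t by apply: st; rewrite mem_head.
rewrite big_cons [leRHS](big_rem x)//= lerD2l; apply: IH => // y ys.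
have yt : y \in t by apply: st; rewrite inE ys orbT.
have yx : y != x by apply: contraNneq xs => <-.
by move: yt; rewrite (perm_mem (perm_to_rem xt)) inE (negbTE yx).
Qed.

Section integer_sums.
Context {R : realType}.

Lemma sum_uniq_nat (h : nat -> R) (s : seq nat) (C : R) : uniq s ->
  (forall i, 0 <= h i) -> (forall n, \sum_(i < n) h i <= C) ->
  \sum_(i <- s) h i <= C.
Proof.
move=> us h0 hC; pose N := (\max_(i <- s) i).+1.
apply: le_trans (hC N); rewrite -(big_mkord xpredT) /index_iota subn0.
apply: ler_sum_uniq => // i si.
by rewrite mem_iota /= add0n ltnS; exact: (leq_bigmax_seq i).
Qed.

(** Every natural number is the absolute value of at most two integers. *)
Lemma sum_uniq_absz (h : nat -> R) (s : seq int) (C : R) : uniq s ->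
  (forall i, 0 <= h i) -> (forall n, \sum_(i < n) h i <= C) ->
  \sum_(j <- s) h `|j|%N <= 2 * C.
Proof.
move=> us h0 hC; rewrite (bigID (fun j : int => 0 <= j))/= mulrDl !mul1r.
have inj (P : pred int) : {in [seq j <- s | P j] &, injective absz} ->
    \sum_(j <- s | P j) h `|j|%N <= C.
  move=> ij; rewrite -big_filter -(big_map absz xpredT h).
  by apply: sum_uniq_nat => //; rewrite map_inj_in_uniq ?filter_uniq.
apply: lerD; apply: inj => i j; rewrite !mem_filter => /andP[i0 _] /andP[j0 _].
  by move=> ij; rewrite -(gez0_abs i0) -(gez0_abs j0) ij.
move=> ij; rewrite -(opprK i) -(opprK j); congr (- _).
by rewrite -(ltz0_abs (m := i)) ?ltNge// -(ltz0_abs (m := j)) ?ltNge//; congr Posz.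
Qed.

(** The telescoping bound [3 - 2 / n] is proved by induction. *)
Lemma sum_inv_sqr (n : nat) : \sum_(i < n) (1 + i%:R ^+ 2)^-1 <= 3 :> R.
Proof.
suff h m : \sum_(i < m.+1) (1 + i%:R ^+ 2)^-1 <= 3 - 2 / m.+1%:R :> R.
  case: n => [|n]; first by rewrite big_ord0.
  by apply: le_trans (h n) _; rewrite gerBl divr_ge0.
elim: m => [|m IH].
  by rewrite big_ord_recr big_ord0/= expr0n/= addr0 add0r invr1; lra.
rewrite big_ord_recr/=; apply: le_trans (lerD IH (lexx _)) _.
rewrite -[m.+2]addn1 -[m.+1]addn1 !natrD; set x : R := m%:R.
have x0 : 0 <= x by rewrite ler0n.
rewrite -subr_ge0.
have -> : 3 - 2 / (x + 1 + 1) - (3 - 2 / (x + 1) + (1 + (x + 1) ^+ 2)^-1) =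
    (x ^+ 2 + x + 2) / ((x + 1) * (x + 1 + 1) * (1 + (x + 1) ^+ 2)).
  by field; rewrite !gt_eqF//; nra.
by rewrite divr_ge0 ?mulr_ge0 ?addr_ge0 ?sqr_ge0.
Qed.

(** Recentring at the integer part of [v] costs a factor [2 / a] per term and
    makes the bound uniform in [v]. *)
Lemma sum_uniq_inv_sqr (a v : R) (s : seq int) : 0 < a <= 2^-1 -> uniq s ->
  \sum_(j <- s) (1 + a * (j%:~R - v) ^+ 2)^-1 <= 12 / a.
Proof.
move=> /andP[a0 a1] us; pose m := Num.floor v.
have mv : m%:~R <= v by exact: floor_le.
have vm : v < m%:~R + 1 by have := floorD1_gt v; rewrite intrD.
pose h (i : nat) : R := 2 / a * (1 + i%:R ^+ 2)^-1.
apply: (@le_trans _ _ (\sum_(j <- s) h `|j - m|%N)).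
  apply: ler_sum => j _; rewrite /h.
  have -> : (`|j - m|%N%:R ^+ 2 : R) = (j%:~R - m%:~R) ^+ 2.
    by rewrite natr_absz intr_norm real_normK ?num_real// intrB.
  set x : R := j%:~R - m%:~R.
  have -> : j%:~R - v = x - (v - m%:~R) by rewrite /x; ring.
  set th := v - m%:~R; have th0 : 0 <= th by rewrite subr_ge0.
  have th1 : th <= 1 by rewrite lerBlDl ltW.
  have p1 : 0 < 1 + a * (x - th) ^+ 2 by rewrite ltr_wpDr// mulr_ge0 ?sqr_ge0// ltW.
  have p2 : 0 < 1 + x ^+ 2 by rewrite ltr_wpDr// sqr_ge0.
  rewrite -(invf_div a) -invfM lef_pV2 ?posrE ?mulr_gt0 ?divr_gt0//.
  have : x ^+ 2 <= 2 * (x - th) ^+ 2 + 2 by have := sqr_ge0 (x - 2 * th); nra.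
  by nra.
rewrite -(big_map (fun j => j - m) xpredT (fun j => h `|j|%N)).
rewrite (_ : 12 / a = 2 * (2 / a * 3)); last by ring.
apply: sum_uniq_absz.
- by rewrite map_inj_uniq//; exact: addIr.
- by move=> i; rewrite mulr_ge0 ?invr_ge0 ?addr_ge0 ?sqr_ge0 ?divr_ge0// ltW.
- by move=> n; rewrite -mulr_sumr ler_pM2l ?divr_gt0//; exact: sum_inv_sqr.
Qed.

(** A finite set of integer vectors lies in a product of finite sets of integers,
    over which the sum of the products is the product of the sums. *)
Lemma sum_uniq_prod n (g : 'I_n -> int -> R) (C : R) (s : seq 'cV[int]_n) :
  uniq s -> (forall i j, 0 <= g i j) ->
  (forall i (r : seq int), uniq r -> \sum_(j <- r) g i j <= C) ->
  \sum_(k <- s) \prod_i g i (k i ord0) <= C ^+ n.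
Proof.
move=> us g0 gC.
pose r := undup [seq (k : 'cV[int]_n) i ord0 | k <- s, i <- enum 'I_n].
have ur : uniq r by exact: undup_uniq.
have kr k i : k \in s -> k i ord0 \in r.
  move=> ks; rewrite mem_undup; apply/allpairsP; exists (k, i); split => //=.
  by rewrite mem_enum.
(* the spare index [size r] of the ordinals carries the value [0] in [G] *)
pose e (k : 'cV[int]_n) : {ffun 'I_n -> 'I_(size r).+1} := [ffun i => inord (index (k i ord0) r)].
have eK k i : k \in s -> nth 0 r (e k i) = k i ord0.
  move=> ks; rewrite ffunE inordK ?nth_index ?kr// ltnS index_size//.
pose G (f : {ffun 'I_n -> 'I_(size r).+1}) := \prod_i (if (f i < size r)%N then g i (nth 0 r (f i)) else 0).
have G0 f : 0 <= G f by apply: prodr_ge0 => i _; case: ifP.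
apply: (@le_trans _ _ (\sum_(f <- [seq e k | k <- s]) G f)).
  rewrite big_map big_seq [leRHS]big_seq; apply: ler_sum => k ks.
  apply: ler_prod => i _; rewrite g0/= eK//.
  by rewrite ffunE inordK ?index_mem ?kr// ltnS index_size.
apply: (@le_trans _ _ (\sum_f G f)).
  rewrite -[leRHS]big_enum/=; apply: ler_sum_uniq => //; last by move=> f _; rewrite mem_enum.
  rewrite map_inj_in_uniq// => k k' ks k's ee; apply/colP => i.
  by rewrite -[LHS](eK k i)// -[RHS](eK k' i)// ee.
rewrite /G -(bigA_distr_bigA (fun i (j : 'I_(size r).+1) => if (j < size r)%N then g i (nth 0 r j) else 0)).
apply: (@le_trans _ _ (\prod_(i < n) C)); last by rewrite prodr_const card_ord.
apply: ler_prod => i _; rewrite sumr_ge0/=; last by move=> j _; case: ifP.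
rewrite big_ord_recr/= ltnn addr0.
apply: le_trans (gC i r ur); rewrite [leRHS](big_nth 0) big_mkord.
by apply: ler_sum => j _; rewrite ltn_ord.
Qed.

End integer_sums.

Section nrm1.
Context {R : realType} {n : nat}.
Implicit Types (x y z : 'cV[R]_n) (A : 'M[R]_n).

Definition nrm1 z : R := \sum_i `|z i ord0|.
Definition mnorm A : R := \sum_i \sum_j `|A i j|.

Lemma nrm1_ge0 z : 0 <= nrm1 z. Proof. exact: sumr_ge0. Qed.
Lemma mnorm_ge0 A : 0 <= mnorm A.
Proof. by apply: sumr_ge0 => i _; exact: sumr_ge0. Qed.
Lemma nrm1N z : nrm1 (- z) = nrm1 z.
Proof. by apply: eq_bigr => i _; rewrite mxE normrN. Qed.
Lemma nrm1D x y : nrm1 (x + y) <= nrm1 x + nrm1 y.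
Proof.
by rewrite /nrm1 -big_split/=; apply: ler_sum => i _; rewrite mxE ler_normD.
Qed.
Lemma nrm1B x y : nrm1 (x - y) <= nrm1 x + nrm1 y.
Proof. by rewrite -(nrm1N y) nrm1D. Qed.
Lemma nrm1_coor z i : `|z i ord0| <= nrm1 z.
Proof. by rewrite /nrm1 (bigD1 i)//= lerDl sumr_ge0. Qed.

Lemma nrm1_mulmx A z : nrm1 (A *m z) <= mnorm A * nrm1 z.
Proof.
rewrite /mnorm mulr_suml; apply: ler_sum => i _; rewrite mxE.
apply: le_trans (ler_norm_sum _ _ _) _; rewrite mulr_suml.
by apply: ler_sum => j _; rewrite normrM ler_wpM2l// nrm1_coor.
Qed.

Lemma sqr_nrm1 z : nrm1 z ^+ 2 <= n%:R * \sum_i z i ord0 ^+ 2.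
Proof.
pose S := \sum_i z i ord0 ^+ 2.
have -> : n%:R * S = \sum_(i < n) \sum_(j < n) (z i ord0 ^+ 2 + z j ord0 ^+ 2) / 2.
  under eq_bigr do rewrite -mulr_suml big_split/= sumr_const card_ord.
  rewrite -mulr_suml big_split/= sumr_const card_ord sumrMnl -/S.
  by rewrite -[_ *+ n]mulr_natl; field.
rewrite expr2 /nrm1 mulr_suml; apply: ler_sum => i _; rewrite mulr_sumr.
apply: ler_sum => j _; rewrite -!(real_normK (num_real (z _ _))).
have := sqr_ge0 (`|z i ord0| - `|z j ord0|); nra.
Qed.

Lemma sum_sqr_nrm1 z : \sum_i z i ord0 ^+ 2 <= nrm1 z ^+ 2.
Proof.
rewrite expr2 {1}/nrm1 mulr_suml; apply: ler_sum => i _.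
by rewrite -(real_normK (num_real (z _ _))) expr2 ler_wpM2l// nrm1_coor.
Qed.

(** Under this condition [L] differs from [L0] by a relative perturbation of size at
    most one half, so that the inverse of [L] is controlled by that of [L0]. *)
Definition close (L0 L : 'M[R]_n) : Prop :=
  2 * mnorm (L - L0) * mnorm (invmx L0) <= 1.

Lemma nrm1_close (L0 L : 'M[R]_n) z : L0 \in unitmx -> close L0 L ->
  nrm1 z <= 2 * mnorm (invmx L0) * nrm1 (L *m z).
Proof.
move=> uL0 cL; set M := mnorm (invmx L0).
have : nrm1 z <= M * (nrm1 (L *m z) + mnorm (L - L0) * nrm1 z).
  rewrite {1}(_ : z = invmx L0 *m (L *m z - (L - L0) *m z)); last first.
    by rewrite -mulmxBl opprB addrC subrK mulKmx.
  apply: le_trans (nrm1_mulmx _ _) _; apply: ler_wpM2l; first exact: mnorm_ge0.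
  by apply: le_trans (nrm1B _ _) _; rewrite lerD2l nrm1_mulmx.
move: cL; rewrite /close -/M; have := nrm1_ge0 z; have := nrm1_ge0 (L *m z); nra.
Qed.

End nrm1.

Section weight_theory.
Context {R : realType} {d : nat}.
Local Notation R2d := 'cV[R]_(d + d).
Implicit Types (x y z : R2d).

Lemma weightE z : weight z = 1 + nrm1 z. Proof. by []. Qed.
Lemma weight_ge1 z : 1 <= weight z. Proof. by rewrite weightE lerDl nrm1_ge0. Qed.
Lemma weight_gt0 z : 0 < weight z. Proof. exact: lt_le_trans (weight_ge1 z). Qed.
Lemma weight_ge0 z : 0 <= weight z. Proof. exact: ltW (weight_gt0 z). Qed.
Lemma weightN z : weight (- z) = weight z. Proof. by rewrite !weightE nrm1N. Qed.
Lemma weightM x y : weight (x + y) <= weight x * weight y.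
Proof.
rewrite !weightE; have := nrm1D x y; have := nrm1_ge0 x; have := nrm1_ge0 y; nra.
Qed.

Lemma measurable_weight : measurable_fun setT (@weight R d).
Proof.
apply: measurable_funD => //; apply: measurable_sum => i.
by apply: measurableT_comp; [exact: normr_measurable|exact: measurable_coor].
Qed.

(** The absolute value of the transform of the Gaussian itself, see
    [normc_inner_gaussian]. *)
Definition gauss_stft (z : R2d) : R := @cphi R d * expR (- (pi / 2) * \sum_i z i ord0 ^+ 2).

Lemma gauss_stft_ge0 z : 0 <= gauss_stft z.
Proof. by rewrite mulr_ge0 ?expR_ge0// ltW// cphi_gt0. Qed.

(** The weight is dominated by an exponential, and half of the quadratic exponent
    absorbs the linear one after completing the square. *)
Lemma weight_gauss_le z : weight z * gauss_stft z <=
  @cphi R d * expR ((d + d)%:R / pi) * expR (- (pi / 4 * \sum_i z i ord0 ^+ 2)).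
Proof.
rewrite /gauss_stft mulrCA -!mulrA; apply: ler_wpM2l; first by rewrite ltW// cphi_gt0.
apply: (@le_trans _ _ (expR (nrm1 z) * expR (- (pi / 2) * \sum_i z i ord0 ^+ 2))).
  by apply: ler_wpM2r; rewrite ?expR_ge0// weightE expR_ge1Dx.
rewrite -!expRD ler_expR.
suff : nrm1 z <= (d + d)%:R / pi + pi / 4 * \sum_i z i ord0 ^+ 2.
  by move: (pi : R) (nrm1 z) => p q; lra.
have -> : (d + d)%:R / pi = \sum_(i < d + d) pi^-1 :> R by rewrite sumr_const card_ord mulr_natl.
rewrite mulr_sumr -big_split/=.
apply: ler_sum => i _; rewrite -(real_normK (num_real (z _ _))).
have p0 := pi_gt0 R; move: (pi : R) p0 `|z i ord0| => p p0 x.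
rewrite -subr_ge0 (_ : _ - _ = p / 4 * (x - 2 / p) ^+ 2); last by field; rewrite gt_eqF.
by rewrite mulr_ge0 ?sqr_ge0 ?divr_ge0// ltW.
Qed.

Lemma lattice_ptN (L : 'M[R]_(d + d)) k : lattice_pt L (- k) = - lattice_pt L k.
Proof. by rewrite /lattice_pt map_mxN mulmxN. Qed.
Lemma lattice_ptD (L : 'M[R]_(d + d)) k l :
  lattice_pt L (k + l) = lattice_pt L k + lattice_pt L l.
Proof. by rewrite /lattice_pt map_mxD mulmxDr. Qed.
Lemma lattice_ptB (L : 'M[R]_(d + d)) k l :
  lattice_pt L (k - l) = lattice_pt L k - lattice_pt L l.
Proof. by rewrite lattice_ptD lattice_ptN. Qed.

(** Bounds over finite sets of lattice points stand for convergent series. The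
    uniformity in the shift [w] makes the notion usable in Schur's test and under
    convolutions. *)
Definition lattice_summable (L : 'M[R]_(d + d)) (H : R2d -> R) (C : R) : Prop :=
  forall (w : R2d) (s : seq 'cV[int]_(d + d)), uniq s ->
    \sum_(k <- s) weight (lattice_pt L k - w) * H (lattice_pt L k - w) <= C.

(** For all [L] close to [L0] a Gaussian of [L *m y] is dominated by one and the same
    Gaussian of [y] ([nrm1_close]); it is then replaced by a product of summable functions
    [(1 + a * y_i ^+ 2)^-1]. *)
Lemma lattice_summable_gauss (L0 : 'M[R]_(d + d)) : L0 \in unitmx ->
  exists C, forall L, L \in unitmx -> close L0 L ->
    lattice_summable L gauss_stft C.
Proof.
move=> uL0; pose M := 2 * mnorm (invmx L0).
have M0 : 0 <= M by rewrite mulr_ge0 ?mnorm_ge0.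
pose b := M ^+ 2 * (d + d)%:R + 1.
have b0 : 0 < b by rewrite ltr_wpDl// mulr_ge0 ?sqr_ge0.
have pi0 : 0 < pi :> R := pi_gt0 R.
pose a := Num.min 2^-1 (pi / 4 / b).
have a0 : 0 < a by rewrite lt_min invr_gt0 ltr0n/= !divr_gt0.
pose Cc := @cphi R d * expR ((d + d)%:R / pi).
have Cc0 : 0 <= Cc by rewrite mulr_ge0 ?expR_ge0// ltW// cphi_gt0.
exists (Cc * (12 / a) ^+ (d + d)) => L uL cL w s us.
pose v : R2d := invmx L *m w.
pose g (i : 'I_(d + d)) (j : int) := (1 + a * (j%:~R - v i ord0) ^+ 2)^-1.
have g0 i j : 0 < 1 + a * (j%:~R - v i ord0) ^+ 2.
  by rewrite ltr_wpDr// mulr_ge0 ?sqr_ge0// ltW.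
apply: (@le_trans _ _ (\sum_(k <- s) Cc * \prod_i g i (k i ord0))); last first.
  rewrite -mulr_sumr; apply: ler_wpM2l => //; apply: sum_uniq_prod => //.
    by move=> i j; rewrite invr_ge0 ltW.
  by move=> i r ur; apply: sum_uniq_inv_sqr => //; rewrite a0/= ge_min lexx.
apply: ler_sum => k _; apply: le_trans (weight_gauss_le _) _; apply: ler_wpM2l => //.
set x := lattice_pt L k - w; pose y : R2d := map_mx intr k - v.
have xE : x = L *m y by rewrite mulmxBr mulKVmx.
have yx : \sum_i y i ord0 ^+ 2 <= b * \sum_i x i ord0 ^+ 2.
  apply: le_trans (sum_sqr_nrm1 _) _; have := nrm1_close y uL0 cL; rewrite -xE -/M => h.
  have q0 : 0 <= \sum_i x i ord0 ^+ 2 by apply: sumr_ge0 => i _; exact: sqr_ge0.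
  apply: (@le_trans _ _ (M ^+ 2 * nrm1 x ^+ 2)).
    by have h2 := mulr_ge0 M0 (nrm1_ge0 x); rewrite -exprMn ler_sqr ?nnegrE ?nrm1_ge0.
  have := sqr_nrm1 x; rewrite /b; have := sqr_ge0 M; nra.
apply: (@le_trans _ _ (expR (- (a * \sum_i y i ord0 ^+ 2)))).
  rewrite ler_expR lerN2; apply: le_trans (ler_wpM2l (ltW a0) yx) _.
  rewrite mulrA; apply: ler_wpM2r; first by apply: sumr_ge0 => i _; exact: sqr_ge0.
  by rewrite -ler_pdivlMr// ge_min lexx orbT.
rewrite mulr_sumr -sumrN expR_sum; apply: ler_prod => i _; rewrite expR_ge0/=.
rewrite expRN lef_pV2 ?posrE ?expR_gt0//.
by rewrite /y !mxE; exact: expR_ge1Dx.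
Qed.

End weight_theory.

Section lattice_convolution.
Context {R : realType} {d : nat}.
Local Notation R2d := 'cV[R]_(d + d).
Local Notation mu2 := (lebesgue_cV (d + d) : {measure set R2d -> \bar R}).

(** Since the weight is submultiplicative, it can be distributed over the two
    factors of a convolution, and the lattice sum is taken under the integral sign. *)
Lemma lattice_summable_conv (L : 'M[R]_(d + d)) (H F G : R2d -> R) (C N : R) :
  measurable_fun setT H -> measurable_fun setT F ->
  (forall z, 0 <= H z) -> (forall z, 0 <= F z) ->
  lattice_summable L H C ->
  (\int[mu2]_z (F z * weight z)%:E <= N%:E)%E ->
  (forall y, (G y)%:E <= \int[mu2]_z (H (z - y) * F z)%:E)%E ->
  lattice_summable L G (C * N).
Proof.
move=> mH mF H0 F0 HC FN GH w s us.
have mHy y : measurable_fun setT (fun z : R2d => H (z - y)).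
  exact: (measurableT_comp mH (measurable_addcV (- y))).
have C0 : 0 <= C.
  by have := HC 0 [::] isT; rewrite big_nil.
rewrite -lee_fin -sumEFin.
apply: (@le_trans _ _ (\sum_(k <- s) \int[mu2]_z
  (weight (lattice_pt L k - w) * (H (z - (lattice_pt L k - w)) * F z))%:E)%E).
  apply: lee_sum => k _; under eq_integral do rewrite EFinM.
  rewrite ge0_integralZl//.
  - by rewrite EFinM lee_wpmul2l// lee_fin weight_ge0.
  - by apply/measurable_EFinP; exact: measurable_funM.
  - by move=> z _; rewrite lee_fin mulr_ge0.
  - by rewrite lee_fin weight_ge0.
rewrite -ge0_integral_sum//; last 2 first.
- move=> k; apply/measurable_EFinP; apply: measurable_funM => //; exact: measurable_funM.
- by move=> k z _; rewrite lee_fin !mulr_ge0 ?weight_ge0.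
apply: (@le_trans _ _ (\int[mu2]_z (C%:E * (F z * weight z)%:E))%E); last first.
  rewrite ge0_integralZl//.
  - by rewrite EFinM lee_wpmul2l.
  - by apply/measurable_EFinP; apply: measurable_funM => //; exact: measurable_weight.
  - by move=> z _; rewrite lee_fin mulr_ge0 ?weight_ge0.
apply: ge0_le_integral => //.
- by move=> z _; apply: sume_ge0 => k _; rewrite lee_fin !mulr_ge0 ?weight_ge0.
- apply: emeasurable_sum => k; apply/measurable_EFinP.
  by apply: measurable_funM => //; exact: measurable_funM.
- apply: measurable_funeM; apply/measurable_EFinP.
  by apply: measurable_funM => //; exact: measurable_weight.
move=> z _; rewrite sumEFin -EFinM lee_fin.
rewrite [leRHS]mulrA.
have := HC (- (w + z)) [seq - k | k <- s]; rewrite map_inj_uniq; last exact: oppr_inj.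
move=> /(_ us); rewrite big_map => h.
apply: (@le_trans _ _ (\sum_(k <- s) (weight (lattice_pt L (- k) - - (w + z)) *
   H (lattice_pt L (- k) - - (w + z))) * (F z * weight z))); last first.
  by rewrite -mulr_suml -mulrA; apply: ler_wpM2r => //; rewrite mulr_ge0 ?weight_ge0.
apply: ler_sum => k _; rewrite lattice_ptN.
have -> : - lattice_pt L k - - (w + z) = z - (lattice_pt L k - w).
  by rewrite opprK opprB addrCA addrA [RHS]addrA (addrC z w) addrAC.
set y := lattice_pt L k - w.
have wy : weight y <= weight (z - y) * weight z.
  by have := weightM (- (z - y)) z; rewrite weightN opprB subrK.
apply: le_trans (ler_wpM2r _ wy) _; first by rewrite mulr_ge0.
by rewrite le_eqVlt; apply/orP; left; apply/eqP; ring.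
Qed.

End lattice_convolution.

(** * Off-diagonal decay of a Gabor system and continuity of time-frequency shifts *)

Section inner_sub.
Context {R : realType} {d} {T : measurableType d}.
Variable mu : {measure set T -> \bar R}.
Implicit Types f g h : T -> R[i].

Lemma innerBl f g h : sqintegrable mu f -> sqintegrable mu g ->
  sqintegrable mu h ->
  inner mu (fun x => f x - g x) h = inner mu f h - inner mu g h.
Proof.
move=> fi gi hi; rewrite (_ : (fun x => _) = fun x => f x + (-1) * g x); last first.
  by apply/funext => x; rewrite mulN1r.
by rewrite (innerDl fi (sqintegrableZ _ gi) hi) (innerZl _ gi hi) mulN1r.
Qed.

Lemma innerBr f g h : sqintegrable mu f -> sqintegrable mu g ->
  sqintegrable mu h ->
  inner mu h (fun x => f x - g x) = inner mu h f - inner mu h g.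
Proof.
move=> fi gi hi; rewrite (_ : (fun x => _) = fun x => f x + (-1) * g x); last first.
  by apply/funext => x; rewrite mulN1r.
rewrite (innerDr fi (sqintegrableZ _ gi) hi) (innerZr _ gi hi).
by rewrite rmorphN rmorph1 mulN1r.
Qed.

End inner_sub.

Section stft_estimates.
Context {R : realType} {d : nat}.
Local Notation Rd := 'cV[R]_d.
Local Notation R2d := 'cV[R]_(d + d).
Local Notation mu := (lebesgue_cV d : {measure set Rd -> \bar R}).
Local Notation mu2 := (lebesgue_cV (d + d) : {measure set R2d -> \bar R}).
Local Notation phi := (@gaussian R d).
Local Notation c0 := (@cphi R d).

Variable f : Rd -> R[i].
Hypotheses (fi : sqintegrable mu f)
  (fnu : cintegrable mu2 (fun z => stft f z * (weight z)%:C%C)).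

Let mF : cmeasurable (stft f). Proof. by apply: cmeasurable_stft; case: fi. Qed.
Let mnF : measurable_fun setT (fun z => normc (stft f z)).
Proof. exact: measurable_normc. Qed.

Lemma normc_stft_weight z :
  normc (stft f z * (weight z)%:C%C) = normc (stft f z) * weight z.
Proof. by rewrite normcM normcR ger0_norm ?weight_ge0. Qed.

Lemma cintegrable_stft : cintegrable mu2 (stft f).
Proof.
case: fnu => m fin; apply: (@cintegrable_le _ _ _ _ _
  (fun z => (normc (stft f z * (weight z)%:C%C))%:E)) => //.
  exact: measurable_EFin_normc.
move=> z; rewrite lee_fin normc_stft_weight ler_peMr ?normc_ge0//.
exact: weight_ge1.
Qed.

Definition modnorm : R := fine (\int[mu2]_z (normc (stft f z) * weight z)%:E)%E.

Lemma modnormE :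
  (\int[mu2]_z (normc (stft f z) * weight z)%:E)%E = modnorm%:E.
Proof.
case: fnu => m fin; rewrite /modnorm fineK// ge0_fin_numE.
  by under eq_integral do rewrite -normc_stft_weight.
by apply: integral_ge0 => z _; rewrite lee_fin mulr_ge0 ?normc_ge0 ?weight_ge0.
Qed.

Lemma modnorm_ge0 : 0 <= modnorm.
Proof.
by apply: fine_ge0; apply: integral_ge0 => z _; rewrite lee_fin mulr_ge0 ?normc_ge0 ?weight_ge0.
Qed.

(** Absolute values in [stft_inversion]. *)
Lemma normc_inner_le (h : Rd -> R[i]) : sqintegrable mu h ->
  ((normc (inner mu h f))%:E <=
   \int[mu2]_z (c0^-1 * (normc (stft h z) * normc (stft f z)))%:E)%E.
Proof.
move=> hi; have c00 := @cphi_gt0 R d.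
have [mh _] := hi.
have mVh := cmeasurable_stft mh; have mnh := measurable_normc mVh.
have E := stft_inversion fi cintegrable_stft hi.
pose K := Num.sqrt (nrm2 mu h) * Num.sqrt c0.
have ci : cintegrable mu2 (fun z => (stft f z)^*%C * stft h z).
  apply: (@cintegrable_le _ _ _ _ _ (fun z => (K * normc (stft f z))%:E)).
  - by apply: cmeasurableM => //; exact: cmeasurableJ.
  - by apply/measurable_EFinP; exact: measurable_funM.
  - move=> z; rewrite lee_fin normcM normc_conj mulrC; apply: ler_wpM2r; first exact: normc_ge0.
    exact: normc_stft_le.
  - have := integrableZl measurableT K (cintegrable_normc cintegrable_stft).
    by move=> /integrable_lty => /(_ measurableT).
have := normc_cintegral ci; rewrite -E normcM normcR (ger0_norm (ltW c00)).
under eq_integral do rewrite normcM normc_conj mulrC.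
move=> h1; under eq_integral do rewrite EFinM.
rewrite ge0_integralZl//.
- rewrite -[leLHS]mul1e -(mulVf (lt0r_neq0 c00)) EFinM -muleA.
  apply: lee_wpmul2l; first by rewrite lee_fin invr_ge0 ltW.
  by rewrite -EFinM.
- by apply/measurable_EFinP; exact: measurable_funM.
- by move=> z _; rewrite lee_fin mulr_ge0 ?normc_ge0.
- by rewrite lee_fin invr_ge0 ltW.
Qed.

Lemma normc_stft_tfshift (u : Rd -> R[i]) y z : sqintegrable mu u ->
  normc (stft (tfshift y u) z) = normc (stft u (z - y)).
Proof. by move=> ui; exact: (normc_inner_tfshift y z ui sqintegrable_gaussian). Qed.

Lemma normc_stft_gaussian z : normc (stft phi z) = gauss_stft z.
Proof. exact: normc_inner_gaussian. Qed.

Lemma measurable_gauss_stft : measurable_fun setT (@gauss_stft R d).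
Proof.
rewrite (_ : gauss_stft = fun z => normc (stft phi z)); last first.
  by apply/funext => z; rewrite normc_stft_gaussian.
by apply: measurable_normc; apply: cmeasurable_stft; exact: cmeasurable_gaussian.
Qed.

Let mulEFinA (c a a' b : R) : a = a' -> (c * (a * b))%:E = (c * a' * b)%:E.
Proof. by move=> ->; rewrite mulrA. Qed.

(** The inversion formula for a shifted Gaussian: [stft f] is dominated by its own
    convolution with a Gaussian, which gives pointwise control of an integrable
    function. *)
Lemma normc_stft_conv y : ((normc (stft f y))%:E <=
  \int[mu2]_z ((c0^-1 * gauss_stft (z - y)) * normc (stft f z))%:E)%E.
Proof.
have phi2 := @sqintegrable_gaussian R d.
have h := normc_inner_le (sqintegrable_tfshift y phi2).
have h' (a b : R) (w : \bar R) : a = b -> (b%:E <= w)%E -> (a%:E <= w)%E by move=> ->.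
have E : normc (stft f y) = normc (inner mu (tfshift y phi) f).
  exact: normc_innerC fi (sqintegrable_tfshift y phi2).
apply: le_trans (h' _ _ _ E h) _; rewrite le_eqVlt; apply/orP; left; apply/eqP.
apply: eq_integral => z _; apply: mulEFinA.
have E1 := normc_stft_tfshift y z phi2.
have E2 := normc_stft_gaussian (z - y).
exact: etrans E1 E2.
Qed.

(** The absolute value of the ambiguity function. By [normc_inner_tfshift2] it
    is the size of the entries of the Gram matrix of a Gabor system. *)
Definition amb (y : R2d) : R := normc (inner mu f (tfshift y f)).

Lemma amb_ge0 y : 0 <= amb y. Proof. exact: normc_ge0. Qed.
Lemma ambN y : amb (- y) = amb y. Proof. exact: normc_inner_tfshiftN. Qed.
Lemma normc_inner_tfshift2 p q :
  normc (inner mu (tfshift p f) (tfshift q f)) = amb (q - p).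
Proof. exact: normc_inner_tfshift. Qed.

Lemma amb_conv y : ((amb y)%:E <=
  \int[mu2]_z ((c0^-1 * normc (stft f (z - y))) * normc (stft f z))%:E)%E.
Proof.
have h := normc_inner_le (sqintegrable_tfshift y fi).
rewrite /amb (normc_innerC fi (sqintegrable_tfshift y fi)).
apply: le_trans h _; rewrite le_eqVlt; apply/orP; left; apply/eqP.
apply: eq_integral => z _; apply: mulEFinA.
exact: normc_stft_tfshift y z fi.
Qed.

Lemma lattice_summableZ (L : 'M[R]_(d + d)) (H : R2d -> R) (a C : R) : 0 <= a ->
  lattice_summable L H C -> lattice_summable L (fun z => a * H z) (a * C).
Proof.
move=> a0 HC w s us; under eq_bigr do rewrite mulrCA.
by rewrite -mulr_sumr; apply: ler_wpM2l => //; exact: HC.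
Qed.

(** [lattice_summable_conv] twice: the Gaussian dominates [stft f] by convolution, and
    [stft f] dominates [amb]. The bound inherits from the Gaussian its uniformity in the
    lattice. *)
Lemma lattice_summable_amb (L0 : 'M[R]_(d + d)) : L0 \in unitmx ->
  exists C, forall L, L \in unitmx -> close L0 L -> lattice_summable L amb C.
Proof.
move=> uL0; have [C hC] := lattice_summable_gauss uL0.
have c00 : 0 <= c0^-1 :> R by rewrite invr_ge0 ltW// cphi_gt0.
exists (c0^-1 * (c0^-1 * C * modnorm) * modnorm) => L uL cL.
have sF : lattice_summable L (fun z => normc (stft f z)) (c0^-1 * C * modnorm).
  apply: (@lattice_summable_conv _ _ _ (fun z => c0^-1 * gauss_stft z) (fun z => normc (stft f z))) => //.
  - by apply: measurable_funM => //; exact: measurable_gauss_stft.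
  - by move=> z; rewrite mulr_ge0 ?gauss_stft_ge0.
  - by move=> z; exact: normc_ge0.
  - by apply: lattice_summableZ => //; exact: hC.
  - by rewrite modnormE.
  - exact: normc_stft_conv.
apply: (@lattice_summable_conv _ _ _ (fun z => c0^-1 * normc (stft f z)) (fun z => normc (stft f z))) => //.
- exact: measurable_funM.
- by move=> z; rewrite mulr_ge0 ?normc_ge0.
- by move=> z; exact: normc_ge0.
- exact: lattice_summableZ.
- by rewrite modnormE.
- exact: amb_conv.
Qed.

End stft_estimates.

Section continuity_of_shifts.
Context {R : realType} {d : nat}.
Local Notation Rd := 'cV[R]_d.
Local Notation R2d := 'cV[R]_(d + d).
Local Notation mu := (lebesgue_cV d : {measure set Rd -> \bar R}).
Local Notation mu2 := (lebesgue_cV (d + d) : {measure set R2d -> \bar R}).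
Local Notation phi := (@gaussian R d).
Local Notation c0 := (@cphi R d).

Lemma abs_sin_le (x : R) : `|sin x| <= `|x|.
Proof.
wlog x0 : x / 0 <= x.
  move=> h; have [x0|x0] := leP 0 x; first exact: h.
  by rewrite -(normrN x) -(normrN (sin x)) -sinN; apply: h; rewrite oppr_ge0 ltW.
have [c _] := @MVT_segment R sin cos 0 x x0 (fun y _ => is_derive_sin y)
  (continuous_subspaceT (@continuous_sin R)).
rewrite sin0 !subr0 => ->; rewrite normrM ler_piMl//.
exact: norm_cos_le1.
Qed.

Lemma one_sub_cos_le (x : R) : 1 - cos x <= x ^+ 2 / 2.
Proof.
have -> : cos x = 1 - 2 * sin (x / 2) ^+ 2.
  have -> : x = (x / 2) *+ 2 by rewrite mulr2n -splitr.
  rewrite cos_mulr2n (_ : _ / 2 = x / 2); last by rewrite mulr2n -splitr.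
  have := cos2Dsin2 (x / 2); lra.
have : sin (x / 2) ^+ 2 <= (x / 2) ^+ 2.
  by rewrite -[leLHS]real_normK ?num_real// -[leRHS]real_normK ?num_real// ler_sqr ?nnegrE// abs_sin_le.
lra.
Qed.

Lemma normc_expi_sub1 (x : R) : normc (expi x - 1) ^+ 2 <= x ^+ 2.
Proof.
rewrite sqr_normcE/= subr0.
have := one_sub_cos_le x; have := cos2Dsin2 x; nra.
Qed.

(** Expand the square and use the explicit value of [inner_gaussian]. *)
Lemma nrm2_gaussian_shift (y : R2d) : nrm1 y <= 1 ->
  nrm2 mu (fun t => tfshift y phi t - phi t) <= c0 * (pi + pi ^+ 2) * nrm1 y.
Proof.
move=> y1; have phi2 := @sqintegrable_gaussian R d.
have y0 := nrm1_ge0 y.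
rewrite nrm2B//; last exact: sqintegrable_tfshift.
rewrite nrm2_tfshift; last exact: cmeasurable_gaussian.
rewrite nrm2_gaussian innerC// ; last exact: sqintegrable_tfshift.
rewrite cReJ inner_gaussian cReM/= mul0r subr0 cosN dotprod_split.
set q := \sum_i y i ord0 ^+ 2; set th := pi * dotprod _ _.
have q0 : 0 <= q by apply: sumr_ge0 => i _; exact: sqr_ge0.
have qy : q <= nrm1 y.
  by apply: le_trans (sum_sqr_nrm1 y) _; rewrite expr2 ler_piMr.
have thy : `|th| <= pi * nrm1 y.
  rewrite /th normrM (ger0_norm (pi_ge0 R)); apply: ler_wpM2l; first exact: pi_ge0.
  apply: le_trans (ler_norm_sum _ _ _) _.
  apply: (@le_trans _ _ (\sum_i `|usubmx y i ord0|)).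
    apply: ler_sum => i _; rewrite normrM ler_piMr//.
    by apply: le_trans y1; rewrite mxE; exact: nrm1_coor.
  rewrite /nrm1 big_split_ord/=; under eq_bigr do rewrite mxE.
  by rewrite lerDl sumr_ge0.
have c1 := one_sub_cos_le th.
have th2 : th ^+ 2 <= pi ^+ 2 * nrm1 y.
  rewrite -(real_normK (num_real th)).
  apply: (@le_trans _ _ ((pi * nrm1 y) ^+ 2)); first by rewrite ler_sqr ?nnegrE// mulr_ge0 ?pi_ge0.
  by rewrite exprMn ler_wpM2l ?sqr_ge0// expr2 ler_piMr.
have e1 : 1 - expR (- (pi / 2) * q) <= pi / 2 * q.
  by have := expR_ge1Dx (- (pi / 2) * q); rewrite mulNr; lra.
have e2 : expR (- (pi / 2) * q) <= 1.
  by rewrite -expR0 ler_expR mulNr oppr_le0 mulr_ge0 ?divr_ge0 ?pi_ge0.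
have e3 := expR_ge0 (- (pi / 2) * q).
have c2 := cos_le1 th.
have c3 := @cphi_gt0 R d.
move: (expR _) e1 e2 e3 => E e1 e2 e3.
rewrite (_ : c0 + c0 - 2 * (c0 * E * cos th) = c0 * (2 * (1 - E * cos th))); last by ring.
rewrite -mulrA; apply: ler_wpM2l; first exact: ltW.
have h1 : 1 - E * cos th <= (1 - E) + (1 - cos th) by nra.
have h2 : pi / 2 * q <= pi / 2 * nrm1 y by apply: ler_wpM2l; rewrite ?divr_ge0 ?pi_ge0.
move: (pi : R) (nrm1 y) (cos th) (th ^+ 2) c1 th2 e1 h1 h2 => p n C t c1 th2 e1 h1 h2.
by move: (p * n) (p ^+ 2 * n) (p / 2 * q) => *; nra.
Qed.

Lemma tfshift_commute (y z : R2d) (g : Rd -> R[i]) :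
  tfshift y (tfshift z g) = fun t =>
    expi (2 * pi * (dotprod (usubmx z) (dsubmx y) - dotprod (usubmx y) (dsubmx z))) *
    tfshift z (tfshift y g) t.
Proof.
rewrite !tfshift_comp (addrC z y); apply/funext => t; rewrite mulrA -expiD.
congr (expi _ * _).
by move: (dotprod _ _) (dotprod _ _) (pi : R) => a b p; ring.
Qed.

(** The exponent of the phase by which two time-frequency shifts commute. *)
Lemma symplectic_le (y z : R2d) :
  `|dotprod (usubmx z) (dsubmx y) - dotprod (usubmx y) (dsubmx z)| <= nrm1 y * nrm1 z.
Proof.
apply: le_trans (ler_normB _ _) _.
rewrite {1}/nrm1 big_split_ord/= mulrDl addrC; apply: lerD; rewrite mulr_suml;
    (apply: le_trans (ler_norm_sum _ _ _) _); apply: ler_sum => i _.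
  rewrite normrM !mxE; apply: ler_wpM2l => //; exact: nrm1_coor.
rewrite normrM mulrC !mxE; apply: ler_wpM2l => //; exact: nrm1_coor.
Qed.

Variable f : Rd -> R[i].
Hypotheses (fi : sqintegrable mu f)
  (fnu : cintegrable mu2 (fun z => stft f z * (weight z)%:C%C)).

(** By inversion, the squared norm is at most an integral of the transform of
    [f - pi(y) f] against that of [f]. Moving [pi(y)] to the Gaussian shifted by [z] costs
    the phase of [tfshift_commute], of size [nrm1 y * nrm1 z]; the growth in [z] is
    what the weight pays for. *)
Lemma nrm2_shift (y : R2d) : nrm2 mu (fun t => tfshift y f t - f t) <=
  2 * (c0^-1 * (Num.sqrt (nrm2 mu f) * (Num.sqrt (nrm2 mu (fun t => tfshift y phi t - phi t)) +
    2 * pi * Num.sqrt c0 * nrm1 y) * modnorm f)).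
Proof.
have phi2 := @sqintegrable_gaussian R d; have c00 := @cphi_gt0 R d.
have [mf _] := fi; have mphi := @cmeasurable_gaussian R d.
have yf2 := sqintegrable_tfshift y fi; have yphi2 := sqintegrable_tfshift y phi2.
pose g t := f t - tfshift y f t.
have g2 : sqintegrable mu g by exact: sqintegrableB.
set rho := Num.sqrt (nrm2 mu (fun t => tfshift y phi t - phi t)); set b := 2 * pi * Num.sqrt c0.
have b0 : 0 <= b by rewrite !mulr_ge0 ?pi_ge0 ?sqrtr_ge0.
have rho0 : 0 <= rho by exact: sqrtr_ge0.
have Vg z : normc (stft g z) <= Num.sqrt (nrm2 mu f) * ((rho + b * nrm1 y) * weight z).
  have zphi2 := sqintegrable_tfshift z phi2.
  have yzphi2 := sqintegrable_tfshift y zphi2.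
  pose u t := tfshift y (tfshift z phi) t - tfshift z phi t.
  have u2 : sqintegrable mu u by exact: sqintegrableB.
  have E : stft g z = inner mu (tfshift y f) u.
    rewrite (innerBr yzphi2 zphi2 yf2) (inner_tfshift y mf (cmeasurable_tfshift z mphi)).
    exact: (innerBl fi yf2 zphi2).
  rewrite E; apply: le_trans (CauchySchwarz yf2 u2) _.
  rewrite nrm2_tfshift//; apply: ler_wpM2l; first exact: sqrtr_ge0.
  set th := 2 * pi * (dotprod (usubmx z) (dsubmx y) - dotprod (usubmx y) (dsubmx z)).
  pose v t := tfshift y phi t - phi t.
  have v2 : sqintegrable mu v by exact: sqintegrableB.
  have uE : u = fun t => expi th * tfshift z v t + (expi th - 1) * tfshift z phi t.
    apply/funext => t; rewrite /u tfshift_commute -/th.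
    have -> : tfshift z v t = tfshift z (tfshift y phi) t - tfshift z phi t.
      by rewrite /tfshift /v mulrBr.
    by move: (expi th) => e; ring.
  rewrite uE; apply: le_trans (sqrt_nrm2D _ _) _.
  - by apply: sqintegrableZ; exact: sqintegrable_tfshift.
  - exact: sqintegrableZ.
  rewrite nrm2Z; last exact: sqintegrable_tfshift.
  rewrite nrm2Z// normc_expi expr1n mul1r !nrm2_tfshift//; last by case: v2.
  rewrite nrm2_gaussian sqrtrM ?sqr_ge0// -/rho sqrtr_sqr ger0_norm ?normc_ge0//.
  have h1 : normc (expi th - 1) <= 2 * pi * (nrm1 y * nrm1 z).
    apply: (@le_trans _ _ `|th|).
      by rewrite -ler_sqr ?nnegrE ?normc_ge0// real_normK ?num_real// normc_expi_sub1.
    rewrite /th normrM (ger0_norm (mulr_ge0 _ (pi_ge0 R)))//.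
    by apply: ler_wpM2l; [rewrite mulr_ge0 ?pi_ge0|exact: symplectic_le].
  apply: (@le_trans _ _ (rho + b * (nrm1 y * nrm1 z))).
    rewrite lerD2l /b mulrAC; apply: ler_wpM2r; first exact: sqrtr_ge0.
    exact: h1.
  rewrite weightE; have := nrm1_ge0 z; have := nrm1_ge0 y.
  move: (nrm1 y) (nrm1 z) => p q p0 q0.
  have : 0 <= rho * q by rewrite mulr_ge0.
  have : 0 <= b * p by rewrite mulr_ge0.
  by lra.
rewrite nrm2B// nrm2_tfshift//.
have -> : nrm2 mu f + nrm2 mu f - 2 * complex.Re (inner mu (tfshift y f) f) =
    2 * complex.Re (inner mu g f).
  by rewrite (innerBl fi yf2 fi) cReD cReN (inner_nrm2 fi)/=; ring.
apply: ler_wpM2l => //; apply: le_trans (Re_le_normc _) _.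
rewrite -lee_fin; apply: le_trans (normc_inner_le fi fnu g2) _.
rewrite -mulrA EFinM EFinM.
under eq_integral do rewrite EFinM.
have mg : cmeasurable g by case: g2.
have mVg := measurable_normc (cmeasurable_stft mg).
have mVf := measurable_normc (cmeasurable_stft mf).
rewrite ge0_integralZl//; last 3 first.
- by apply/measurable_EFinP; exact: measurable_funM.
- by move=> z _; rewrite lee_fin mulr_ge0 ?normc_ge0.
- by rewrite lee_fin invr_ge0 ltW.
apply: lee_wpmul2l; first by rewrite lee_fin invr_ge0 ltW.
rewrite EFinM muleA -(modnormE fnu) -EFinM -ge0_integralZl//; last 3 first.
- by apply/measurable_EFinP; apply: measurable_funM => //; exact: measurable_weight.
- by move=> z _; rewrite lee_fin mulr_ge0 ?normc_ge0 ?weight_ge0.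
- by rewrite lee_fin; exact: mulr_ge0 (sqrtr_ge0 _) (addr_ge0 rho0 (mulr_ge0 b0 (nrm1_ge0 y))).
apply: ge0_le_integral => //.
- by move=> z _; rewrite lee_fin mulr_ge0 ?normc_ge0.
- by apply/measurable_EFinP; exact: measurable_funM.
- apply: measurable_funeM; apply/measurable_EFinP; apply: measurable_funM => //.
  exact: measurable_weight.
move=> z _; rewrite -EFinM lee_fin; apply: le_trans (ler_wpM2r _ (Vg z)) _.
  exact: normc_ge0.
by rewrite le_eqVlt; apply/orP; left; apply/eqP; rewrite -!mulrA (mulrC (weight z)).
Qed.

(** The modulus of continuity is of the order of the square root of [nrm1 y], and
    [r] stands for this root. *)
Lemma nrm2_shift_small : exists2 C, 0 <= C & forall (r : R) (y : R2d),
  0 <= r <= 1 -> nrm1 y <= r ^+ 2 ->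
  nrm2 mu (fun t => tfshift y f t - f t) <= C * r.
Proof.
pose D := Num.sqrt (c0 * (pi + pi ^+ 2)) + 2 * pi * Num.sqrt c0.
have D0 : 0 <= D by rewrite addr_ge0 ?mulr_ge0 ?sqrtr_ge0 ?pi_ge0.
have c00 := @cphi_gt0 R d.
exists (2 * (c0^-1 * (Num.sqrt (nrm2 mu f) * D * modnorm f))).
  by rewrite !mulr_ge0 ?invr_ge0 ?sqrtr_ge0 ?modnorm_ge0// ltW.
move=> r y /andP[r0 r1] yr; apply: le_trans (nrm2_shift y) _.
rewrite -[leRHS]mulrA; apply: ler_wpM2l => //; rewrite -[leRHS]mulrA.
apply: ler_wpM2l; first by rewrite invr_ge0 ltW.
rewrite [leRHS]mulrAC; apply: ler_wpM2r; first exact: modnorm_ge0.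
rewrite -[leRHS]mulrA; apply: ler_wpM2l; first exact: sqrtr_ge0.
have r21 : r ^+ 2 <= 1 by rewrite expr_le1.
have h := nrm2_gaussian_shift (le_trans yr r21).
have k0 : 0 <= c0 * (pi + pi ^+ 2) by exact: mulr_ge0 (ltW c00) (addr_ge0 (pi_ge0 R) (sqr_ge0 _)).
rewrite /D [leRHS]mulrDl; apply: lerD.
  rewrite -[X in _ * X](ger0_norm r0) -(sqrtr_sqr r) -sqrtrM//.
  rewrite ler_wsqrtr//; apply: le_trans h _; exact: ler_wpM2l.
apply: ler_wpM2l; first by rewrite !mulr_ge0 ?pi_ge0 ?sqrtr_ge0.
by apply: le_trans yr _; rewrite expr2 ler_piMr.
Qed.

Lemma normc_inner_shift_le (h : Rd -> R[i]) (z z0 : R2d) : sqintegrable mu h ->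
  normc (inner mu h (tfshift z0 f)) <= normc (inner mu h (tfshift z f)) +
    Num.sqrt (nrm2 mu h) * Num.sqrt (nrm2 mu (fun t => tfshift (z - z0) f t - f t)).
Proof.
move=> hi; set u := fun t => _.
have zf := sqintegrable_tfshift (z - z0) fi.
have u2 : sqintegrable mu u by exact: sqintegrableB.
have zzf := sqintegrable_tfshift z0 zf.
have z0f := sqintegrable_tfshift z0 fi; have z0u := sqintegrable_tfshift z0 u2.
have -> : normc (inner mu h (tfshift z f)) = normc (inner mu h (tfshift z0 (tfshift (z - z0) f))).
  by rewrite (tfshift_split z z0) innerZr// normcM normc_conj normc_expi mul1r.
have -> : inner mu h (tfshift z0 f) = inner mu h (tfshift z0 (tfshift (z - z0) f)) - inner mu h (tfshift z0 u).
  have -> : tfshift z0 (tfshift (z - z0) f) = fun t => tfshift z0 u t + tfshift z0 f t.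
    by apply/funext => t; rewrite {2 3}/tfshift -mulrDr /u subrK.
  by rewrite innerDr// addrC addKr.
apply: le_trans (le_normcD _ _) _; rewrite lerD2l normcN.
apply: le_trans (CauchySchwarz hi z0u) _.
by rewrite nrm2_tfshift//; case: u2.
Qed.

End continuity_of_shifts.

(** * Schur's test and tilings of the integer lattice *)

Section finite_sums.
Context {R : realType}.

Lemma ler_sqr_sum (I : Type) (s : seq I) (b x : I -> R) :
  (forall i, 0 <= x i) ->
  (\sum_(i <- s) b i * x i) ^+ 2 <= (\sum_(i <- s) b i ^+ 2 * x i) * \sum_(i <- s) x i.
Proof.
move=> x0; pose S (f : I -> I -> R) := \sum_(i <- s) \sum_(j <- s) f i j.
have SD (f g : I -> I -> R) : S (fun i j => f i j + g i j) = S f + S g.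
  by rewrite /S -big_split/=; apply: eq_bigr => i _; rewrite big_split.
have E1 : (\sum_(i <- s) b i * x i) ^+ 2 = S (fun i j => b i * x i * (b j * x j)).
  by rewrite expr2 mulr_suml; apply: eq_bigr => i _; rewrite mulr_sumr.
have E2 : (\sum_(i <- s) b i ^+ 2 * x i) * \sum_(i <- s) x i = S (fun i j => b i ^+ 2 * x i * x j).
  by rewrite mulr_suml; apply: eq_bigr => i _; rewrite mulr_sumr.
have E3 : (\sum_(i <- s) b i ^+ 2 * x i) * \sum_(i <- s) x i = S (fun i j => b j ^+ 2 * x j * x i).
  by rewrite E2 /S exchange_big.
suff : 2 * (\sum_(i <- s) b i * x i) ^+ 2 <= 2 * ((\sum_(i <- s) b i ^+ 2 * x i) * \sum_(i <- s) x i) by lra.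
rewrite !mulrDl !mul1r {1}E2 E3 -SD E1 -SD; apply: ler_sum => i _; apply: ler_sum => j _.
have := mulr_ge0 (mulr_ge0 (x0 i) (x0 j)) (sqr_ge0 (b i - b j)); nra.
Qed.

(** The Cauchy-Schwarz inequality with the entries [x k j] as weights. *)
Lemma schur_rect (I : Type) (J : eqType) (s : seq I) (t : seq J) (b : J -> R)
    (x : I -> J -> R) (C C' : R) :
  (forall k j, 0 <= x k j) -> 0 <= C ->
  (forall k, \sum_(j <- t) x k j <= C) -> (forall j, j \in t -> \sum_(k <- s) x k j <= C') ->
  \sum_(k <- s) (\sum_(j <- t) b j * x k j) ^+ 2 <= C * C' * \sum_(j <- t) b j ^+ 2.
Proof.
move=> x0 C0 hC hC'.
apply: (@le_trans _ _ (\sum_(k <- s) (\sum_(j <- t) b j ^+ 2 * x k j) * C)).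
  apply: ler_sum => k _; apply: le_trans (ler_sqr_sum _ _ (x0 k)) _.
  by apply: ler_wpM2l => //; apply: sumr_ge0 => j _; rewrite mulr_ge0 ?sqr_ge0.
rewrite -mulr_suml mulrC -mulrA; apply: ler_wpM2l => //.
rewrite exchange_big/= mulr_sumr big_seq [leRHS]big_seq; apply: ler_sum => j jt.
by rewrite -mulr_sumr mulrC; apply: ler_wpM2r; rewrite ?sqr_ge0// hC'.
Qed.

Lemma schur_square (I : Type) (t : seq I) (b : I -> R) (x : I -> I -> R) (C : R) :
  (forall i j, 0 <= x i j) ->
  (forall i, \sum_(j <- t) x i j <= C) -> (forall j, \sum_(i <- t) x i j <= C) ->
  \sum_(i <- t) \sum_(j <- t) b i * b j * x i j <= C * \sum_(j <- t) b j ^+ 2.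
Proof.
move=> x0 hC hC'.
apply: (@le_trans _ _ (2^-1 * \sum_(i <- t) \sum_(j <- t) b i ^+ 2 * x i j +
    2^-1 * \sum_(i <- t) \sum_(j <- t) b j ^+ 2 * x i j)).
  rewrite !mulr_sumr -big_split; apply: ler_sum => i _.
  rewrite !mulr_sumr -big_split; apply: ler_sum => j _ /=.
  have := mulr_ge0 (x0 i j) (sqr_ge0 (b i - b j)); nra.
rewrite [X in _ + 2^-1 * X]exchange_big/=.
have h (y : I -> I -> R) : (forall i, \sum_(j <- t) y i j <= C) ->
    \sum_(i <- t) \sum_(j <- t) b i ^+ 2 * y i j <= C * \sum_(j <- t) b j ^+ 2.
  move=> hy; rewrite mulr_sumr; apply: ler_sum => i _.
  by rewrite -mulr_sumr mulrC; apply: ler_wpM2r; rewrite ?sqr_ge0.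
have h1 := h x hC; have h2 := h (fun i j => x j i) hC'.
by move: h1 h2 => /=; lra.
Qed.

(** Some element lies below the average. *)
Lemma pigeonhole (T : nat) (D : 'I_T.+1 -> R) (C : R) :
  \sum_a D a <= C -> exists a, T.+1%:R * D a <= C.
Proof.
move=> h; apply: contrapT => /forallNP hn.
have : \sum_(a < T.+1) C < \sum_(a < T.+1) T.+1%:R * D a.
  apply: ltr_sum => [|a _]; first by apply/hasP; exists ord0; rewrite ?mem_index_enum.
  by rewrite ltNge; apply/negP; exact: hn.
rewrite -[X in _ < X]mulr_sumr sumr_const card_ord -[X in X < _]mulr_natl => hs.
by move: hs; rewrite ltr_pM2l ?ltr0n// ltNge h.
Qed.

(** Summing over the keys first counts each pair of points with the same key once. *)
Lemma sum_by_key (I Q : eqType) (t : seq I) (key : I -> Q) (m : I -> I -> R) :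
  \sum_(q <- undup [seq key j | j <- t])
    \sum_(j <- t | key j == q) \sum_(j' <- t | key j' == q) m j j' =
  \sum_(j <- t) \sum_(j' <- t | key j' == key j) m j j'.
Proof.
rewrite (exchange_big_dep xpredT)//= big_seq [RHS]big_seq; apply: eq_bigr => j jt.
rewrite big_mkcond (bigD1_seq (key j)) ?undup_uniq ?mem_undup ?map_f//= eqxx.
by rewrite [X in _ + X]big1 ?addr0// => q /negPf; rewrite eq_sym => ->.
Qed.

Lemma sum_by_key1 (I Q : eqType) (t : seq I) (key : I -> Q) (m : I -> R) :
  \sum_(q <- undup [seq key j | j <- t]) \sum_(j <- t | key j == q) m j =
  \sum_(j <- t) m j.
Proof.
rewrite (exchange_big_dep xpredT)//= big_seq [RHS]big_seq; apply: eq_bigr => j jt.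
rewrite big_mkcond (bigD1_seq (key j)) ?undup_uniq ?mem_undup ?map_f//= eqxx.
by rewrite [X in _ + X]big1 ?addr0// => q /negPf; rewrite eq_sym => ->.
Qed.

End finite_sums.

Section boxes_of_lattice_points.
Context {R : realType} {n : nat}.
Variable T : nat.
Implicit Types (j : 'cV[int]_n).

(** The index of the box of side [T.+1] that contains [j], in the tiling shifted by
    [a]. *)
Definition boxkey (a : nat) j : 'cV[int]_n := \col_i ((j i ord0 + a%:Z) %/ T.+1%:Z)%Z.

Definition inrm j : nat := \sum_i `|j i ord0|%N.

Lemma nrm1_inrm j : nrm1 (map_mx intr j : 'cV[R]_n) = (inrm j)%:R.
Proof.
rewrite /nrm1 /inrm natr_sum; apply: eq_bigr => i _.
by rewrite mxE natr_absz intr_norm.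
Qed.

(** Moving by one unit crosses a boundary of exactly one of the [T.+1] shifted
    partitions of the integers into intervals of length [T.+1]. *)
Lemma count_divz_neq (x y : int) :
  (\sum_(a < T.+1) ((x + a%:Z) %/ T.+1%:Z != (y + a%:Z) %/ T.+1%:Z)%Z <= `|x - y|)%N.
Proof.
have step (u : int) (a : nat) : ((u + a%:Z) %/ T.+1%:Z != (u + 1 + a%:Z) %/ T.+1%:Z)%Z ->
    (T.+1%:Z %| u + 1 + a%:Z)%Z.
  set v := u + a%:Z; have -> : u + 1 + a%:Z = v + 1 by rewrite addrAC.
  apply: contraNT => nd; have ve := divz_eq v T.+1%:Z.
  have r0 := @modz_ge0 v T.+1%:Z isT; have r1 := @ltz_pmod v T.+1%:Z isT.
  have r2 : (v %% T.+1%:Z)%Z + 1 < T.+1%:Z.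
    rewrite lt_neqAle; apply/andP; split; last by lia.
    apply: contra nd => /eqP E; rewrite ve -addrA E -[X in _ + X]mul1r -mulrDl.
    exact: dvdz_mull.
  move: (v %/ T.+1%:Z)%Z (v %% T.+1%:Z)%Z ve r0 r2 => q e ve r0 r2.
  by rewrite ve -addrA divzMDl// divz_small ?addr0//; apply/andP; split; lia.
have step1 (u : int) : (\sum_(a < T.+1) ((u + a%:Z) %/ T.+1%:Z != (u + 1 + a%:Z) %/ T.+1%:Z)%Z <= 1)%N.
  have [/existsP[a0 h0]|/existsPn h] := boolP [exists a : 'I_T.+1, ((u + a%:Z) %/ T.+1%:Z != (u + 1 + a%:Z) %/ T.+1%:Z)%Z].
    rewrite (bigD1 a0)//= h0 big1// => a aa0; apply/eqP; rewrite eqb0 negbK.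
    have lt := ltn_ord a; have lt0 := ltn_ord a0.
    have {}aa0 : nat_of_ord a <> a0 by move/val_inj; exact/eqP.
    apply/eqP; apply: contrapT => /eqP h1.
    have := step u a h1; have := step u a0 h0 => d0 d1.
    have d2 : dvdn (absz T.+1%:Z) (absz ((u + 1 + a%:Z) - (u + 1 + a0%:Z))%R) := rpredB d1 d0.
    apply: aa0; apply: contrapT => ne.
    have d3 : (absz (u + 1 + a%:Z - (u + 1 + a0%:Z))%R < T.+1)%N by clear -lt lt0; lia.
    have d4 : (0 < absz (u + 1 + a%:Z - (u + 1 + a0%:Z))%R)%N by clear -ne; lia.
    by have := dvdn_leq d4 d2; rewrite leqNgt d3.
  by rewrite big1// => a _; apply/eqP; rewrite eqb0; exact: h.
have up (u : int) (m : nat) : (\sum_(a < T.+1) ((u + a%:Z) %/ T.+1%:Z != (u + m%:Z + a%:Z) %/ T.+1%:Z)%Z <= m)%N.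
  elim: m => [|m IH].
    by rewrite big1// => a _; rewrite addr0 eqxx.
  rewrite -[X in (_ <= X)%N]addn1; apply: leq_trans _ (leq_add IH (step1 (u + m%:Z))).
  rewrite -big_split/=; apply: leq_sum => a _.
  have -> : u + m.+1%:Z = u + m%:Z + 1 by rewrite -addn1 PoszD addrA.
  have tri (p q r : int) : ((p != r) <= (p != q) + (q != r))%N.
    by case: (eqVneq p q) => [->//|_]; case: (p != r).
  exact: tri.
have [xy|xy] := leP x y.
  have -> : y = x + `|x - y|%N%:Z by lia.
  by have := up x `|x - y|%N; rewrite opprD addNKr abszN absz_nat.
have E : x = y + `|x - y|%N%:Z by lia.
have := up y `|x - y|%N; rewrite -E; apply: leq_trans.
by apply: leq_sum => a _; rewrite eq_sym.
Qed.

Lemma count_boxkey_neq j j' :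
  (\sum_(a < T.+1) (boxkey a j != boxkey a j') <= inrm (j - j'))%N.
Proof.
apply: (@leq_trans (\sum_(a < T.+1) \sum_i ((j i ord0 + a%:Z) %/ T.+1%:Z != (j' i ord0 + a%:Z) %/ T.+1%:Z)%Z)).
  apply: leq_sum => a _; case: eqVneq => // h.
  rewrite lt0n sum_nat_eq0; apply: contra_neqN h => /forallP h.
  by apply/colP => i; rewrite !mxE; apply/eqP; have := h i; rewrite eqb0 negbK.
rewrite exchange_big/=; apply: leq_sum => i _; rewrite !mxE.
exact: count_divz_neq.
Qed.

(** A pair of points is separated by a number of shifted tilings that is at most its
    distance ([count_boxkey_neq]), hence by few of them on average. *)
Lemma exists_tiling (t : seq 'cV[int]_n) (w : 'cV[int]_n -> 'cV[int]_n -> R) :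
  (forall j j', 0 <= w j j') ->
  exists a : 'I_T.+1, T.+1%:R *
    \sum_(j <- t) \sum_(j' <- t | boxkey a j' != boxkey a j) w j j' <=
    \sum_(j <- t) \sum_(j' <- t) (inrm (j' - j))%:R * w j j'.
Proof.
move=> w0; apply: pigeonhole; rewrite exchange_big/=; apply: ler_sum => j _.
under eq_bigr do rewrite big_mkcond; rewrite exchange_big/=; apply: ler_sum => j' _.
rewrite (eq_bigr (fun a : 'I_T.+1 => (boxkey a j' != boxkey a j)%:R * w j j')); last first.
  by move=> a _; case: ifP; rewrite ?mul1r ?mul0r.
rewrite -mulr_suml -natr_sum; apply: ler_wpM2r => //.
by rewrite ler_nat count_boxkey_neq.
Qed.

Lemma boxkey_dist (a : 'I_T.+1) j :
  (inrm (j - (T.+1)%:Z *: boxkey a j) <= n * T.+1)%N.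
Proof.
apply: (@leq_trans (\sum_(i < n) T.+1)); last by rewrite sum_nat_const card_ord.
apply: leq_sum => i _; rewrite !mxE; set v := j i ord0 + a%:Z.
have := divz_eq v T.+1%:Z; have := @modz_ge0 v T.+1%:Z isT; have := @ltz_pmod v T.+1%:Z isT.
have := ltn_ord a; rewrite (mulrC (v %/ T.+1%:Z)%Z).
have key (p q : int) : (a < T.+1)%N -> q < T.+1%:Z -> 0 <= q -> v = p + q ->
  (`|j i ord0 - p| <= T.+1)%N by rewrite /v; lia.
exact: key.
Qed.

Definition ibox (N : nat) : seq 'cV[int]_n :=
  map (fun f : {ffun 'I_n -> 'I_(N + N).+1} => \col_i ((f i)%:Z - N%:Z))
    (enum {: {ffun 'I_n -> 'I_(N + N).+1}}).

Lemma ibox_uniq N : uniq (ibox N).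
Proof.
rewrite map_inj_uniq ?enum_uniq// => f g fg; apply/ffunP => i; apply: val_inj => /=.
by have /colP/(_ i) := fg; rewrite !mxE => /addIr [].
Qed.

Lemma mem_ibox N j : (inrm j <= N)%N -> j \in ibox N.
Proof.
move=> jN; have ji i : (`|j i ord0| <= N)%N.
  by apply: leq_trans jN; rewrite /inrm (bigD1 i)//= leq_addr.
apply/mapP; exists [ffun i => inord (absz (j i ord0 + N%:Z))]; first by rewrite mem_enum.
apply/colP => i; rewrite mxE ffunE; have := ji i; move: (j i ord0) => x hx; rewrite inordK; lia.
Qed.

Lemma ibox_inrm N j : j \in ibox N -> (inrm j <= n * N)%N.
Proof.
move=> /mapP[f _ ->]; apply: (@leq_trans (\sum_(i < n) N)); last by rewrite sum_nat_const card_ord.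
apply: leq_sum => i _; rewrite mxE; have := ltn_ord (f i); move: (nat_of_ord (f i)) => m; lia.
Qed.

End boxes_of_lattice_points.

(** * Finite combinations and greedy approximation *)

Section finite_systems.
Context {R : realType} {d} {T : measurableType d}.
Variable mu : {measure set T -> \bar R}.
Variables (I : eqType) (e : I -> T -> R[i]).
Hypothesis ei : forall j, sqintegrable mu (e j).
Implicit Types (h : T -> R[i]) (s t : seq I) (b c : I -> R[i]).
Local Notation Re := complex.Re.

Definition lcomb t c : T -> R[i] := fun x => \sum_(j <- t) c j * e j x.
Definition qsum s h : R := \sum_(k <- s) normc (inner mu h (e k)) ^+ 2.
Definition csqr t c : R := \sum_(j <- t) normc (c j) ^+ 2.

Lemma csqr_ge0 t c : 0 <= csqr t c.
Proof. by apply: sumr_ge0 => j _; exact: sqr_ge0. Qed.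
Lemma qsum_ge0 s h : 0 <= qsum s h.
Proof. by apply: sumr_ge0 => j _; exact: sqr_ge0. Qed.

Lemma sqintegrable_lcomb t c : sqintegrable mu (lcomb t c).
Proof. by apply: sqintegrable_sum => j; exact: sqintegrableZ. Qed.

Lemma inner_lcombl t c h : sqintegrable mu h ->
  inner mu (lcomb t c) h = \sum_(j <- t) c j * inner mu (e j) h.
Proof.
move=> hi; rewrite /lcomb (@inner_suml _ _ _ mu _ t (fun j x => c j * e j x))//.
  by apply: eq_bigr => j _; rewrite innerZl.
by move=> j; exact: sqintegrableZ.
Qed.

Lemma inner_lcombr t c h : sqintegrable mu h ->
  inner mu h (lcomb t c) = \sum_(j <- t) (c j)^*%C * inner mu h (e j).
Proof.
move=> hi; rewrite /lcomb (@inner_sumr _ _ _ mu _ t (fun j x => c j * e j x))//.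
  by apply: eq_bigr => j _; rewrite innerZr.
by move=> j; exact: sqintegrableZ.
Qed.

Lemma Re_sum (J : Type) (s : seq J) (P : pred J) (f : J -> R[i]) :
  Re (\sum_(j <- s | P j) f j) = \sum_(j <- s | P j) Re (f j).
Proof. by apply: (big_morph _ cReD). Qed.

(** Real parts suffice: the sum over all pairs is real. *)
Definition gram c (j j' : I) : R := Re (c j * ((c j')^*%C * inner mu (e j) (e j'))).

Lemma nrm2_lcomb t c :
  nrm2 mu (lcomb t c) = \sum_(j <- t) \sum_(j' <- t) gram c j j'.
Proof.
have ti := sqintegrable_lcomb t c.
have -> : nrm2 mu (lcomb t c) = Re (inner mu (lcomb t c) (lcomb t c)) by rewrite inner_nrm2.
rewrite inner_lcombl// Re_sum; apply: eq_bigr => j _.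
by rewrite inner_lcombr// mulr_sumr Re_sum.
Qed.

Lemma gram_le c j j' :
  `|gram c j j'| <= normc (c j) * normc (c j') * normc (inner mu (e j) (e j')).
Proof.
apply: le_trans (normr_Re_le _) _.
by rewrite normcM (normcM (c j')^*%C) normc_conj mulrA.
Qed.

Variable B : R.
Hypotheses (B0 : 0 < B)
  (synth_le : forall t c, uniq t -> nrm2 mu (lcomb t c) <= B * csqr t c).

(** Duality: apply the synthesis bound to the coefficients [inner mu h (e k)]. *)
Lemma qsum_le s h : uniq s -> sqintegrable mu h -> qsum s h <= B * nrm2 mu h.
Proof.
move=> us hi; pose c k := inner mu h (e k).
have E : inner mu h (lcomb s c) = (qsum s h)%:C%C.
  rewrite inner_lcombr// /qsum rmorph_sum/=; apply: eq_bigr => k _.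
  by rewrite mulrC mulcJ.
have h1 := CauchySchwarz2 hi (sqintegrable_lcomb s c).
rewrite E normcR real_normK ?num_real// in h1.
have h2 := synth_le c us; rewrite -[csqr s c]/(qsum s h) in h2.
have q0 := qsum_ge0 s h; have n0 := nrm2_ge0 mu h.
have [->|qn] := eqVneq (qsum s h) 0; first by rewrite mulr_ge0// ltW.
have qp : 0 < qsum s h by rewrite lt_neqAle eq_sym qn.
rewrite -(ler_pM2r qp) -expr2; apply: le_trans h1 _.
by rewrite (mulrC B) -mulrA; apply: ler_wpM2l.
Qed.

Lemma qsumD s h h' : sqintegrable mu h -> sqintegrable mu h' ->
  qsum s (fun x => h x + h' x) <= 2 * qsum s h + 2 * qsum s h'.
Proof.
move=> hi hi'; rewrite !mulr_sumr -big_split/=; apply: ler_sum => k _.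
by rewrite innerDl//; exact: normc_sqrD.
Qed.

Lemma sum_extend (V : nmodType) (t t' : seq I) (F : I -> V) :
  uniq t -> uniq t' -> {subset t <= t'} ->
  \sum_(j <- t') (if j \in t then F j else 0) = \sum_(j <- t) F j.
Proof.
move=> ut ut' tt'; rewrite -big_mkcond -big_filter; apply: perm_big.
apply: uniq_perm => //; first exact: filter_uniq.
move=> j; rewrite mem_filter; case: (boolP (j \in t)) => //= jt; exact: tt'.
Qed.

(** The lower frame inequality with a finite set of indices that depends on [h].
    Up to an arbitrarily small loss in [A] this is the inequality for the whole series,
    and it allows the whole argument to use finite sums only. *)
Definition frame_low (A : R) := forall h, sqintegrable mu h ->
  exists2 s, uniq s & A * nrm2 mu h <= qsum s h.

Variable A : R.
Hypotheses (A0 : 0 < A) (AB : A <= B) (fA : frame_low A).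

(** One step subtracts from the remainder [r] the combination with coefficients
    [B^-1 * inner mu r (e k)] over a finite set on which the frame inequality holds for
    [r]. The synthesis bound shows that the squared norm drops by the factor
    [1 - A / B]. The square sum of the coefficients stays controlled by the norm of [h]. *)
Lemma greedy (N : nat) : exists2 C, 0 <= C & forall h, sqintegrable mu h ->
  exists t b, [/\ uniq t,
    nrm2 mu (fun x => h x - lcomb t b x) <= (1 - A / B) ^+ N * nrm2 mu h &
    csqr t b <= C * nrm2 mu h].
Proof.
have AB1 : A / B <= 1 by rewrite ler_pdivrMr// mul1r.
elim: N => [|N [C C0 IH]].
  exists 0 => // h hi; exists [::], (fun=> 0); split => //.
    rewrite expr0 mul1r (_ : (fun x => _) = h)//.
    by apply/funext => x; rewrite /lcomb big_nil subr0.
  by rewrite /csqr big_nil mul0r.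
exists (2 * C + 2 / B); first by rewrite addr_ge0 ?mulr_ge0 ?invr_ge0// ltW.
move=> h hi; have [t [b [ut rN bC]]] := IH h hi.
pose r x := h x - lcomb t b x.
have ri : sqintegrable mu r by apply: sqintegrableB => //; exact: sqintegrable_lcomb.
have [s us rs] := fA ri.
pose c k := (B^-1)%:C%C * inner mu r (e k).
pose t' := undup (t ++ s).
(* the coefficients of the sum of two combinations over the union of their indices *)
pose b' j := (if j \in t then b j else 0) + (if j \in s then c j else 0).
have ut' : uniq t' := undup_uniq _.
have tt' : {subset t <= t'} by move=> j jt; rewrite mem_undup mem_cat jt.
have st' : {subset s <= t'} by move=> j js; rewrite mem_undup mem_cat js orbT.
have lE x : lcomb t' b' x = lcomb t b x + lcomb s c x.
  rewrite /lcomb -(sum_extend _ ut ut' tt') -(sum_extend _ us ut' st') -big_split/=.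
  apply: eq_bigr => j _; rewrite /b' mulrDl.
  by case: ifP => _; case: ifP => _; rewrite ?mul0r.
have cE : csqr s c = B ^- 2 * qsum s r.
  rewrite /csqr /qsum mulr_sumr; apply: eq_bigr => k _.
  by rewrite /c normcM normcR exprMn real_normK ?num_real// exprVn.
have rB := qsum_le us ri.
exists t', b'; split => //.
  rewrite (_ : (fun x => _) = fun x => r x - lcomb s c x); last first.
    by apply/funext => x; rewrite lE /r opprD addrA.
  rewrite nrm2B//; last exact: sqintegrable_lcomb.
  have -> : complex.Re (inner mu r (lcomb s c)) = B^-1 * qsum s r.
    rewrite inner_lcombr// Re_sum /qsum mulr_sumr; apply: eq_bigr => k _.
    rewrite /c conjcM conjc_real -mulrA (mulrC (_^*)%C) mulcJ.
    by rewrite cReM/= mulr0 subr0.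
  have h1 : nrm2 mu (lcomb s c) <= B^-1 * qsum s r.
    apply: le_trans (synth_le c us) _; rewrite cE.
    rewrite le_eqVlt; apply/orP; left; apply/eqP; field; exact: lt0r_neq0.
  have h2 : B^-1 * (A * nrm2 mu r) <= B^-1 * qsum s r.
    by apply: ler_wpM2l; rewrite ?invr_ge0// ltW.
  apply: (@le_trans _ _ ((1 - A / B) * nrm2 mu r)).
    have -> : (1 - A / B) * nrm2 mu r = nrm2 mu r - B^-1 * (A * nrm2 mu r).
      by field; exact: lt0r_neq0.
    lra.
  by rewrite exprS -mulrA; apply: ler_wpM2l; [rewrite subr_ge0|].
have rh : nrm2 mu r <= nrm2 mu h.
  apply: le_trans rN _; rewrite ler_piMl ?nrm2_ge0// exprn_ile1 ?subr_ge0//.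
  by rewrite gerBl divr_ge0// ltW.
apply: (@le_trans _ _ (2 * csqr t b + 2 * csqr s c)).
  rewrite /csqr -(sum_extend (fun j => normc (b j) ^+ 2) ut ut' tt').
  rewrite -(sum_extend (fun j => normc (c j) ^+ 2) us ut' st') !mulr_sumr -big_split/=.
  apply: ler_sum => j _; apply: le_trans (normc_sqrD _ _) _.
  by case: ifP => _; case: ifP => _; rewrite ?(normcR (0 : R)) ?normr0 ?expr0n.
rewrite [leRHS]mulrDl -[2 * C * _]mulrA -[2 / B * _]mulrA; apply: lerD.
  by rewrite ler_pM2l.
rewrite ler_pM2l// cE -exprVn expr2 -mulrA; apply: ler_wpM2l; first by rewrite invr_ge0 ltW.
apply: (@le_trans _ _ (nrm2 mu r)) => //.
by rewrite ler_pdivrMl.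
Qed.

Lemma greedy_approx (eps : R) : 0 < eps ->
  exists2 C, 0 <= C & forall h, sqintegrable mu h ->
  exists t b, [/\ uniq t,
    nrm2 mu (fun x => h x - lcomb t b x) <= eps * nrm2 mu h &
    csqr t b <= C * nrm2 mu h].
Proof.
move=> eps0.
have q1 : `|1 - A / B| < 1.
  rewrite ger0_norm ?subr_ge0 ?ler_pdivrMr ?mul1r//.
  by rewrite gtrBl divr_gt0.
have /cvgrPdist_lt/(_ eps eps0)[N _ /(_ N (leqnn N))] := cvg_expr q1.
rewrite /= sub0r normrN => /ltW hN; have [C C0 HC] := greedy N.
exists C => // h hi; have [t [b [ut h1 h2]]] := HC h hi.
exists t, b; split => //; apply: le_trans h1 _.
by apply: ler_wpM2r; [exact: nrm2_ge0|apply: le_trans hN; rewrite ler_norm].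
Qed.

End finite_systems.

(** * Cutting a combination of lattice vectors along a tiling *)

Section lattice_systems.
Context {R : realType} {d : nat}.
Local Notation Rd := 'cV[R]_d.
Local Notation R2d := 'cV[R]_(d + d).
Local Notation n := (d + d)%N.
Local Notation mu := (lebesgue_cV d : {measure set Rd -> \bar R}).
Implicit Types (L : 'M[R]_(d + d)) (s t : seq 'cV[int]_(d + d)).

(** The Gabor system of [f] along the lattice of [L]. *)
Definition gsys (f : Rd -> R[i]) L (k : 'cV[int]_(d + d)) : Rd -> R[i] :=
  tfshift (lattice_pt L k) f.

Variable f : Rd -> R[i].
Hypothesis fi : sqintegrable mu f.
Local Notation e := (gsys f).
Local Notation av := (amb f).

Lemma sqintegrable_gsys L k : sqintegrable mu (e L k).
Proof. exact: sqintegrable_tfshift. Qed.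
Let ei := sqintegrable_gsys.

Lemma sum_amb_le L B w s : lattice_summable L av B -> uniq s ->
  \sum_(k <- s) av (lattice_pt L k - w) <= B.
Proof.
move=> LB us; apply: le_trans (LB w s us); apply: ler_sum => k _.
by rewrite ler_peMl ?amb_ge0// weight_ge1.
Qed.

Lemma normc_inner_gsys L L' j k :
  normc (inner mu (e L j) (e L' k)) = av (lattice_pt L' k - lattice_pt L j).
Proof. exact: normc_inner_tfshift2. Qed.

Lemma gram_gsys_le L c j j' : `|gram mu (e L) c j j'| <=
  normc (c j) * normc (c j') * av (lattice_pt L j' - lattice_pt L j).
Proof. by have := gram_le mu (e L) c j j'; rewrite normc_inner_gsys. Qed.

(** Schur's test for the Gram matrix, whose entries are bounded by [amb]. *)
Lemma gsys_synth_le L B : lattice_summable L av B ->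
  forall t c, uniq t -> nrm2 mu (lcomb (e L) t c) <= B * csqr t c.
Proof.
move=> LB t c ut; rewrite (nrm2_lcomb (ei L)).
apply: (@le_trans _ _ (\sum_(j <- t) \sum_(j' <- t)
    normc (c j) * normc (c j') * av (lattice_pt L j' - lattice_pt L j))).
  apply: ler_sum => j _; apply: ler_sum => j' _.
  by apply: le_trans (ler_norm _) _; exact: gram_gsys_le.
apply: (@schur_square R _ t (fun j => normc (c j)) (fun j j' => av (lattice_pt L j' - lattice_pt L j))).
- by move=> i j; exact: amb_ge0.
- by move=> j; exact: sum_amb_le.
- move=> j'; rewrite (eq_bigr (fun j => av (lattice_pt L j - lattice_pt L j'))).
    exact: sum_amb_le.
  by move=> j _; rewrite -[LHS](ambN fi) opprB.
Qed.

Section two_lattices.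
Variables (L0 L : 'M[R]_(d + d)) (B : R).
Hypotheses (uL0 : L0 \in unitmx) (B0 : 0 <= B)
  (sL0 : lattice_summable L0 av B) (sL : lattice_summable L av B).

Lemma nrm1_lattice (k : 'cV[int]_(d + d)) :
  (inrm k)%:R <= 2 * mnorm (invmx L0) * nrm1 (lattice_pt L0 k) :> R.
Proof.
rewrite -(@nrm1_inrm R); apply: (nrm1_close _ uL0).
rewrite /close subrr /mnorm; under eq_bigr do under eq_bigr do rewrite mxE normr0.
by rewrite [\sum_(i < n) _]big1 ?mulr0 ?mul0r// => i _; rewrite big1.
Qed.

(** Only the absolute values of the coefficients and the decay of [amb] enter. *)
Lemma normc_inner_lcomb t b z : normc (inner mu (lcomb (e L0) t b) (tfshift z f)) <=
  \sum_(j <- t) normc (b j) * av (z - lattice_pt L0 j).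
Proof.
rewrite (inner_lcombl (ei L0)); last exact: sqintegrable_tfshift.
apply: le_trans (ler_normc_sum _ _ _) _; apply: ler_sum => j _.
rewrite -(normc_inner_tfshift2 fi) -/(e L0 j).
by move: (b j) (inner _ _ _) => x y; rewrite normcM.
Qed.

(** A bound for the mutual contribution of [j] and [j'] both to the squared norm of a
    combination of the system at [L0] and to its square sum against the system at [L]. *)
Definition interaction (s : seq 'cV[int]_(d + d)) (b : 'cV[int]_(d + d) -> R) j j' : R :=
  b j * b j' * av (lattice_pt L0 j' - lattice_pt L0 j) +
  \sum_(k <- s) (b j * av (lattice_pt L k - lattice_pt L0 j)) *
                (b j' * av (lattice_pt L k - lattice_pt L0 j')).

(** The distance of [j] and [j'] is at most a product of two weights, through the point
    of the second lattice in the second term. The weighted sums of [amb] absorb these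
    weights, and Schur's test applies. *)
Lemma interaction_le s t b : uniq s -> uniq t -> (forall j, 0 <= b j) ->
  \sum_(j <- t) \sum_(j' <- t) (inrm (j' - j))%:R * interaction s b j j' <=
  (2 * mnorm (invmx L0) * B * (1 + B)) * \sum_(j <- t) b j ^+ 2.
Proof.
move=> us ut b0; set M := 2 * mnorm (invmx L0).
have M0 : 0 <= M by rewrite mulr_ge0 ?mnorm_ge0.
pose W (z : R2d) := weight z * av z.
have W0 z : 0 <= W z by rewrite mulr_ge0 ?weight_ge0 ?amb_ge0.
have WN z : W (- z) = W z by rewrite /W weightN ambN.
have dist j j' : (inrm (j' - j))%:R <= M * weight (lattice_pt L0 j' - lattice_pt L0 j).
  apply: le_trans (nrm1_lattice _) _; rewrite lattice_ptB -/M.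
  by apply: ler_wpM2l => //; rewrite weightE lerDr.
rewrite (_ : M * B * (1 + B) * _ = M * (B * \sum_(j <- t) b j ^+ 2) +
    M * (B * B * \sum_(j <- t) b j ^+ 2)); last by ring.
apply: (@le_trans _ _ (M * (\sum_(j <- t) \sum_(j' <- t) b j * b j' * W (lattice_pt L0 j' - lattice_pt L0 j)) +
   M * \sum_(k <- s) (\sum_(j <- t) b j * W (lattice_pt L k - lattice_pt L0 j)) ^+ 2)); last first.
  apply: lerD; apply: ler_wpM2l => //.
    apply: (@schur_square R _ t b (fun j j' => W (lattice_pt L0 j' - lattice_pt L0 j))) => //.
    - by move=> j; exact: sL0.
    - by move=> j'; under eq_bigr do rewrite -WN opprB; exact: sL0.
  apply: (@schur_rect R _ _ s t b (fun k j => W (lattice_pt L k - lattice_pt L0 j))) => //.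
  - by move=> k; under eq_bigr do rewrite -WN opprB; exact: sL0.
  - by move=> j _; exact: sL.
rewrite -mulrDr.
have -> : \sum_(k <- s) (\sum_(j <- t) b j * W (lattice_pt L k - lattice_pt L0 j)) ^+ 2 =
    \sum_(j <- t) \sum_(j' <- t) \sum_(k <- s) (b j * W (lattice_pt L k - lattice_pt L0 j)) *
       (b j' * W (lattice_pt L k - lattice_pt L0 j')).
  under eq_bigr do rewrite expr2 mulr_suml; rewrite exchange_big/=; apply: eq_bigr => j _.
  under eq_bigr do rewrite mulr_sumr; exact: exchange_big.
rewrite -big_split mulr_sumr; apply: ler_sum => j _.
rewrite -big_split mulr_sumr; apply: ler_sum => j' _ /=.
rewrite /interaction mulrDr mulrDr; apply: lerD.
  rewrite /W mulrCA [leRHS]mulrCA; apply: ler_wpM2l; first exact: mulr_ge0.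
  by rewrite mulrA; apply: ler_wpM2r; [exact: amb_ge0|exact: dist].
rewrite !mulr_sumr; apply: ler_sum => k _.
set x := lattice_pt L k - lattice_pt L0 j; set y := lattice_pt L k - lattice_pt L0 j'.
have wxy : weight (lattice_pt L0 j' - lattice_pt L0 j) <= weight x * weight y.
  have -> : lattice_pt L0 j' - lattice_pt L0 j = x - y.
    by rewrite /x /y opprB [RHS]addrC addrA subrK.
  by apply: le_trans (weightM _ _) _; rewrite weightN.
apply: (@le_trans _ _ (M * (weight x * weight y) * (b j * av x * (b j' * av y)))).
  apply: ler_wpM2r; first by rewrite !mulr_ge0 ?amb_ge0.
  by apply: le_trans (dist j j') _; exact: ler_wpM2l.
rewrite /W; move: (weight x) (weight y) (av x) (av y) => p q p' q'.
by rewrite le_eqVlt; apply/orP; left; apply/eqP; ring.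
Qed.

Lemma sqr_normc_sum (J : Type) (r : seq J) (u : J -> R[i]) :
  normc (\sum_(j <- r) u j) ^+ 2 =
  \sum_(j <- r) \sum_(j' <- r) complex.Re (u j * (u j')^*%C).
Proof.
have -> : normc (\sum_(j <- r) u j) ^+ 2 =
    complex.Re ((\sum_(j <- r) u j) * (\sum_(j <- r) u j)^*%C) by rewrite mulcJ.
rewrite mulr_suml Re_sum; apply: eq_bigr => j _.
by rewrite rmorph_sum mulr_sumr Re_sum.
Qed.

Lemma sum_neq_key (Q : eqType) t (key : 'cV[int]_(d + d) -> Q)
    (m w : 'cV[int]_(d + d) -> 'cV[int]_(d + d) -> R) :
  (forall j j', `|m j j'| <= w j j') ->
  `|\sum_(j <- t) \sum_(j' <- t) m j j' -
    \sum_(j <- t) \sum_(j' <- t | key j' == key j) m j j'| <=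
  \sum_(j <- t) \sum_(j' <- t | key j' != key j) w j j'.
Proof.
move=> mw; rewrite -sumrB; apply: le_trans (ler_norm_sum _ _ _) _.
apply: ler_sum => j _; rewrite (bigID (fun j' => key j' == key j))/= addrAC subrr add0r.
by apply: le_trans (ler_norm_sum _ _ _) _; exact: ler_sum.
Qed.

(** Norm and square sum are quadratic in the coefficients; replacing the
    combination by its pieces on the boxes drops exactly the pairs that are separated by the
    tiling. For the tiling of [exists_tiling] they are worth at most [tau], which is of order
    [1 / T]. One tiling serves for both quantities. *)
Lemma tiling_estimate (T : nat) s t (b : 'cV[int]_(d + d) -> R[i]) :
  uniq s -> uniq t ->
  exists a : 'I_T.+1, let h q := lcomb (e L0) [seq j <- t | boxkey T a j == q] b in
    let Q := undup [seq boxkey T a j | j <- t] in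
    let tau := (2 * mnorm (invmx L0) * B * (1 + B)) / T.+1%:R * csqr t b in
    nrm2 mu (lcomb (e L0) t b) - tau <= \sum_(q <- Q) nrm2 mu (h q) /\
    \sum_(q <- Q) qsum mu (e L) s (h q) <= qsum mu (e L) s (lcomb (e L0) t b) + tau.
Proof.
move=> us ut; pose nb j := normc (b j).
have nb0 j : 0 <= nb j by exact: normc_ge0.
pose w := interaction s nb.
have p10 j j' : 0 <= nb j * nb j' * av (lattice_pt L0 j' - lattice_pt L0 j).
  by rewrite !mulr_ge0 ?amb_ge0.
have p20 j j' : 0 <= \sum_(k <- s) (nb j * av (lattice_pt L k - lattice_pt L0 j)) *
                (nb j' * av (lattice_pt L k - lattice_pt L0 j')).
  by apply: sumr_ge0 => k _; rewrite !mulr_ge0 ?amb_ge0.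
have w0 j j' : 0 <= w j j' by exact: addr_ge0.
have [a ha] := exists_tiling T t w0; exists a => h Q tau.
have {ha} ha : \sum_(j <- t) \sum_(j' <- t | boxkey T a j' != boxkey T a j) w j j' <= tau.
  rewrite /tau mulrAC ler_pdivlMr ?ltr0n// mulrC; apply: le_trans ha _.
  exact: (interaction_le us ut nb0).
pose key : 'cV[int]_n -> 'cV[int]_n := boxkey T a.
split.
  have -> : \sum_(q <- Q) nrm2 mu (h q) =
      \sum_(j <- t) \sum_(j' <- t | key j' == key j) gram mu (e L0) b j j'.
    rewrite -sum_by_key; apply: eq_bigr => q _; rewrite /h (nrm2_lcomb (ei L0)) big_filter.
    by apply: eq_bigr => j _; rewrite big_filter.
  rewrite (nrm2_lcomb (ei L0)).
  have := @sum_neq_key _ t key (gram mu (e L0) b) w; set X := `|_|.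
  move=> /(_ _)/wrap[|hX].
    move=> j j'; apply: le_trans (gram_gsys_le _ _ _ _) _.
    by rewrite /w /interaction lerDl.
  have := le_trans (le_trans (ler_norm _) hX) ha; lra.
pose u k j := b j * inner mu (e L0 j) (e L k).
have uE k j : normc (u k j) = nb j * av (lattice_pt L k - lattice_pt L0 j).
  by rewrite -normc_inner_gsys /u /nb; move: (b j) (inner _ _ _) => x y; rewrite normcM.
pose m j j' := \sum_(k <- s) complex.Re (u k j * (u k j')^*%C).
have qE r : qsum mu (e L) s (lcomb (e L0) r b) = \sum_(j <- r) \sum_(j' <- r) m j j'.
  rewrite /qsum (eq_bigr (fun k => \sum_(j <- r) \sum_(j' <- r) complex.Re (u k j * (u k j')^*%C))).
    by rewrite exchange_big/=; apply: eq_bigr => j _; rewrite exchange_big.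
  move=> k _; rewrite -sqr_normc_sum; congr (normc _ ^+ 2).
  by rewrite (inner_lcombl (ei L0)).
have -> : \sum_(q <- Q) qsum mu (e L) s (h q) =
    \sum_(j <- t) \sum_(j' <- t | key j' == key j) m j j'.
  rewrite -sum_by_key; apply: eq_bigr => q _; rewrite /h qE big_filter.
  by apply: eq_bigr => j _; rewrite big_filter.
rewrite qE.
have := @sum_neq_key _ t key m w; set X := `|_|.
move=> /(_ _)/wrap[|hX].
  move=> j j'; apply: le_trans (ler_norm_sum _ _ _) _.
  rewrite /w /interaction; apply: ler_wpDl => //; apply: ler_sum => k _.
  apply: le_trans (normr_Re_le _) _; have := uE k j; have := uE k j'.
  by move: (u k j) (u k j') => x y <- <-; rewrite normcM normc_conj.
have := le_trans (le_trans (ler_norm _) hX) ha.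
have : - (\sum_(j <- t) \sum_(j' <- t) m j j' -
    \sum_(j <- t) \sum_(j' <- t | key j' == key j) m j j') <= tau.
  by apply: le_trans ha; apply: le_trans hX; rewrite -[X]normrN ler_norm.
lra.
Qed.

End two_lattices.

End lattice_systems.

(** * Comparison of two lattices on a bounded region *)

Section local_estimate.
Context {R : realType} {d : nat}.
Local Notation Rd := 'cV[R]_d.
Local Notation R2d := 'cV[R]_(d + d).
Local Notation n := (d + d)%N.
Local Notation mu := (lebesgue_cV d : {measure set Rd -> \bar R}).
Local Notation mu2 := (lebesgue_cV (d + d) : {measure set R2d -> \bar R}).
Implicit Types (L : 'M[R]_(d + d)) (s t : seq 'cV[int]_(d + d)).

Variable f : Rd -> R[i].
Hypotheses (fi : sqintegrable mu f)
  (fnu : cintegrable mu2 (fun z => stft f z * (weight z)%:C%C)).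
Local Notation e := (gsys f).
Local Notation av := (amb f).

Variables (L0 : 'M[R]_(d + d)) (A B : R).
Hypotheses (uL0 : L0 \in unitmx) (A0 : 0 < A) (B0 : 0 < B).
Hypothesis sB : forall L, L \in unitmx -> close L0 L -> lattice_summable L av B.
Hypothesis fA : frame_low mu (e L0) A.

Let ei := sqintegrable_gsys fi.

Lemma close_refl : close L0 L0.
Proof.
rewrite /close subrr /mnorm; under eq_bigr do under eq_bigr do rewrite mxE normr0.
by rewrite [\sum_(i < n) _]big1 ?mulr0 ?mul0r// => i _; rewrite big1.
Qed.

Let sL0 : lattice_summable L0 av B. Proof. exact: sB uL0 close_refl. Qed.

(** Lattice points outside a large box are at distance at least [rho] from the
    region that carries the combination, so that the weight gains a factor [rho] in one of
    the two sums of Schur's test. *)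
Lemma tail_estimate (D eps : R) : 0 <= D -> 0 < eps -> exists N : nat,
  forall (q : R2d) s t b, uniq s -> uniq t ->
    (forall j, j \in t -> nrm1 (q - lattice_pt L0 j) <= D) ->
    \sum_(k <- [seq k <- s | k \notin ibox N])
      normc (inner mu (lcomb (e L0) t b) (tfshift (lattice_pt L0 k + q) f)) ^+ 2 <=
    eps * csqr t b.
Proof.
move=> D0 eps0; pose M := 2 * mnorm (invmx L0).
have M0 : 0 <= M by rewrite mulr_ge0 ?mnorm_ge0.
pose rho := B ^+ 2 / eps + 1.
have rho0 : 0 < rho by rewrite ltr_wpDl// divr_ge0 ?sqr_ge0// ltW.
have x0 : 0 <= (M + 1) * (rho + D) by exact: mulr_ge0 (addr_ge0 M0 ler01) (addr_ge0 (ltW rho0) D0).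
exists (Num.bound ((M + 1) * (rho + D))).
set N := Num.bound _ => q s t b us ut tD.
have hN : (M + 1) * (rho + D) <= N%:R by apply: ltW; exact: archi_boundP.
pose x k j := if (k \in ibox N) then 0 else av (lattice_pt L0 k + q - lattice_pt L0 j).
have x00 k j : 0 <= x k j by rewrite /x; case: ifP => // _; exact: amb_ge0.
apply: (@le_trans _ _ (\sum_(k <- [seq k <- s | k \notin ibox N])
   (\sum_(j <- t) normc (b j) * x k j) ^+ 2)).
  rewrite !big_filter; apply: ler_sum => k kN.
  rewrite ler_sqr ?nnegrE ?normc_ge0//; last first.
    by apply: sumr_ge0 => j _; rewrite mulr_ge0 ?normc_ge0.
  apply: le_trans (normc_inner_lcomb fi _ _ _ _) _.
  by rewrite /x (negbTE kN).
have := @schur_rect R _ _ [seq k <- s | k \notin ibox N] t (fun j => normc (b j)) x B (B / rho) x00 (ltW B0).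
move=> h; apply: le_trans (h _ _) _.
- move=> k; have [kN|kN] := boolP (k \in ibox N).
    by rewrite big1 ?ltW// => j _; rewrite /x kN.
  rewrite (eq_bigr (fun j => av (lattice_pt L0 j - (lattice_pt L0 k + q)))).
    exact: (sum_amb_le _ sL0 ut).
  by move=> j _; rewrite /x (negbTE kN) -[LHS](ambN fi) opprB.
- move=> j jt; rewrite ler_pdivlMr//.
  apply: le_trans (sL0 (lattice_pt L0 j - q) (filter_uniq (fun k => k \notin ibox N) us)).
  rewrite mulr_suml !big_filter; apply: ler_sum => k kN.
  rewrite /x (negbTE kN) mulrC opprB addrA; apply: ler_wpM2r; first exact: amb_ge0.
  set z := lattice_pt L0 k; set y := q - lattice_pt L0 j.
  have -> : z + q - lattice_pt L0 j = z + y by rewrite /y addrA.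
  have yD : nrm1 y <= D by exact: tD.
  have kn : (N <= inrm k)%N.
    by rewrite leqNgt; apply: contra kN => /ltnW; exact: mem_ibox.
  have h1 := nrm1_lattice uL0 k; rewrite -/M -/z in h1.
  have h2 : N%:R <= (inrm k)%:R :> R by rewrite ler_nat.
  have zn := nrm1_ge0 z.
  have h3 : rho + D <= nrm1 z.
    have M1 : 0 < M + 1 by rewrite ltr_wpDl.
    rewrite -(ler_pM2l M1); lra.
  have h4 : nrm1 z <= nrm1 (z + y) + nrm1 y by rewrite -{1}(addrK y z) nrm1B.
  by rewrite weightE; lra.
- rewrite -[\sum_(j <- t) _]/(csqr t b); apply: ler_wpM2r; first exact: csqr_ge0.
  rewrite mulrA -expr2 ler_pdivrMr// /rho mulrDr mulrCA divff ?mulr1 ?gt_eqF//.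
  by rewrite lerDl ltW.
Qed.

(** A combination carried by a region near the point [p] of the lattice of [L] is
    moved by [- L p] to a neighbourhood of the origin, where the frame inequality at [L0]
    applies. Its terms far from the origin are small by [tail_estimate]. For the finitely many
    others the shifts by [L k] and [L0 k] are close when [L] is close to [L0]. Moving back
    turns the index [k] into [k + p]. *)
Lemma local_estimate (D eps : R) : 0 <= D -> 0 < eps ->
  exists N : nat, exists2 eta : R, 0 < eta & forall L p t b,
    mnorm (L - L0) <= eta -> uniq t ->
    (forall j, j \in t -> nrm1 (lattice_pt L p - lattice_pt L0 j) <= D) ->
    A * nrm2 mu (lcomb (e L0) t b) - eps * csqr t b - eps * nrm2 mu (lcomb (e L0) t b) <=
    \sum_(k <- ibox N) normc (inner mu (lcomb (e L0) t b) (e L (k + p))) ^+ 2.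
Proof.
move=> D0 eps0; have [N hN] := tail_estimate D0 eps0; exists N.
have [C C0 hC] := nrm2_shift_small fi fnu.
pose F := Num.sqrt (nrm2 mu f); have F0 : 0 <= F by exact: sqrtr_ge0.
pose m : R := (size (@ibox n N))%:R.
have m0 : 0 <= m by exact: ler0n.
pose sg := Num.min 1 (eps / (m * (2 * F + 1) + 1)).
have dn0 : 0 < m * (2 * F + 1) + 1 by rewrite ltr_wpDl// mulr_ge0// addr_ge0// mulr_ge0.
have sg0 : 0 < sg by rewrite lt_min ltr01 divr_gt0.
have sg1 : sg <= 1 by rewrite ge_min lexx.
have sge : m * (2 * F * sg + sg ^+ 2) <= eps.
  have h : sg * (m * (2 * F + 1) + 1) <= eps by rewrite -ler_pdivlMr// ge_min lexx orbT.
  apply: le_trans h; rewrite -subr_ge0.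
  rewrite (_ : _ - _ = m * (sg * (1 - sg)) + sg); last by ring.
  by rewrite addr_ge0 ?mulr_ge0 ?subr_ge0// ltW.
pose r := Num.min 1 (sg ^+ 2 / (C + 1)).
have C1 : 0 < C + 1 by rewrite ltr_wpDl.
have r0 : 0 < r by rewrite lt_min ltr01 divr_gt0// exprn_gt0.
have r1 : r <= 1 by rewrite ge_min lexx.
have Cr : C * r <= sg ^+ 2.
  have h : r * (C + 1) <= sg ^+ 2 by rewrite -ler_pdivlMr// ge_min lexx orbT.
  by apply: le_trans h; rewrite mulrC mulrDr lerDl mulr1 ltW.
pose nN : R := (n * N)%:R.
have nN0 : 0 <= nN by exact: ler0n.
have nN1 : 0 < nN + 1 by rewrite ltr_wpDl.
exists (r ^+ 2 / (nN + 1)); first by rewrite divr_gt0// exprn_gt0.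
move=> L p t b LL ut tD; set h := lcomb (e L0) t b.
have hi : sqintegrable mu h by exact: sqintegrable_lcomb.
have [mh _] := hi.
pose q := lattice_pt L p; pose h' := tfshift (- q) h.
have hi' : sqintegrable mu h' by exact: sqintegrable_tfshift.
have nh' : nrm2 mu h' = nrm2 mu h by exact: nrm2_tfshift.
have shift z : normc (inner mu h' (tfshift z f)) = normc (inner mu h (tfshift (z + q) f)).
  by have := normc_inner_tfshift (- q) z hi fi; rewrite opprK.
have [s us As] := fA hi'.
pose S := nrm2 mu h; have S0 : 0 <= S by exact: nrm2_ge0.
rewrite nh' -/S in As.
have tail := hN q s t b us ut tD.
pose X k := normc (inner mu h' (e L0 k)).
pose Y k := normc (inner mu h (e L (k + p))).
(* [X] at [L0] and [Y] at [L] differ by the modulus of continuity [rk] *)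
pose rk k := Num.sqrt (nrm2 mu (fun u => tfshift (lattice_pt L k - lattice_pt L0 k) f u - f u)).
have X0 k : 0 <= X k by exact: normc_ge0.
have Y0 k : 0 <= Y k by exact: normc_ge0.
have YE k : Y k = normc (inner mu h' (e L k)).
  by rewrite (shift (lattice_pt L k)) /q -lattice_ptD.
have YF k : Y k <= Num.sqrt S * F.
  rewrite YE; have := CauchySchwarz hi' (ei L k); rewrite nh' -/S nrm2_tfshift//.
  by case: fi.
have XY k : X k <= Y k + Num.sqrt S * rk k.
  have := normc_inner_shift_le fi (lattice_pt L k) (lattice_pt L0 k) hi'.
  by rewrite nh' YE.
have tailE : \sum_(k <- [seq k <- s | k \notin ibox N]) X k ^+ 2 <= eps * csqr t b.
  apply: le_trans tail; rewrite le_eqVlt; apply/orP; left; apply/eqP.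
  by apply: eq_bigr => k _; exact: (congr1 (fun x : R => x ^+ 2) (shift (lattice_pt L0 k))).
have rks k : k \in ibox N -> rk k <= sg.
  move=> kN; rewrite -[leRHS](ger0_norm (ltW sg0)) -sqrtr_sqr ler_wsqrtr//.
  apply: le_trans Cr; apply: hC; first by rewrite (ltW r0).
  rewrite /lattice_pt -mulmxBl; apply: le_trans (nrm1_mulmx _ _) _.
  rewrite nrm1_inrm; have kn : (inrm k)%:R <= nN by rewrite ler_nat ibox_inrm.
  apply: (@le_trans _ _ (r ^+ 2 / (nN + 1) * nN)).
    by apply: ler_pM; rewrite ?mnorm_ge0 ?ler0n.
  by rewrite mulrAC ler_pdivrMr// ler_wpM2l ?sqr_ge0// lerDl.
rewrite -[leRHS]/(\sum_(k <- ibox N) Y k ^+ 2).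
rewrite -[qsum _ _ _ _]/(\sum_(k <- s) X k ^+ 2) in As; rewrite -/S.
clearbody X Y rk; move: (csqr t b) As tailE => c As tailE.
have Ss := sqr_sqrtr S0; have Sq0 := sqrtr_ge0 S.
move: (Num.sqrt S) Ss Sq0 YF XY => Q Ss Q0 YF XY.
have head : \sum_(k <- s | k \in ibox N) X k ^+ 2 <=
    \sum_(k <- ibox N) (Y k ^+ 2 + S * (2 * F * sg + sg ^+ 2)).
  apply: (@le_trans _ _ (\sum_(k <- ibox N) X k ^+ 2)).
    rewrite -big_filter; apply: ler_sum_uniq; first exact: filter_uniq.
      by move=> k; rewrite mem_filter => /andP[].
    by move=> k; exact: sqr_ge0.
  rewrite big_seq [leRHS]big_seq; apply: ler_sum => k kN.
  have {XY} xy : X k <= Y k + Q * sg.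
    by apply: le_trans (XY k) _; rewrite lerD2l ler_wpM2l// rks.
  have y0 := Y0 k; have yF := YF k; have x0 := X0 k.
  move: (X k) (Y k) xy y0 yF x0 => x y xy y0 yF x0.
  have xy2 : x ^+ 2 <= (y + Q * sg) ^+ 2.
    by have h1 := le_trans x0 xy; rewrite ler_sqr ?nnegrE.
  apply: le_trans xy2 _; rewrite -Ss.
  have Qs : 0 <= Q * sg := mulr_ge0 Q0 (ltW sg0).
  have : y * (Q * sg) <= Q * F * (Q * sg) by rewrite ler_wpM2r.
  move=> h1; rewrite -subr_ge0.
  rewrite (_ : _ - _ = 2 * (Q * F * (Q * sg) - y * (Q * sg))); last by ring.
  by rewrite mulr_ge0 ?subr_ge0.
rewrite big_split/= in head.
have E : \sum_(k <- @ibox n N) S * (2 * F * sg + sg ^+ 2) <= eps * S.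
  rewrite big_const_seq count_predT iter_addr_0 -mulrnAr mulrC.
  by apply: ler_wpM2r => //; rewrite -mulr_natl.
rewrite (bigID (fun k => k \in ibox N))/= -[X in _ <= _ + X]big_filter in As.
lra.
Qed.

(** Coordinatewise integer part in the basis of the lattice, so that the
    lattice of [L] is within bounded distance of every point. *)
Definition ifloor L (z : R2d) : 'cV[int]_(d + d) := \col_i Num.floor ((invmx L *m z) i ord0).

Lemma ifloorP L z : L \in unitmx -> nrm1 (lattice_pt L (ifloor L z) - z) <= mnorm L * n%:R.
Proof.
move=> uL; have {2}-> : z = L *m (invmx L *m z) by rewrite mulKVmx.
rewrite /lattice_pt -mulmxBr; apply: le_trans (nrm1_mulmx _ _) _.
apply: ler_wpM2l; first exact: mnorm_ge0.
apply: (@le_trans _ _ (\sum_(i < n) 1)); last by rewrite sumr_const card_ord.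
apply: ler_sum => i _; set x := (invmx L *m z) i ord0.
have -> : (map_mx intr (ifloor L z) - invmx L *m z) i ord0 = (Num.floor x)%:~R - x.
  by rewrite /x !mxE.
have := floor_le x; have := floorD1_gt x; rewrite intrD distrC => h1 h2.
by rewrite ger0_norm ?subr_ge0// lerBlDl ltW.
Qed.

End local_estimate.

(** * Deformation of the lattice for a fixed window *)

Section deformation.
Context {R : realType} {d : nat}.
Local Notation Rd := 'cV[R]_d.
Local Notation R2d := 'cV[R]_(d + d).
Local Notation n := (d + d)%N.
Local Notation mu := (lebesgue_cV d : {measure set Rd -> \bar R}).
Local Notation mu2 := (lebesgue_cV (d + d) : {measure set R2d -> \bar R}).
Implicit Types (L : 'M[R]_(d + d)) (s t : seq 'cV[int]_(d + d)).

Variable f : Rd -> R[i].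
Hypotheses (fi : sqintegrable mu f)
  (fnu : cintegrable mu2 (fun z => stft f z * (weight z)%:C%C)).
Local Notation e := (gsys f).
Local Notation av := (amb f).
Let ei := sqintegrable_gsys fi.

Section combinations.
Variables (L0 : 'M[R]_(d + d)) (A B : R).
Hypotheses (uL0 : L0 \in unitmx) (A0 : 0 < A) (B0 : 0 < B).
Hypothesis sB : forall L, L \in unitmx -> close L0 L -> lattice_summable L av B.
Hypothesis fA : frame_low mu (e L0) A.

(** Cut the combination along a tiling of side [T.+1]; each piece is carried by a
    region of bounded size, to which [local_estimate] applies with a neighbourhood of [L0]
    that depends on [T] only. Adding up the pieces loses [tau]. *)
Lemma frame_low_lcomb (eps : R) : 0 < eps -> eps <= A ->
  exists2 eta : R, 0 < eta & forall L, L \in unitmx -> close L0 L ->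
    mnorm (L - L0) <= eta -> forall t b, uniq t ->
    exists2 s, uniq s &
      (A - eps) * nrm2 mu (lcomb (e L0) t b) - eps * csqr t b <=
      qsum mu (e L) s (lcomb (e L0) t b).
Proof.
move=> eps0 epsA.
pose C2 := 2 * mnorm (invmx L0) * B * (1 + B).
have C20 : 0 <= C2 by rewrite /C2 !mulr_ge0 ?mnorm_ge0 ?addr_ge0// ltW.
have e2 : 0 < eps / 2 by rewrite divr_gt0.
pose T := Num.bound ((eps / 2)^-1 * ((A + 1) * C2)).
have TE : (A + 1) * (C2 / T.+1%:R) <= eps / 2.
  rewrite mulrA ler_pdivrMr ?ltr0n// -ler_pdivrMl//.
  have x0 : 0 <= (eps / 2)^-1 * ((A + 1) * C2).
    apply: mulr_ge0; first by rewrite invr_ge0 ltW.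
    exact: mulr_ge0 (addr_ge0 (ltW A0) ler01) C20.
  by apply: le_trans (ltW (archi_boundP x0)) _; rewrite ler_nat -/T leqnSn.
pose D : R := (mnorm L0 + 1) * n%:R + mnorm L0 * (n * T.+1)%:R.
have D0 : 0 <= D by rewrite /D addr_ge0 ?mulr_ge0 ?addr_ge0 ?mnorm_ge0 ?ler0n.
have [N [eta eta0 hloc]] := local_estimate fi fnu uL0 B0 sB fA D0 e2.
exists (Num.min 1 eta); first by rewrite lt_min ltr01.
move=> L uL cL; rewrite le_min => /andP[L1 Leta] t b ut.
have sL0 : lattice_summable L0 av B by apply: sB => //; exact: close_refl.
have sL := sB uL cL.
pose ref (q : 'cV[int]_(d + d)) := lattice_pt L0 (T.+1%:Z *: q).
pose p q := ifloor L (ref q).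
(* The set [s] must be chosen before the tiling: the shift [a] is found for a given
   [s]. It therefore collects the points attached to the boxes of all shifted tilings. *)
pose qs := [seq boxkey T a j | a <- iota 0 T.+1, j <- t].
pose s := undup [seq k + p q | q <- qs, k <- @ibox n N].
have us : uniq s by exact: undup_uniq.
exists s => //.
have [a [h1 h2]] := tiling_estimate fi uL0 (ltW B0) sL0 sL T b us ut.
set Q := undup _ in h1 h2; set tau := _ * csqr t b in h1 h2.
pose tq q := [seq j <- t | boxkey T a j == q].
pose h q := lcomb (e L0) (tq q) b.
have loc q : q \in Q -> A * nrm2 mu (h q) - eps / 2 * csqr (tq q) b - eps / 2 * nrm2 mu (h q) <=
    qsum mu (e L) s (h q).
  rewrite mem_undup => /mapP[j0 j0t qE].
  have utq : uniq (tq q) by exact: filter_uniq.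
  apply: le_trans (hloc L (p q) (tq q) b Leta utq _) _.
    move=> j; rewrite mem_filter => /andP[/eqP jq jt].
    have -> : lattice_pt L (p q) - lattice_pt L0 j =
        (lattice_pt L (p q) - ref q) - lattice_pt L0 (j - T.+1%:Z *: q).
      by rewrite lattice_ptB opprB /ref addrA subrK.
    apply: le_trans (nrm1B _ _) _; apply: lerD.
      apply: le_trans (ifloorP _ uL) _; apply: ler_wpM2r; first exact: ler0n.
      have : mnorm L <= mnorm L0 + mnorm (L - L0).
        rewrite -big_split/=; apply: ler_sum => i _; rewrite -big_split/=; apply: ler_sum => i' _.
        have -> : L i i' = L0 i i' + (L - L0) i i' by rewrite !mxE [RHS]addrC subrK.
        exact: ler_normD.
      by move=> hL; apply: le_trans hL _; rewrite lerD2l.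
    apply: le_trans (nrm1_mulmx _ _) _; apply: ler_wpM2l; first exact: mnorm_ge0.
    by rewrite nrm1_inrm ler_nat -jq; exact: boxkey_dist.
  rewrite -(big_map (fun k => k + p q) xpredT (fun k => normc (inner mu (h q) (e L k)) ^+ 2)).
  apply: ler_sum_uniq.
  - by rewrite map_inj_uniq ?ibox_uniq//; exact: addIr.
  - move=> k' /mapP[k kN ->]; rewrite mem_undup; apply/allpairsP; exists (q, k); split => //=.
    by apply/allpairsP; exists (nat_of_ord a, j0); split; [rewrite mem_iota/= add0n|exact: j0t|].
  - by move=> k; exact: sqr_ge0.
have sum1 : A * \sum_(q <- Q) nrm2 mu (h q) - eps / 2 * csqr t b -
    eps / 2 * \sum_(q <- Q) nrm2 mu (h q) <= \sum_(q <- Q) qsum mu (e L) s (h q).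
  have -> : csqr t b = \sum_(q <- Q) csqr (tq q) b.
    rewrite /csqr -(sum_by_key1 t (boxkey T a)); apply: eq_bigr => q _.
    by rewrite big_filter.
  rewrite !mulr_sumr -!sumrB big_seq [leRHS]big_seq; apply: ler_sum => q qQ.
  exact: loc.
have cs0 := csqr_ge0 t b.
have tauE : (A + 1) * tau <= eps / 2 * csqr t b.
  by rewrite /tau mulrA; apply: ler_wpM2r.
have tau0 : 0 <= tau by rewrite mulr_ge0// divr_ge0.
move: h1 h2 sum1; rewrite -/(h _).
move: (\sum_(q <- Q) nrm2 mu (h q)) (\sum_(q <- Q) qsum mu (e L) s (h q)) => H G.
have := nrm2_ge0 mu (lcomb (e L0) t b).
move: (nrm2 mu (lcomb (e L0) t b)) (qsum mu (e L) s (lcomb (e L0) t b)) => H0 G0.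
move: (csqr t b) cs0 tauE tau0 => c cs0; move: tau => u tauE tau0 H00 h1 h2 h3.
have h4 : (A - eps / 2) * (H0 - u) <= (A - eps / 2) * H.
  by apply: ler_wpM2l => //; rewrite subr_ge0; lra.
have h5 : 0 <= eps / 2 * H0 := mulr_ge0 (ltW e2) H00.
have h6 : 0 <= eps / 2 * u := mulr_ge0 (ltW e2) tau0.
lra.
Qed.

End combinations.

(** By [greedy_approx] at [L0] every [h] is close to a combination [h0] with controlled
    coefficients, which satisfies the lower inequality at [L] by [frame_low_lcomb]. The
    remainder is controlled by the Bessel bound at [L]. The factor [16] absorbs the error terms and
    two uses of [|x + y|^2 <= 2 |x|^2 + 2 |y|^2]. *)
Theorem frame_deformation (L0 : 'M[R]_(d + d)) (A : R) : L0 \in unitmx -> 0 < A ->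
  frame_low mu (e L0) A ->
  exists eta B : R, [/\ 0 < eta, 0 < B & forall L, L \in unitmx ->
    mnorm (L - L0) <= eta ->
    frame_low mu (e L) (A / 16) /\
    forall s h, uniq s -> sqintegrable mu h -> qsum mu (e L) s h <= B * nrm2 mu h].
Proof.
move=> uL0 A0 fA; have [C hC] := lattice_summable_amb fi fnu uL0.
pose B := Num.max A C.
have AB : A <= B by rewrite le_max lexx.
have B0 : 0 < B := lt_le_trans A0 AB.
have sB L : L \in unitmx -> close L0 L -> lattice_summable L av B.
  move=> uL cL w s us; apply: le_trans (hC L uL cL w s us) _.
  by rewrite le_max lexx orbT.
have syn L : L \in unitmx -> close L0 L ->
    forall t c, uniq t -> nrm2 mu (lcomb (e L) t c) <= B * csqr t c.
  by move=> uL cL; apply: gsys_synth_le => //; exact: sB.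
(* [dl] bounds the relative error of the combination; with [B * dl <= A / 32] the
   square sum of the remainder is at most [A / 32] times the squared norm of [h] *)
pose dl := Num.min (1 / 8) (A / (32 * B)).
have dl0 : 0 < dl by rewrite lt_min !divr_gt0// mulr_gt0.
have dl8 : dl <= 1 / 8 by rewrite ge_min lexx.
have dlB : B * dl <= A / 32.
  apply: (@le_trans _ _ (B * (A / (32 * B)))).
    by apply: ler_wpM2l; [exact: ltW|rewrite ge_min lexx orbT].
  by rewrite le_eqVlt; apply/orP; left; apply/eqP; field; rewrite gt_eqF.
have [Cb Cb0 grd] := greedy_approx (ei L0) B0 (syn L0 uL0 (close_refl L0)) A0 AB fA dl0.
pose eps := Num.min (A / 4) (A / (32 * (Cb + 1))).
have Cb1 : 0 < Cb + 1 by rewrite ltr_wpDl.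
have eps0 : 0 < eps by rewrite lt_min !divr_gt0// mulr_gt0.
have eps4 : eps <= A / 4 by rewrite ge_min lexx.
have epsA : eps <= A by lra.
have epsC : eps * Cb <= A / 32.
  apply: (@le_trans _ _ (A / (32 * (Cb + 1)) * (Cb + 1))).
    apply: ler_pM; [exact: ltW|by []|by rewrite ge_min lexx orbT|by rewrite lerDl].
  by rewrite le_eqVlt; apply/orP; left; apply/eqP; field; rewrite gt_eqF.
have [eta eta0 heta] := frame_low_lcomb uL0 A0 B0 sB fA eps0 epsA.
pose mm := 2 * mnorm (invmx L0) + 1.
have mm0 : 0 < mm by rewrite ltr_wpDl// mulr_ge0 ?mnorm_ge0.
exists (Num.min eta mm^-1), B; split; [by rewrite lt_min eta0 invr_gt0|exact: B0|].
move=> L uL; rewrite le_min => /andP[L1 L2].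
have cL : close L0 L.
  rewrite /close mulrAC; have := mnorm_ge0 (invmx L0) => h0.
  have h1 : mm * mnorm (L - L0) <= 1 by rewrite mulrC -ler_pdivlMr// div1r.
  have := mnorm_ge0 (L - L0); rewrite /mm in h1; lra.
have bes s h : uniq s -> sqintegrable mu h -> qsum mu (e L) s h <= B * nrm2 mu h.
  by move=> us hi; exact: (qsum_le (ei L) B0 (syn L uL cL)).
split; last exact: bes.
move=> h hi.
have [t [b [ut hr hb]]] := grd h hi.
have [s us hs] := heta L uL cL L1 t b ut; exists s => //.
pose h0 := lcomb (e L0) t b; pose r x := h x - h0 x.
have h0i : sqintegrable mu h0 by exact: (sqintegrable_lcomb (ei L0)).
have ri : sqintegrable mu r by exact: sqintegrableB.
have Nh : nrm2 mu h <= 2 * nrm2 mu h0 + 2 * nrm2 mu r.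
  have -> : h = (fun x => h0 x + r x) by apply/funext => x; rewrite /r addrC subrK.
  exact: nrm2D_le.
pose r' x := (-1) * r x.
have ri' : sqintegrable mu r' by exact: sqintegrableZ.
have nr' : nrm2 mu r' = nrm2 mu r.
  have n1 : normc (-1 : R[i]) = 1 by rewrite normcN; exact: etrans (normcR 1) (normr1 R).
  by rewrite (nrm2Z (-1) ri) n1 expr1n mul1r.
have Qh : qsum mu (e L) s h0 <= 2 * qsum mu (e L) s h + 2 * qsum mu (e L) s r'.
  have {1}-> : h0 = (fun x => h x + r' x).
    by apply/funext => x; rewrite /r' /r mulN1r opprB addrC subrK.
  exact: (qsumD (ei L)).
have Qr := bes s r' us ri'; rewrite nr' in Qr.
have Nr : nrm2 mu r <= dl * nrm2 mu h by [].
have n0 := nrm2_ge0 mu h.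
move: hs Qh Nh Qr Nr hb n0; rewrite -/h0.
move: (qsum _ _ _ h0) (qsum _ _ _ h) (qsum _ _ _ r') (nrm2 mu h0) (nrm2 mu h) (nrm2 mu r) (csqr t b).
move=> Q0 Q Qr N0 N Nr c hs Qh Nh hQr hNr hb n0.
have k1 : Nr <= N / 8.
  by apply: le_trans hNr _; rewrite mulrC; apply: ler_wpM2l => //; rewrite -div1r.
have k2 : Qr <= A / 32 * N.
  apply: le_trans hQr _; apply: (@le_trans _ _ (B * (dl * N))).
    by apply: ler_wpM2l => //; exact: ltW.
  by rewrite mulrA; apply: ler_wpM2r.
have k3 : eps * c <= A / 32 * N.
  apply: (@le_trans _ _ (eps * (Cb * N))); first by apply: ler_wpM2l => //; exact: ltW.
  by rewrite mulrA; apply: ler_wpM2r.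
have k4 : 3 / 8 * N <= N0 by lra.
have k5 : (3 / 4 * A) * (3 / 8 * N) <= (A - eps) * N0.
  apply: ler_pM => //; [by rewrite mulr_ge0// ltW|by rewrite mulr_ge0|].
  by lra.
have AN : 0 <= A * N by rewrite mulr_ge0// ltW.
move: (A * N) AN (eps * c) ((A - eps) * N0) k2 k3 k5 hs => *.
nra.
Qed.

End deformation.

(** * Gabor frames, Heisenberg norms and the bundle topology *)

Section gabor_sums.
Context {R : realType} {d : nat}.
Local Notation Rd := 'cV[R]_d.
Local Notation mu := (lebesgue_cV d : {measure set Rd -> \bar R}).
Implicit Types (L : 'M[R]_(d + d)) (s t : seq 'cV[int]_(d + d)) (g h : Rd -> R[i]).

Lemma gabor_sum_ge g L h s : uniq s ->
  ((qsum mu (gsys g L) s h)%:E <= gabor_sum g L h)%E.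
Proof.
move=> us; apply: esum_ge; exists [set` s]; first by split => //; exact: finite_seq.
by rewrite -fsbig_seq// sumEFin.
Qed.

Lemma gabor_sum_le g L h (x : R) :
  (forall s, uniq s -> qsum mu (gsys g L) s h <= x) ->
  (gabor_sum g L h <= x%:E)%E.
Proof.
move=> hx; apply: ge_ereal_sup => _ [X [finX _] <-].
rewrite fsbig_finite// sumEFin lee_fin.
exact: (hx _ (finmap.fset_uniq _)).
Qed.

Lemma gabor_sum_gt g L h (y : R) : (y%:E < gabor_sum g L h)%E ->
  exists2 s, uniq s & y <= qsum mu (gsys g L) s h.
Proof.
move=> hy; apply: contrapT => hn; move: hy; rewrite ltNge => /negP; apply.
apply: gabor_sum_le => s us; rewrite leNgt; apply/negP => /ltW h1.
by apply: hn; exists s.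
Qed.

Lemma sqintegrable_L2 (u : L2 R d) : sqintegrable mu u.
Proof. exact: L2funP. Qed.

(** Frame inequalities quantify over classes, the estimates on finite systems over
    functions; this is the passage between the two. *)
Lemma L2_class h : sqintegrable mu h -> exists u : L2 R d,
  (u : Rd -> R[i]) = h %[ae mu].
Proof.
move=> hi; pose u : L2 R d := (\pi_(L2 R d) (L2Fun hi))%qT; exists u.
by have /eqmodP/asboolP := reprK u.
Qed.

Lemma qsum_ae g L s h h' : sqintegrable mu g -> sqintegrable mu h ->
  sqintegrable mu h' -> h = h' %[ae mu] ->
  qsum mu (gsys g L) s h = qsum mu (gsys g L) s h'.
Proof.
move=> gi [mh _] [mh' _] hh; apply: eq_bigr => k _.
have [mg _] := sqintegrable_gsys gi L k.
by rewrite (inner_ae mh mh' mg hh).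
Qed.

(** The Bessel inequality tested on finite sets of indices and on functions
    instead of classes. *)
Definition bessel_le g L (C : R) := forall s h, uniq s -> sqintegrable mu h ->
  qsum mu (gsys g L) s h <= C * nrm2 mu h.

Lemma bessel_bound_le g L C : sqintegrable mu g -> bessel_bound g L C -> bessel_le g L C.
Proof.
move=> gi [C0 hC] s h us hi; have [u uh] := L2_class hi.
have ui := sqintegrable_L2 u.
have [mu_ _] := ui; have [mh _] := hi.
rewrite -(qsum_ae L s gi ui hi uh) -(nrm2_ae mu_ mh uh) -lee_fin EFinM nrm2E//.
exact: le_trans (gabor_sum_ge g L u us) (hC u).
Qed.

Lemma bessel_le_bound g L C : 0 < C -> bessel_le g L C -> bessel_bound g L C.
Proof.
move=> C0 hC; split => // u; have ui := sqintegrable_L2 u.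
rewrite -nrm2E// -EFinM; apply: gabor_sum_le => s us; exact: hC.
Qed.

(** A series of nonnegative terms is the supremum of its finite sums; when [h] is not
    null, passing from [A] to the smaller [A'] leaves room for a finite sum. *)
Lemma frame_lowP g L (A A' : R) : sqintegrable mu g -> 0 < A' -> A' < A ->
  (forall f : L2 R d, (A%:E * sqnorm mu f <= gabor_sum g L f)%E) ->
  frame_low mu (gsys g L) A'.
Proof.
move=> gi A'0 AA hA h hi; have [u uh] := L2_class hi.
have ui := sqintegrable_L2 u.
have [mu_ _] := ui; have [mh _] := hi.
have [h0|h0] := eqVneq (nrm2 mu h) 0.
  by exists [::] => //; rewrite h0 mulr0 /qsum big_nil.
have hp : 0 < nrm2 mu h by rewrite lt_neqAle eq_sym h0 nrm2_ge0.
have [|s us hs] := @gabor_sum_gt g L u (A' * nrm2 mu h).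
  apply: lt_le_trans (hA u); rewrite -nrm2E// -EFinM lte_fin.
  by rewrite (nrm2_ae mu_ mh uh) ltr_pM2r.
by exists s => //; rewrite -(qsum_ae L s gi ui hi uh).
Qed.

Lemma gabor_frameP g L (A B : R) : 0 < A -> 0 < B ->
  frame_low mu (gsys g L) A -> bessel_le g L B -> gabor_frame g L.
Proof.
move=> A0 B0 fA hB; exists A, B; split => // u; have ui := sqintegrable_L2 u.
rewrite -nrm2E// -!EFinM; split.
  have [s us hs] := fA u ui; apply: le_trans (gabor_sum_ge g L u us).
  by rewrite lee_fin.
by apply: gabor_sum_le => s us; exact: hB.
Qed.

(** The system is additive in its window. *)
Lemma qsum_window g g' L s h : sqintegrable mu g -> sqintegrable mu g' ->
  sqintegrable mu h -> qsum mu (gsys g L) s h <=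
  2 * qsum mu (gsys g' L) s h + 2 * qsum mu (gsys (fun x => g x - g' x) L) s h.
Proof.
move=> gi gi' hi; rewrite !mulr_sumr -big_split/=; apply: ler_sum => k _.
have di : sqintegrable mu (fun x => g x - g' x) by exact: sqintegrableB.
have -> : inner mu h (gsys g L k) = inner mu h (gsys g' L k) +
    inner mu h (gsys (fun x => g x - g' x) L k).
  rewrite -innerDr//; [|exact: sqintegrable_gsys|exact: sqintegrable_gsys].
  congr (inner mu h _); apply/funext => x; rewrite /gsys /tfshift -mulrDr.
  by rewrite [X in _ = _ * X]addrC subrK.
exact: normc_sqrD.
Qed.

Lemma qsumN g g' L s h : sqintegrable mu g -> sqintegrable mu g' ->
  sqintegrable mu h ->
  qsum mu (gsys (fun x => g x - g' x) L) s h = qsum mu (gsys (fun x => g' x - g x) L) s h.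
Proof.
move=> gi gi' hi; apply: eq_bigr => k _.
have -> : gsys (fun x => g x - g' x) L k = fun x => (-1) * gsys (fun x => g' x - g x) L k x.
  by apply/funext => x; rewrite /gsys /tfshift mulN1r -mulrN opprB.
have di : sqintegrable mu (fun x => g' x - g x) by exact: sqintegrableB.
have n1 : normc ((-1)^*%C : R[i]) = 1.
  by rewrite normc_conj normcN; exact: etrans (normcR 1) (normr1 R).
rewrite (innerZr (-1) (sqintegrable_gsys di L k) hi).
by move: (inner mu h _) => x; rewrite normcM n1 mul1r.
Qed.

Lemma qsum_le_size g L s h : sqintegrable mu g -> sqintegrable mu h ->
  qsum mu (gsys g L) s h <= (size s)%:R * (nrm2 mu h * nrm2 mu g).
Proof.
move=> gi hi; rewrite -sum1_size natr_sum mulr_suml; apply: ler_sum => k _.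
rewrite mul1r; have := CauchySchwarz2 hi (sqintegrable_gsys gi L k).
by rewrite nrm2_tfshift//; case: gi.
Qed.

Lemma bessel_leN g g' L (C : R) : sqintegrable mu g -> sqintegrable mu g' ->
  bessel_le (g \- g') L C -> bessel_le (g' \- g) L C.
Proof.
move=> gi gi' hC s h us hi; have E := qsumN L s gi' gi hi.
by apply: le_trans (hC s h us hi); rewrite le_eqVlt; apply/orP; left; apply/eqP; exact: E.
Qed.

Lemma bessel_leW g L (C C' : R) : C <= C' -> bessel_le g L C -> bessel_le g L C'.
Proof.
move=> CC hC s h us hi; apply: le_trans (hC s h us hi) _.
by apply: ler_wpM2r => //; exact: nrm2_ge0.
Qed.

(** By [qsum_window] a lower bound [A] for [g] gives [(A - 2 * (A / 8)) / 2] for [g']. *)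
Lemma frame_low_window g g' L (A : R) : 0 < A -> sqintegrable mu g ->
  sqintegrable mu g' -> frame_low mu (gsys g L) A ->
  bessel_le (g \- g') L (A / 8) -> frame_low mu (gsys g' L) (A / 4).
Proof.
move=> A0 gi gi' fA hC h hi; have [s us hs] := fA h hi; exists s; first exact: us.
have h1 := qsum_window L s gi gi' hi.
have h2 := hC s h us hi; have AN := mulr_ge0 (ltW A0) (nrm2_ge0 mu h).
move: hs h1 h2 AN; rewrite -[(fun x => g x - g' x)]/(g \- g').
move: (qsum _ _ _ _) (qsum _ _ _ _) (qsum _ _ _ _) (nrm2 _ _) => q0 q1 q2 N.
lra.
Qed.

(** The squared Heisenberg norm of a difference of windows is the best Bessel
    bound of the difference, which is what [frame_low_window] asks for. *)
Lemma heis_norm_lt g L (e : R) : sqintegrable mu g -> 0 < e ->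
  (heis_norm L g < e%:E)%E -> bessel_le g L (e ^+ 2).
Proof.
move=> gi e0 /ereal_inf_lt[_ [C hC <-]]; rewrite lte_fin => Ce s h us hi.
apply: le_trans (bessel_bound_le gi hC us hi) _; apply: ler_wpM2r; first exact: nrm2_ge0.
have C0 : 0 <= C by case: hC => /ltW.
by rewrite -(sqr_sqrtr C0) ler_sqr ?nnegrE ?sqrtr_ge0 ?ltW.
Qed.

Lemma heis_norm_le g L (e : R) : 0 < e -> bessel_le g L (e ^+ 2) ->
  (heis_norm L g <= e%:E)%E.
Proof.
move=> e0 hg; apply: ereal_inf_lbound; exists (e ^+ 2).
  by apply: bessel_le_bound => //; rewrite exprn_gt0.
by rewrite sqrtr_sqr gtr0_norm.
Qed.

(** Take a term [u N] far in the Cauchy sequence that defines [f0]. For a fixed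
    finite set of indices the square sum is continuous in L^2, so that the Bessel
    inequality for [u k - u N] passes to the limit in [k]. *)
Lemma heisenberg_approx L (f0 : L2 R d) (e : R) : 0 < e ->
  heisenberg_module L f0 -> exists2 f : L2 R d, M1nu R d f &
    bessel_le (f0 \- f) L (e ^+ 2).
Proof.
move=> e0 [u [uM uC uf]].
have [|N hN] := uC (e / 2); first by rewrite divr_gt0.
exists (u N) => // s h us hi.
have f0i := sqintegrable_L2 f0; have ui k := sqintegrable_L2 (u k).
have dN : sqintegrable mu (f0 \- u N) by exact: sqintegrableB.
apply/ler_addgt0Pr => eps eps0.
(* the accuracy in L^2 that makes the square sum over [s] smaller than [eps] *)
pose K := 2 * ((size s)%:R * nrm2 mu h) + 1.
have K0 : 0 < K by rewrite ltr_wpDl// mulr_ge0// mulr_ge0// nrm2_ge0.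
have [k [kN hk]] : exists k, (N <= k)%N /\ nrm2 mu (u k \- f0) <= eps / K.
  have : \forall k \near \oo, (sqnorm mu (u k \- f0)%R < (eps / K)%:E)%E.
    have eK0 : 0 < eps / K by rewrite divr_gt0.
    exact: (uf _ (@nbhs_open_ereal_lt R 0 (fun=> eps / K) eK0)).
  move=> [N' _ hN']; exists (maxn N N'); split; first exact: leq_maxl.
  have := hN' (maxn N N') (leq_maxr _ _); rewrite -nrm2E; first by rewrite lte_fin => /ltW.
  exact: sqintegrableB.
have h1 := heis_norm_lt (sqintegrableB (ui k) (ui N)) _ (hN k N kN (leqnn N)).
have {h1} h1 : qsum mu (gsys (u k \- u N) L) s h <= (e / 2) ^+ 2 * nrm2 mu h.
  by apply: h1 => //; rewrite divr_gt0.
have h2 := qsum_window L s dN (sqintegrableB (ui k) (ui N)) hi.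
have h3 : qsum mu (gsys (fun x => (f0 \- u N) x - (u k \- u N) x) L) s h <=
    (size s)%:R * (nrm2 mu h * (eps / K)).
  have -> : (fun x => (f0 \- u N) x - (u k \- u N) x) = (fun x => f0 x - u k x).
    by apply/funext => x /=; rewrite opprB addrA subrK.
  rewrite qsumN//; apply: le_trans (qsum_le_size L s (sqintegrableB (ui k) f0i) hi) _.
  by apply: ler_wpM2l => //; apply: ler_wpM2l; first exact: nrm2_ge0.
apply: le_trans h2 _.
have n0 := nrm2_ge0 mu h.
have h4 : 2 * ((size s)%:R * (nrm2 mu h * (eps / K))) <= eps.
  rewrite !mulrA ler_pdivrMr// mulrC -!mulrA; apply: ler_wpM2l; first exact: ltW.
  by rewrite /K lerDl.
have h5 : 2 * ((e / 2) ^+ 2 * nrm2 mu h) <= e ^+ 2 * nrm2 mu h.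
  rewrite mulrA; apply: ler_wpM2r => //.
  have := sqr_ge0 e; rewrite exprMn; lra.
by apply: lerD; [apply: le_trans h5; rewrite ler_pM2l|apply: le_trans h4; rewrite ler_pM2l].
Qed.

End gabor_sums.

Section topology.
Context (R : realType) (d : nat).

Lemma open_heis_basic (f : L2 R d) (e : R) : M1nu R d f -> 0 < e ->
  open (@heis_basic R d f setT e).
Proof.
move=> fM e0; exists [set heis_basic f setT e].
  move=> _ ->; apply: (@finI_from1 _ _ (@heis_basics R d) id).
  by exists f, setT, e; split => //; exact: openT.
by rewrite bigcup_set1.
Qed.

Lemma near_mnorm (L0 : GL R (d + d)) (eta : R) : 0 < eta ->
  \forall L \near L0, mnorm (sval L - sval L0) <= eta.
Proof.
move=> eta0; pose e : R := eta / ((d + d)%:R * (d + d)%:R + 1).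
have m0 : 0 < (d + d)%:R * (d + d)%:R + 1 :> R by rewrite ltr_wpDl// mulr_ge0.
have e0 : 0 < e by rewrite divr_gt0.
have cont : continuous (fun L : GL R (d + d) => sval L).
  exact: (@initial_continuous _ _ set_val).
have : \forall L \near L0, ball (sval L0) e (sval L).
  by apply: cont; exact: nbhsx_ballx.
apply: filterS => L [_ hL].
apply: (@le_trans _ _ (\sum_(i < d + d) \sum_(j < d + d) e)).
  apply: ler_sum => i _; apply: ler_sum => j _.
  have := hL i j; rewrite /ball/= => /ltW; rewrite distrC.
  by rewrite !mxE.
rewrite !sumr_const !card_ord -mulrnA -mulr_natl natrM /e.
by rewrite mulrA ler_pdivrMr// [leRHS]mulrC ler_wpM2r ?lerDl// ltW.
Qed.

Lemma small_square (a : R) : 0 < a ->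
  exists2 e : R, 0 < e & e ^+ 2 <= a.
Proof.
move=> a0; exists (Num.sqrt a); first by rewrite sqrtr_gt0.
by rewrite sqr_sqrtr// ltW.
Qed.

Lemma near_preimage (T U : topologicalType) (Y : T -> U) (x : T) (W : set U) :
  continuous Y -> nbhs (Y x) W -> \forall t \near x, W (Y t).
Proof. by move=> cY nW; exact: (cY x _ nW). Qed.

Lemma near_section (Y : GL R (d + d) -> heis_bundle R d) (L0 : GL R (d + d))
  (f : L2 R d) (e : R) : continuous_sections R d Y -> M1nu R d f -> 0 < e ->
  heis_basic f setT e (Y L0) -> \forall L \near L0, heis_basic f setT e (Y L).
Proof.
move=> [cY _] fM e0 Y0; have nW : nbhs (Y L0) (heis_basic f setT e).
  by apply: open_nbhs_nbhs; split; [exact: open_heis_basic|exact: Y0].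
exact: (near_preimage cY nW).
Qed.

End topology.

Theorem theorem3p28 (R : realType) (d : nat) (hd : (1 <= d)%N)
    (L0 : GL R (d + d)) (f0 : L2 R d)
    (hf0 : heisenberg_module (sval L0) f0)
    (hframe : gabor_frame f0 (sval L0))
    (Upsilon : GL R (d + d) -> heis_bundle R d)
    (hUpsilon : continuous_sections R d Upsilon)
    (hUpsilon0 : heis_vec (Upsilon L0) = f0) :
  exists U0 : set (GL R (d + d)),
    [/\ open U0, U0 L0 &
        forall L, U0 L -> gabor_frame (heis_vec (Upsilon L)) (sval L)].
Proof.
have [A [B1 [A0 _ hA]]] := hframe.
have f0i := sqintegrable_L2 f0.
have fA0 : frame_low (lebesgue_cV d) (gsys f0 (sval L0)) (A / 2).
  apply: (frame_lowP (A := A)) => //; [by rewrite divr_gt0|lra|].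
  by move=> u; have [] := hA u.
have A20 : 0 < A / 2 by rewrite divr_gt0.
have [e e0 e2A] : exists2 e : R, 0 < e & e ^+ 2 <= A / 2 / 4 / 16 / 8.
  by apply: small_square; rewrite !divr_gt0.
clear hA hframe.
have eh : 0 < e / 2 by rewrite divr_gt0.
have [f fM hf] := heisenberg_approx eh hf0.
have fi := sqintegrable_L2 f.
have fA : frame_low (lebesgue_cV d) (gsys f (sval L0)) (A / 2 / 4).
  apply: (frame_low_window A20 f0i fi fA0); apply: bessel_leW hf.
  by rewrite exprMn; have := sqr_ge0 e; lra.
have A80 : 0 < A / 2 / 4 by rewrite !divr_gt0.
have uL0 : sval L0 \in unitmx by have := svalP L0; rewrite inE.
have [eta [B [eta0 B0 hdef]]] := frame_deformation fi fM uL0 A80 fA.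
have Y0 : heis_basic f setT e (Upsilon L0).
  split => //; rewrite hUpsilon0 hUpsilon.2.
  apply: le_lt_trans (heis_norm_le eh hf) _; rewrite lte_fin; lra.
have near1 : \forall L \near L0, heis_basic f setT e (Upsilon L).
  exact: near_section Y0.
exists [set L | heis_basic f setT e (Upsilon L) /\ mnorm (sval L - sval L0) <= eta]^°.
split; first exact: open_interior.
  by apply: filterI => //; exact: near_mnorm.
move=> L /interior_subset[[_ +] Leta]; rewrite hUpsilon.2.
set g := heis_vec (Upsilon L) => hg.
have gi := sqintegrable_L2 g.
have di : sqintegrable (lebesgue_cV d) (g \- f) by exact: sqintegrableB.
have bd := heis_norm_lt di e0 hg.
have uL : sval L \in unitmx by have := svalP L; rewrite inE.
have [fL fB] := hdef _ uL Leta.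
have AL : 0 < A / 2 / 4 / 16 by rewrite !divr_gt0.
apply: (@gabor_frameP _ _ g (sval L) (A / 2 / 4 / 16 / 4) (2 * B + 2 * e ^+ 2)).
- by rewrite divr_gt0.
- by rewrite addr_gt0 ?mulr_gt0// exprn_gt0.
- apply: (frame_low_window AL fi gi fL); apply: bessel_leN => //.
  by apply: bessel_leW bd; lra.
- move=> s h us hi; apply: le_trans (qsum_window (sval L) s gi fi hi) _.
  have h1 := fB s h us hi; have h2 := bd s h us hi.
  move: h1 h2; rewrite -[(fun x => g x - f x)]/(g \- f).
  by move: (qsum _ _ _ _) (qsum _ _ _ _) (nrm2 _ _) => q0 q1 N; lra.
Qed.
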